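(* Let $\phi(z)=bz+cz^2+\int_{(0,\infty)}(e^{-zu}-1+zu)\,m(du)$ be a branching mechanism with $\delta:=\phi'(\infty)<\infty$. Let $\beta>0$ and let $N_\beta=\sum_{i=1}^\infty\delta_{(s_i,w_i)}$ be a Poisson random measure on $(0,\infty)\times D[0,\infty)$ with intensity $\beta\delta^{-1}(1-e^{-\delta s})\,ds\,\mathbf{N}_m(dw)$, where $$\mathbf{N}_m(dw)=\int_{(0,\infty)}m(dx)\,\mathbf{Q}_x(dw).$$ For $t\ge 0$ let $$Y_t^\beta=\beta\delta^{-1}(1-e^{-\delta t})+\int_{(0,t]}\int_{D[0,\infty)}w(t-s)\,N_\beta(ds,dw)$$ and let $\mathcal{G}_t^\beta$ be the $\sigma$-algebra generated by the random variables $\{N_\beta((0,u]\times A):A\in\mathcal{A}_{t-u},\,0\le u\le t\}$. Then $\{(Y_t^\beta,\mathcal{G}_t^\beta):t\ge 0\}$ is a CBI-process with branching mechanism $\phi$ and immigration mechanism $\psi_\beta$ defined by $\psi_\beta(\lambda)=\beta\lambda$, $\lambda\ge 0$. (Here $\delta^{-1}(1-e^{-\delta s})$ is read as $s$ if $\delta=0$.)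
   Context: In a branching mechanism, $b\in\mathbb{R}$, $c\ge 0$ and $m$ is a $\sigma$-finite measure on $(0,\infty)$ with $\int_{(0,\infty)}(u\wedge u^2)\,m(du)<\infty$; $\phi'(\infty)=\lim_{z\to\infty}\phi'(z)=b+2c\cdot\infty+\int_{(0,\infty)}u\,m(du)$ with $0\cdot\infty=0$. For $\lambda\ge 0$, $t\mapsto v_t(\lambda)$ is the unique nonnegative solution of $v_t(\lambda)=\lambda-\int_0^t\phi(v_s(\lambda))\,ds$. $(Q_t)_{t\ge 0}$ is the (Feller) transition semigroup on $[0,\infty)$ given by $\int_{[0,\infty)}e^{-\lambda y}Q_t(x,dy)=e^{-xv_t(\lambda)}$; the CB-process with branching mechanism $\phi$ is the Markov process in $[0,\infty)$ with this semigroup. A pair $\{(Y_t,\mathcal{G}_t):t\ge 0\}$ is a CBI-process with branching mechanism $\phi$ and immigration mechanism $\psi$ if $Y$ is a $[0,\infty)$-valued Markov process relative to $(\mathcal{G}_t)$ with transition semigroup $(P_t)_{t\ge 0}$ given by $\int_{[0,\infty)}e^{-\lambda y}P_t(x,dy)=\exp\{-xv_t(\lambda)-\int_0^t\psi(v_s(\lambda))\,ds\}$. $D[0,\infty)$ is the space of nonnegative càdlàg paths $w$ on $[0,\infty)$; $\mathcal{A}=\sigma(\{w(s):0\le s<\infty\})$, $\mathcal{A}_t=\sigma(\{w(s):0\le s\le t\})$. $\mathbf{Q}_x$ is the law on $(D[0,\infty),\mathcal{A})$ of the CB-process started from $x$.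
   Formalization: Y_t^β is shown finite almost surely (set to 0 on the exceptional null set), and ''Markov relative to G_t^β'' is taken up to null sets: Y_t^β is only a.s. equal to a G_t^β-measurable variable, since strict adaptedness to the uncompleted G_t^β fails. *)

(* Defs.v *)
From HB Require Import structures.
From mathcomp Require Import all_boot all_order all_algebra.
From mathcomp Require Import all_classical all_reals all_analysis.
From mathcomp Require Import measurable_realfun.

Set Implicit Arguments.
Unset Strict Implicit.
Unset Printing Implicit Defensive.

Import Order.TTheory GRing.Theory Num.Theory.
Import numFieldNormedType.Exports.

Local Open Scope classical_set_scope.
Local Open Scope ring_scope.

(* Measures on (0, oo) and on [0, oo) are represented by measures on the real
   line, and integrals against them are taken over the half-line, so that only
   the restriction of the measure to the half-line matters. In the same way,
   families indexed by time or by a starting point in [0, oo) are indexed by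
   all reals, but are constrained and used at nonnegative indices only. *)

Section branching_mechanism.
Context {R : realType}.
Implicit Types (phi : R -> R) (v : R -> R -> R).

Definition branching_mechanism (b c : R)
    (m : {measure set (measurableTypeR R) -> \bar R}) (z : R) : R :=
  b * z + c * z ^+ 2 +
  \int[m]_(u in `]0, +oo[) (expR (- (z * u)) - 1 + z * u).

Definition derive_at_infty phi : \bar R :=
  lim ((derive1 phi z)%:E @[z --> +oo]).

(* v t lambda stands for v_t(lambda); integrability is spelled out because the
   integral is a total operation. *)
Definition is_cumulant phi v : Prop :=
  forall t lambda, 0 <= t -> 0 <= lambda ->
  [/\ 0 <= v t lambda,
      lebesgue_measure.-integrable `[0, t]
        (fun s => (phi (v s lambda))%:E) &
      v t lambda =
        lambda - \int[lebesgue_measure]_(s in `[0, t]) phi (v s lambda)].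

End branching_mechanism.

Section semigroups.
Context {R : realType}.
Variables (psi : R -> R) (v : R -> R -> R).
Variable K : R -> R.-pker (measurableTypeR R) ~> (measurableTypeR R).

Definition transition_semigroup : Prop :=
  [/\ forall (t x : R), 0 <= t -> 0 <= x -> K t x `[0, +oo[%classic = 1%E,
      forall (x : R) B, 0 <= x -> measurable B -> K 0 x B = \d_x B &
      forall (s t x : R) B, 0 <= s -> 0 <= t -> 0 <= x -> measurable B ->
        K (s + t) x B = (\int[K s x]_(y in `[0%R, +oo[) K t y B)%E].

Definition CB_semigroup : Prop :=
  transition_semigroup /\
  forall t x lambda : R, 0 <= t -> 0 <= x -> 0 <= lambda ->
    (\int[K t x]_(y in `[0%R, +oo[) (expR (- (lambda * y)))%:E)%E =
    (expR (- (x * v t lambda)))%:E.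

Definition CBI_semigroup : Prop :=
  transition_semigroup /\
  forall t x lambda : R, 0 <= t -> 0 <= x -> 0 <= lambda ->
    (\int[K t x]_(y in `[0%R, +oo[) (expR (- (lambda * y)))%:E)%E =
    (expR (- (x * v t lambda)
           - \int[lebesgue_measure]_(s in `[0, t]) psi (v s lambda)))%:E.

End semigroups.

Section markov_processes.
Context {R : realType} d (Omega : measurableType d).
Implicit Types (P : {measure set Omega -> \bar R}) (H : set (set Omega))
  (G : R -> set (set Omega)) (X : R -> Omega -> measurableTypeR R).

Definition filtration G : Prop :=
  (forall t, 0 <= t -> sigma_algebra setT (G t) /\ G t `<=` measurable) /\
  (forall s t, 0 <= s -> s <= t -> G s `<=` G t).

(* Measurability with respect to a sub-sigma-algebra is understood up to a null
   set, because filtrations are not assumed to be complete. This matters for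
   immigration_filtration below: from an atom (s, w) it sees w up to time u
   for every u < t - s, but the value w (t - s) only for countably many s per
   event, so the process at time t agrees with a random variable measurable
   for it almost surely, but not everywhere in general. *)
Definition ae_measurable P H d' (T : measurableType d') (f : Omega -> T) :=
  exists g : Omega -> T,
    (forall B, measurable B -> H (g @^-1` B)) /\ f = g %[ae P].

Definition cond_prob_version P H (A : set Omega) (f : Omega -> \bar R) :=
  ae_measurable P H f /\
  forall C, H C -> P (A `&` C) = (\int[P]_(w in C) f w)%E.

Definition markov_process P G
    (K : R -> R.-pker (measurableTypeR R) ~> (measurableTypeR R)) X : Prop :=
  [/\ filtration G,
      forall t w, 0 <= t -> 0 <= (X t w : R),
      forall t, 0 <= t -> measurable_fun setT (X t) /\ ae_measurable P (G t) (X t) &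
      forall t r B, 0 <= t -> 0 <= r -> measurable B ->
        cond_prob_version P (G t) (X (t + r) @^-1` B)
          (fun w => K r (X t w) B)].

Definition CBI_process (phi psi : R -> R) P G X : Prop :=
  exists v K,
    [/\ is_cumulant phi v, CBI_semigroup psi v K & markov_process P G K X].

End markov_processes.

(* The value 0 at negative times only makes the encoding of a path on [0, oo)
   as a function on R unique. *)
Record cadlag_path (R : realType) := CadlagPath {
  path_fun :> R -> R ;
  path_lt0 : forall t, t < 0 -> path_fun t = 0 ;
  path_ge0 : forall t, 0 <= t -> 0 <= path_fun t ;
  path_right : forall t, 0 <= t -> path_fun s @[s --> t^'+] --> path_fun t ;
  path_left : forall t, 0 < t -> cvg (path_fun s @[s --> t^'-]) }.

Section path_space.
Context (R : realType).

HB.instance Definition _ := gen_eqMixin (cadlag_path R).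
HB.instance Definition _ := gen_choiceMixin (cadlag_path R).

Let zero_path : cadlag_path R.
Proof.
refine (@CadlagPath R (fun=> 0) _ _ _ _) => // t _; first exact: cvg_cst.
by apply/cvg_ex; exists 0; exact: cvg_cst.
Defined.

HB.instance Definition _ := isPointed.Build (cadlag_path R) zero_path.

Definition coordinate_events (I : set R) : set (set (cadlag_path R)) :=
  \bigcup_(s in I) preimage_set_system setT
    (fun w : cadlag_path R => w s : measurableTypeR R) measurable.

Definition D := g_sigma_algebraType (coordinate_events `[0, +oo[).

Definition path_filtration (t : R) : set (set D) :=
  <<s coordinate_events `[0, t] >>.

End path_space.

(* Q x is the law on path space of the CB-process started from x, that is, the
   law under which the coordinate process is such a process. *)
Definition CB_law (R : realType) (phi : R -> R)
    (Q : R.-pker (measurableTypeR R) ~> (D R)) : Prop :=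
  exists v K,
    [/\ is_cumulant phi v, CB_semigroup v K &
        forall x, 0 <= x ->
          markov_process (Q x) (@path_filtration R) K (fun t w => w t) /\
          Q x [set w : D R | w 0 = x] = 1%E].

Section poisson_random_measure.
Context {R : realType} d (Omega : measurableType d) d' (E : measurableType d').

(* The mass function is written out because the library's poisson_pmf is
   constantly 1 at parameter 0. *)
Definition poisson_random_measure (P : probability Omega R)
    (mu : {measure set E -> \bar R})
    (N : Omega -> {measure set E -> \bar R}) : Prop :=
  [/\ forall w, exists (I : set nat) (z : nat -> E), forall A, measurable A ->
        N w A = \esum_(i in I) \d_(z i) A,
      forall A, measurable A -> measurable_fun setT (fun w => N w A),
      forall A (k : nat), measurable A -> (mu A < +oo)%E ->
        P [set w | N w A = k%:R%:E] =
        (fine (mu A) ^+ k / k`!%:R * expR (- fine (mu A)))%:E,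
      forall A, measurable A -> mu A = +oo%E -> P [set w | N w A = +oo%E] = 1%E &
      forall n (A : 'I_n -> set E) (B : 'I_n -> set (\bar R)),
        (forall i, measurable (A i)) -> trivIset setT A ->
        (forall i, measurable (B i)) ->
        P (\bigcap_(i in [set: 'I_n]) [set w | B i (N w (A i))]) =
        (\prod_(i < n) P [set w | B i (N w (A i))])%E].

End poisson_random_measure.

Section intensity.
Context {R : realType}.

Definition clock (delta t : R) : R :=
  if delta == 0 then t else delta^-1 * (1 - expR (- (delta * t))).

Lemma clock_ge0 delta t : 0 <= t -> 0 <= clock delta t.
Proof.
rewrite /clock => t0; have [d0|d0|_] := ltgtP delta 0 => //.
- rewrite nmulr_rge0 ?invr_lt0// subr_le0 -[leLHS]expR0 ler_expR.
  by rewrite oppr_ge0 mulr_le0_ge0// ltW.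
- rewrite pmulr_rge0 ?invr_gt0// subr_ge0 -[leRHS]expR0 ler_expR.
  by rewrite oppr_le0 mulr_ge0// ltW.
Qed.

Lemma clock_le delta n t : 0 <= t -> t <= n ->
  clock delta t <= n + `|delta^-1| * (1 + expR (`|delta| * n)).
Proof.
move=> t0 tn; have n0 := le_trans t0 tn; rewrite /clock; case: ifPn => _.
  by rewrite (le_trans tn)// lerDl mulr_ge0// addr_ge0// expR_ge0.
rewrite (le_trans (ler_norm _))// normrM.
rewrite (@le_trans _ _ (`|delta^-1| * (1 + expR (`|delta| * n))))//; last first.
  by rewrite lerDr.
rewrite ler_wpM2l// (le_trans (ler_normB _ _))// normr1 lerD2l.
rewrite ger0_norm ?expR_ge0// ler_expR (le_trans (ler_norm _))// normrN normrM.
by rewrite (ger0_norm t0) ler_wpM2l.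
Qed.

Lemma measurable_clock delta :
  measurable_fun setT (clock delta : measurableTypeR R -> measurableTypeR R).
Proof.
rewrite /clock; case: eqP => _; first exact: measurable_id.
apply: measurable_funM => //; apply: measurable_funB => //.
by apply: measurableT_comp => //; apply: measurableT_comp => //; exact: measurable_funM.
Qed.

Definition immigration_times (beta : {posnum R}) (delta : R)
    (B : set (measurableTypeR R)) : \bar R :=
  (\int[lebesgue_measure]_(s in B `&` `]0%R, +oo[)
    (beta%:num * clock delta s)%:E)%E.

Section immigration_times_measure.
Variables (beta : {posnum R}) (delta : R).
Let f (s : measurableTypeR R) : \bar R := (beta%:num * clock delta s)%:E.
Let nu := immigration_times beta delta.

Let f_ge0 s : 0 <= s -> (0 <= f s)%E.
Proof. by move=> s0; rewrite lee_fin mulr_ge0// clock_ge0. Qed.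

Let mf A : measurable_fun A f.
Proof.
apply: measurable_funTS; apply/measurable_EFinP; apply: measurable_funM => //.
exact: measurable_clock.
Qed.

Let nu0 : nu set0 = 0%E.
Proof. by rewrite /nu /immigration_times set0I integral_set0. Qed.

Let nu_ge0 A : (0 <= nu A)%E.
Proof.
apply: integral_ge0 => s [_ /=]; rewrite in_itv/= andbT => s0.
exact/f_ge0/ltW.
Qed.

Let nu_sigma_additive : semi_sigma_additive nu.
Proof.
move=> F mF tF mUF.
rewrite /nu /immigration_times setI_bigcupl ge0_integral_bigcup; last first.
- exact: trivIset_setIr.
- move=> s [k _ [_ /=]]; rewrite in_itv/= andbT => s0.
  exact/f_ge0/ltW.
- exact: mf.
- by move=> k; exact: measurableI.
apply: is_cvg_nneseries => n _ _.
apply: integral_ge0 => s [_ /=]; rewrite in_itv/= andbT => s0.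
exact/f_ge0/ltW.
Qed.

HB.instance Definition _ := isMeasure.Build _ _ _
  (immigration_times beta delta) nu0 nu_ge0 nu_sigma_additive.

Let nu_sigma_finite : sigma_finite setT nu.
Proof.
exists (fun n : nat => `]-oo, n%:R]%classic).
  apply/esym/seteqP; split=> // s _; exists (Num.Def.truncn `|s|).+1 => //=.
  by rewrite in_itv/= (le_trans (ler_norm _))// ltW// truncnS_gt.
move=> n; split; first exact: measurable_itv.
pose M := beta%:num *
  (n%:R + `|delta^-1| * (1 + expR (`|delta| * n%:R))).
have E : `]-oo, n%:R] `&` `]0, +oo[ = `]0, n%:R]%classic :> set R.
  apply/seteqP; split => s /=; rewrite !in_itv/= andbT.
    by move=> [-> ->].
  by move=> /andP[-> ->].
rewrite /nu /immigration_times E.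
apply: (@le_lt_trans _ _
    (\int[lebesgue_measure]_(s in `]0%R, n%:R] : set R) M%:E)%E).
  apply: ge0_le_integral => //.
  - by move=> s /=; rewrite in_itv/= => /andP[s0 _]; exact/f_ge0/ltW.
  - move=> s /=; rewrite in_itv/= => /andP[s0 sn].
    by rewrite lee_fin ler_wpM2l// clock_le// ltW.
rewrite integral_cst//= lebesgue_measure_itv/=; case: ifPn => _.
  by rewrite -EFinB -EFinM ltry.
by rewrite mule0.
Qed.

HB.instance Definition _ := @Measure_isSigmaFinite.Build _ _ _
  (immigration_times beta delta) nu_sigma_finite.

End immigration_times_measure.

Definition mixed_path_law (m : {measure set (measurableTypeR R) -> \bar R})
    (Q : R.-pker (measurableTypeR R) ~> (D R)) (A : set (D R)) : \bar R :=
  (\int[m]_(x in `]0%R, +oo[) Q x A)%E.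

Section mixed_path_law_measure.
Variables (m : {measure set (measurableTypeR R) -> \bar R})
  (Q : R.-pker (measurableTypeR R) ~> (D R)).

Let law0 : mixed_path_law m Q set0 = 0%E.
Proof. by rewrite /mixed_path_law integral0_eq// => x _; rewrite measure0. Qed.

Let law_ge0 A : (0 <= mixed_path_law m Q A)%E.
Proof. exact: integral_ge0. Qed.

Let law_sigma_additive : semi_sigma_additive (mixed_path_law m Q).
Proof.
move=> F mF tF mUF; rewrite /mixed_path_law.
rewrite [X in _ --> X](_ : _ =
    (\sum_(n <oo) \int[m]_(x in `]0%R, +oo[) Q x (F n))%E); last first.
  rewrite -integral_nneseries//.
    apply: eq_integral => x _; apply/esym/cvg_lim => //.
    exact: measure_semi_sigma_additive.
  by move=> n; apply: measurable_funTS; exact: measurable_kernel.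
by apply: is_cvg_nneseries => n _ _; exact: integral_ge0.
Qed.

HB.instance Definition _ := isMeasure.Build _ _ _
  (mixed_path_law m Q) law0 law_ge0 law_sigma_additive.

End mixed_path_law_measure.

(* The product \x^ only requires its first factor to be sigma-finite. *)
Definition immigration_intensity (beta : {posnum R}) (delta : R)
    (m : {measure set (measurableTypeR R) -> \bar R})
    (Q : R.-pker (measurableTypeR R) ~> (D R)) :
    {measure set (measurableTypeR R * D R) -> \bar R} :=
  (immigration_times beta delta \x^ mixed_path_law m Q)%E.

End intensity.

Section construction.
Context {R : realType} d (Omega : measurableType d).
Variables (beta delta : R).
Variable N : Omega -> {measure set (measurableTypeR R * D R) -> \bar R}.

Definition immigration_sum (t : R) (w : Omega) : \bar R :=
  ((beta * clock delta t)%:E +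
   \int[N w]_(z in (`]0%R, t] : set (measurableTypeR R)) `*` [set: D R])
     (z.2 (t - z.1)%R)%:E)%E.

Definition immigration_filtration (t : R) : set (set Omega) :=
  <<s \bigcup_(uA in [set uA : R * set (D R) |
                     0 <= uA.1 <= t /\ path_filtration (t - uA.1) uA.2])
        preimage_set_system setT
          (fun w => N w ((`]0%R, uA.1] : set (measurableTypeR R)) `*` uA.2))
          measurable >>.

End construction.

(* Main.v *)
(** As [delta] is finite, [phi z = delta * z - \int (1 - exp (- z u)) m(du)].
    Let [f] be a nonnegative function of the atoms as they are observed up to
    time [t]. By Campbell's formula, [E [exp (- N f - lambda Y_{t+r})]] is the
    exponential of an integral against the intensity. In this integral the Markov
    property of the CB-process at age [t - s] replaces the path value of an atom
    [(s, w)] at age [t + r - s] by that at age [t - s] and [lambda] by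
    [v_r(lambda)], while the atoms with [t < s <= t + r] and the deterministic
    part of [Y] contribute a constant, which the equations for [v] and for the
    clock [delta^-1 (1 - exp (- delta s))] identify as
    [\int_0^r beta v_s(lambda) ds]. Thus
      [E [exp (- N f) exp (- lambda Y_{t+r})]
       = E [exp (- N f) exp (- \int_0^r beta v_s(lambda) ds - v_r(lambda) Y_t)]],
    and the method of moments together with a monotone class argument turns this
    into the conditional law of [Y_{t+r}] given the past. The semigroup of the
    CBI-process is that of the sums of a CB-process and an independent copy of
    [Y]. *)

Require Import Defs.
From HB Require Import structures.
From mathcomp Require Import all_boot all_order all_algebra.
From mathcomp Require Import all_classical all_reals all_analysis.
From mathcomp Require Import measurable_realfun finmap ring lra.

Set Implicit Arguments.
Unset Strict Implicit.
Unset Printing Implicit Defensive.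

Import Order.TTheory GRing.Theory Num.Theory.
Import numFieldNormedType.Exports.

Local Open Scope classical_set_scope.
Local Open Scope ring_scope.

(** * Integration tools *)

Section measurable_induction.
Import HBNNSimple.

(** Integrals against [N] may be infinite, so Laplace functionals are written with [enexp], which is
    0 at [+oo]. The value [N F = +oo] is then treated like any other, and the almost sure finiteness
    of [Y_t] comes afterwards, by letting [lambda] tend to 0. Laplace transforms are compared at
    integers only: there they are the moments of [exp (- y)], a variable in [[0, 1]], and such
    moments determine a finite measure. The same device separates the events of the past:
    [f + k * \1_F] is again an admissible function, and it produces the moments of [exp (- N F)].
    The flow property of [v], its monotonicity and its limit at [lambda = 0] are read off the
    Laplace transforms of the given CB-semigroup, and the additivity of the immigration exponent off
    the identity for [Y] itself. The last obstacle is that the filtration at time [t] need not see a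
    path at the exact age [t - s]. It sees grid ages before that one, and the values there converge
    unless the path jumps at age [t - s]; for a fixed path this happens for countably many [s], a
    null set of the time intensity. *)

Lemma ge0_measurable_ind d (T : measurableType d) (R : realType)
    (Pr : (T -> \bar R) -> Prop) :
  (forall A, measurable A -> Pr (fun x => (\1_A x)%:E)) ->
  (forall (c : R) f, 0 <= c -> measurable_fun setT f ->
    (forall x, (0 <= f x)%E) -> Pr f -> Pr (fun x => (c%:E * f x)%E)) ->
  (forall f g, measurable_fun setT f -> (forall x, (0 <= f x)%E) -> Pr f ->
    measurable_fun setT g -> (forall x, (0 <= g x)%E) -> Pr g ->
    Pr (fun x => (f x + g x)%E)) ->
  (forall (f_ : (T -> \bar R)^nat) f, (forall n, measurable_fun setT (f_ n)) ->
    (forall n x, (0 <= f_ n x)%E) ->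
    (forall x, nondecreasing_seq (f_ ^~ x)) ->
    (forall x, f_ n x @[n --> \oo] --> f x) -> (forall n, Pr (f_ n)) -> Pr f) ->
  forall f, measurable_fun setT f -> (forall x, (0 <= f x)%E) -> Pr f.
Proof.
move=> indic scale add lim f mf f0.
pose f_ n := fun x => (nnsfun_approx measurableT mf n x)%:E.
apply: (lim f_) => //.
- by move=> n; apply/measurable_EFinP.
- by move=> n x; rewrite lee_fin.
- by move=> x n k nk; rewrite lee_fin; apply/lefP/nd_nnsfun_approx.
- by move=> x; exact: cvg_nnsfun_approx.
move=> n; rewrite /f_; move: (nnsfun_approx _ _ _) => g.
(* Expand the simple function over its finitely many values, all nonnegative, and induct on the list
   of values. *)
rewrite [X in Pr X](_ : _ = (fun x => (\sum_(y <- fset_set (range g))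
   (y%:E * (\1_(g @^-1` [set y]) x)%:E))%E)); last first.
  apply/funext => x; rewrite fimfunE fsbig_finite//= -sumEFin.
  by apply: eq_bigr => y _; rewrite EFinM.
have : forall y, y \in (fset_set (range g) : seq R) -> 0 <= y.
  by move=> y yg; have : y \in fset_set (range g) by [];
    rewrite in_fset_set// => /set_mem[x _ <-].
elim: (fset_set _ : seq R) => [_|y s IH s0].
  rewrite [X in Pr X](_ : _ = (fun x => (\1_set0 x)%:E)); first exact: indic.
  by apply/funext => x; rewrite big_nil indic0.
have y0 : 0 <= y by apply: s0; rewrite mem_head.
have {}s0 z : z \in s -> 0 <= z by move=> zs; apply: s0; rewrite inE zs orbT.
rewrite [X in Pr X](_ : _ = (fun x => ((y%:E * (\1_(g @^-1` [set y]) x)%:E) +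
    \sum_(j <- s) (j%:E * (\1_(g @^-1` [set j]) x)%:E))%E)); last first.
  by apply/funext => x; rewrite big_cons.
have m1 z : measurable_fun setT (fun x : T => (\1_(g @^-1` [set z]) x)%:E : \bar R).
  by apply/measurable_EFinP/measurable_indic.
apply: add; last exact: IH.
- exact: measurable_funeM.
- by move=> x; rewrite -EFinM lee_fin mulr_ge0.
- by apply: scale => //; exact: indic.
- by apply: emeasurable_sum => z; exact: measurable_funeM.
- move=> x; rewrite big_seq; apply: sume_ge0 => z zs.
  by rewrite -EFinM lee_fin mulr_ge0// s0.
Qed.

End measurable_induction.

Section mixture.
Context d1 (X : measurableType d1) d2 (Y : measurableType d2) (R : realType).
Variables (mu : {measure set X -> \bar R}) (D : set X) (mD : measurable D)
  (k : X -> {measure set Y -> \bar R})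
  (mk : forall A, measurable A -> measurable_fun setT (k ^~ A)).

(** The two proofs are arguments so that the measure structure, whose axioms rest on them, can be
    inferred from the term. *)
Definition mixture (_ : measurable D)
  (_ : forall A, measurable A -> measurable_fun setT (k ^~ A)) (A : set Y) : \bar R :=
  (\int[mu]_(x in D) k x A)%E.

Local Notation M := (mixture mD mk).

Let mix0 : M set0 = 0%E.
Proof. by rewrite /mixture integral0_eq. Qed.

Let mix_ge0 A : (0 <= M A)%E.
Proof. exact: integral_ge0. Qed.

Let mix_sigma_additive : semi_sigma_additive M.
Proof.
move=> F mF tF mUF; rewrite /mixture.
rewrite [X in _ --> X](_ : _ = (\sum_(n <oo) \int[mu]_(x in D) k x (F n))%E); last first.
  rewrite -integral_nneseries//.
    apply: eq_integral => x _; apply/esym/cvg_lim => //.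
    exact: measure_semi_sigma_additive.
  by move=> n; apply: measurable_funTS; exact: mk.
by apply: is_cvg_nneseries => n _ _; exact: integral_ge0.
Qed.

HB.instance Definition _ := isMeasure.Build _ _ _ M mix0 mix_ge0 mix_sigma_additive.

(** Stated for any [nu] that agrees with the mixture on measurable sets, so that it also
    disintegrates measures built otherwise: the intensity, or [K (s + t) x] by
    Chapman-Kolmogorov. *)
Lemma integral_mixture (nu : {measure set Y -> \bar R}) :
  (forall A, measurable A -> nu A = M A) ->
  forall f, measurable_fun setT f -> (forall y, (0 <= f y)%E) ->
  (\int[nu]_y f y = \int[mu]_(x in D) \int[k x]_y f y)%E.
Proof.
move=> nuM.
have mkf f : measurable_fun setT f -> (forall y, (0 <= f y)%E) ->
    measurable_fun D (fun x => \int[k x]_y f y)%E.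
  by move=> mf f0; apply: measurable_funTS; exact: measurable_fun_integral_kernel.
apply: ge0_measurable_ind.
- move=> A mA; rewrite integral_indic// setIT nuM//.
  by apply: eq_integral => x _; rewrite integral_indic// setIT.
- move=> c f c0 mf f0 IH; transitivity (c%:E * \int[nu]_y f y)%E; first exact: ge0_integralZl.
  rewrite [X in (_ * X)%E]IH; transitivity (\int[mu]_(x in D) (c%:E * \int[k x]_y f y))%E.
    rewrite [RHS]ge0_integralZl//; first exact: mkf.
    by move=> x _; exact: integral_ge0.
  by apply: eq_integral => x _; rewrite ge0_integralZl.
- move=> f g mf f0 If mg g0 Ig; transitivity (\int[nu]_y f y + \int[nu]_y g y)%E;
    first exact: ge0_integralD.
  rewrite [X in (X + _)%E]If [X in (_ + X)%E]Ig.
  transitivity (\int[mu]_(x in D) (\int[k x]_y f y + \int[k x]_y g y))%E.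
    rewrite [RHS]ge0_integralD//.
    - by move=> x _; exact: integral_ge0.
    - exact: mkf.
    - by move=> x _; exact: integral_ge0.
    - exact: mkf.
  by apply: eq_integral => x _; rewrite ge0_integralD.
- move=> f_ f mf_ f_0 nd fl IH.
  have limE y : f y = limn (f_ ^~ y) by apply/esym/cvg_lim => //; exact: fl.
  under eq_integral do rewrite limE.
  rewrite monotone_convergence//.
  under eq_fun do rewrite IH.
  rewrite -monotone_convergence//; last 3 first.
    by move=> n; exact: mkf.
    by move=> n x _; exact: integral_ge0.
    by move=> x _ n p np; apply: ge0_le_integral => // y _; exact: nd.
  apply: eq_integral => x _.
  under [in RHS]eq_integral do rewrite limE.
  by rewrite monotone_convergence.
Qed.

End mixture.

Lemma integrable_cst_fin d (T : measurableType d) (R : realType)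
    (mu : {measure set T -> \bar R}) (M : R) :
  (mu setT < +oo)%E -> mu.-integrable setT (fun=> M%:E).
Proof.
move=> muoo; apply/integrableP; split => //.
by rewrite integral_cst// lte_mul_pinfty// lee_fin.
Qed.

Lemma bounded_integrable d (T : measurableType d) (R : realType)
    (mu : {measure set T -> \bar R}) (f : T -> R) M :
  (mu setT < +oo)%E -> measurable_fun setT f -> (forall x, `|f x| <= M) ->
  mu.-integrable setT (EFin \o f).
Proof.
move=> muoo mf fM.
apply: (@le_integrable _ _ _ mu setT measurableT _ (fun=> M%:E)).
- exact/measurable_EFinP.
- by move=> x _ /=; rewrite lee_fin (le_trans (fM x))// ler_norm.
- exact: integrable_cst_fin.
Qed.

Lemma bounded_cvg_integral d (T : measurableType d) (R : realType)
    (mu : {measure set T -> \bar R}) (f_ : (T -> R)^nat) (f : T -> R) (M : R) :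
  (mu setT < +oo)%E -> (forall n, measurable_fun setT (f_ n)) ->
  (forall n x, `|f_ n x| <= M) -> (forall x, f_ n x @[n --> \oo] --> f x) ->
  (\int[mu]_x (f_ n x)%:E)%E @[n --> \oo] --> (\int[mu]_x (f x)%:E)%E.
Proof.
move=> muoo mf_ fM ff.
have mf : measurable_fun setT f.
  apply: (measurable_fun_cvg mf_) => x _; exact: ff.
have [] := @dominated_convergence _ _ _ mu setT measurableT
  (fun n x => (f_ n x)%:E) (fun x => (f x)%:E) (fun=> M%:E).
- by move=> n; apply/measurable_EFinP.
- by apply/measurable_EFinP.
- by apply/aeW => x _; apply: cvg_EFin; [exact: nearW|exact: ff].
- exact: integrable_cst_fin.
- by apply/aeW => x n _; rewrite lee_fin.
- by [].
Qed.

(** * Finite measures determined by the moments of a variable in [0, 1] *)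

Section moment_problem.
Context d (T : measurableType d) (R : realType).
Variables (mu1 mu2 : {measure set T -> \bar R}) (X : T -> R).
Hypotheses (mu1oo : (mu1 setT < +oo)%E) (mu2oo : (mu2 setT < +oo)%E).
Hypotheses (mX : measurable_fun setT (X : T -> measurableTypeR R)).
Hypothesis X01 : forall x, 0 <= X x <= 1.
Hypothesis moments : forall k, (\int[mu1]_x (X x ^+ k)%:E = \int[mu2]_x (X x ^+ k)%:E)%E.

Let X_norm x k : `|X x ^+ k| <= 1.
Proof.
have /andP[X0 X1] := X01 x.
by rewrite ger0_norm ?exprn_ge0// exprn_ile1.
Qed.

Let lin_integral (c : nat -> R) (e : nat -> nat) N :
  (\int[mu1]_x (\sum_(j < N) c j * X x ^+ e j)%:E =
   \int[mu2]_x (\sum_(j < N) c j * X x ^+ e j)%:E)%E.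
Proof.
have mXk k : measurable_fun setT (fun x => X x ^+ k) by exact: measurable_funX.
have intX (mu : {measure set T -> \bar R}) j : (mu setT < +oo)%E ->
    mu.-integrable setT (EFin \o (fun x => X x ^+ e j)).
  by move=> muoo; apply: (@bounded_integrable _ _ _ _ _ 1).
have H (mu : {measure set T -> \bar R}) : (mu setT < +oo)%E ->
    (\int[mu]_x (\sum_(j < N) c j * X x ^+ e j)%:E =
     \sum_(j < N) (c j)%:E * \int[mu]_x (X x ^+ e j)%:E)%E.
  move=> muoo; under eq_integral do rewrite -sumEFin.
  rewrite integral_sum//; last first.
    move=> j; under eq_fun do rewrite EFinM.
    by apply: integrableZl => //; exact: intX.
  apply: eq_bigr => j _; under eq_integral do rewrite EFinM.
  by rewrite integralZl//; exact: intX.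
rewrite !H//; apply: eq_bigr => j _; by rewrite moments.
Qed.

(* The exponentials of [- (X / a) ^+ n] are limits of polynomials in [X], and
   tend to the indicator of [X < a] away from [X = a]. *)
Let exp_integral (a : R) n : 0 < a ->
  (\int[mu1]_x (expR (- (X x / a) ^+ n))%:E =
   \int[mu2]_x (expR (- (X x / a) ^+ n))%:E)%E.
Proof.
move=> a0.
pose s N x := series (exp_coeff (- (X x / a) ^+ n)) N.
have sE N x : s N x = \sum_(j < N) ((-1) ^+ j * (a^-1) ^+ (n * j) / j`!%:R) * X x ^+ (n * j).
  rewrite /s /series /= big_mkord; apply: eq_bigr => j _; rewrite /exp_coeff /=.
  rewrite (exprNn ((X x / a) ^+ n)) -exprM (exprMn _ (X x)); ring.
have cvgs (mu : {measure set T -> \bar R}) : (mu setT < +oo)%E ->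
    (\int[mu]_x (s N x)%:E)%E @[N --> \oo] --> (\int[mu]_x (expR (- (X x / a) ^+ n))%:E)%E.
  (* As [X <= 1], the argument is at most [a^-1 ^+ n] in absolute value, and the partial sums of the
     exponential series there are bounded by its sum. *)
  move=> muoo; apply: (@bounded_cvg_integral _ _ _ _ _ _ (expR (a^-1 ^+ n))) => //.
  - move=> N; rewrite (funext (sE N)).
    by apply: measurable_sum => j; apply: measurable_funM => //; exact: measurable_funX.
  - move=> N x; rewrite /s.
    apply: (@le_trans _ _ (series (exp_coeff (a^-1 ^+ n)) N)).
      rewrite /series /= (le_trans (ler_norm_sum _ _ _))//; apply: ler_sum => j _.
      rewrite /exp_coeff /= normrM normfV normr_nat normrX normrN ler_pM2r ?invr_gt0 ?ltr0n
        ?fact_gt0//.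
      apply: lerXn2r; rewrite ?nnegrE ?exprn_ge0 ?invr_ge0 ?(ltW a0)//.
      have /andP[X0 X1] := X01 x.
      rewrite ger0_norm ?exprn_ge0 ?divr_ge0 ?(ltW a0)//.
      apply: lerXn2r; rewrite ?nnegrE ?divr_ge0 ?invr_ge0 ?(ltW a0)//.
      by rewrite ler_piMl// invr_ge0 ltW.
    apply: nondecreasing_cvgn_le; last exact: is_cvg_series_exp_coeff.
    apply/nondecreasing_seqP => k; rewrite /series /= big_nat_recr//= lerDl.
    by rewrite exp_coeff_ge0// exprn_ge0// invr_ge0 ltW.
  - by move=> x; exact: is_cvg_series_exp_coeff.
have := cvgs _ mu1oo; have := cvgs _ mu2oo.
have sI N : (\int[mu1]_x (s N x)%:E = \int[mu2]_x (s N x)%:E)%E.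
  under eq_integral do rewrite sE; under [RHS]eq_integral do rewrite sE.
  exact: (lin_integral (fun j => (-1) ^+ j * (a^-1) ^+ (n * j) / j`!%:R) (fun j => n * j)%N).
move=> h2; under eq_fun do rewrite sI.
by move=> h1; rewrite -(cvg_lim _ h1)// -(cvg_lim _ h2).
Qed.

(** The limit of [expR (- (y / a) ^+ n)] for [0 <= y]; at [y = a] every term is [expR (-1)]. *)
Let step (a y : R) : R := if y < a then 1 else if y == a then expR (-1) else 0.

Let step_integral a : 0 < a ->
  (\int[mu1]_x (step a (X x))%:E = \int[mu2]_x (step a (X x))%:E)%E.
Proof.
move=> a0.
have cvgs (mu : {measure set T -> \bar R}) : (mu setT < +oo)%E ->
    (\int[mu]_x (expR (- (X x / a) ^+ n))%:E)%E @[n --> \oo] --> (\int[mu]_x (step a (X x))%:E)%E.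
  move=> muoo; apply: (@bounded_cvg_integral _ _ _ _ _ _ 1) => //.
  - move=> n; apply: measurableT_comp => //; apply: measurableT_comp => //.
    by apply: measurable_funX; apply: measurable_funM.
  - move=> n x; rewrite ger0_norm ?expR_ge0// expR_le1 oppr_le0 exprn_ge0// divr_ge0 ?(ltW a0)//.
    by case/andP: (X01 x).
  - move=> x; have /andP[X0 _] := X01 x; rewrite /step; case: ltgtP => [xa|xa|->].
    + rewrite -[X in _ --> X]expR0;
        apply: (@cvg_comp _ _ _ (fun n => - (X x / a) ^+ n) expR _ (nbhs (0 : R)));
          last exact: continuous_expR.
      rewrite -oppr0; apply: cvgN; apply: cvg_expr.
      by rewrite ger0_norm ?divr_ge0// ?(ltW a0)// ltr_pdivrMr// mul1r.
    + have q1 : 1 < X x / a by rewrite ltr_pdivlMr// mul1r.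
      apply: (@squeeze_cvgr _ _ _ _ (fun=> 0) (fun n => (X x / a)^-1 ^+ n)).
      * near=> n; rewrite expR_ge0/= expRN exprVn lef_pV2 ?posrE ?expR_gt0 ?exprn_gt0 ?(lt_trans
          ltr01)//.
        by rewrite (le_trans _ (expR_ge1Dx _))// lerDr.
      * exact: cvg_cst.
      * apply: cvg_expr; rewrite ger0_norm ?invr_ge0 ?(le_trans ler01) ?(ltW q1)//.
        by rewrite invf_lt1// (lt_trans ltr01).
    + by rewrite divff ?gt_eqF//; under eq_fun do rewrite expr1n; exact: cvg_cst.
have := cvgs _ mu1oo; have := cvgs _ mu2oo.
move=> h2; under eq_fun do rewrite exp_integral//.
by move=> h1; rewrite -(cvg_lim _ h1)// -(cvg_lim _ h2).
Unshelve. all: by end_near. Qed.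

Let below_integral a :
  mu1 (X @^-1` `]-oo, a[) = mu2 (X @^-1` `]-oo, a[).
Proof.
have mXa : measurable (X @^-1` `]-oo, a[).
  by rewrite -[X in measurable X]setTI; apply: mX => //; exact: measurable_itv.
have [a0|a0] := leP a 0.
  rewrite (_ : X @^-1` _ = set0) ?measure0//; apply/seteqP; split => // x /=.
  rewrite in_itv/= => xa; have /andP[X0 _] := X01 x.
  by have := lt_le_trans xa a0; rewrite ltNge X0.
(* Thresholds approaching [a] strictly from below make the value [expR (-1)] of [step] disappear in
   the limit; the factor [a / 2] keeps them positive. *)
pose a_ n : R := a - a / 2 * harmonic n.
have a20 : 0 < a / 2 by rewrite divr_gt0.
have a_0 n : 0 < a_ n.
  rewrite /a_ subr_gt0 (@le_lt_trans _ _ (a / 2))//;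
    last by rewrite ltr_pdivrMr// ltr_pMr// ltr1n.
  by rewrite ler_piMr ?(ltW a20)//= invf_le1// ler1n.
have a_a n : a_ n < a by rewrite /a_ /= gtrBl mulr_gt0// invr_gt0 ltr0n.
have a_cvg : a_ n @[n --> \oo] --> a.
  rewrite -[X in _ --> X]subr0; apply: cvgB; first exact: cvg_cst.
  rewrite -[X in _ --> X](mulr0 (a / 2)); apply: cvgMl_tmp; exact: cvg_harmonic.
have cvgs (mu : {measure set T -> \bar R}) : (mu setT < +oo)%E ->
    (\int[mu]_x (step (a_ n) (X x))%:E)%E @[n --> \oo] --> mu (X @^-1` `]-oo, a[).
  move=> muoo.
  rewrite [X in _ --> X](_ : _ = \int[mu]_x (\1_(X @^-1` `]-oo, a[) x)%:E)%E; last first.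
    by rewrite integral_indic// setIT.
  apply: (@bounded_cvg_integral _ _ _ _ _ _ 1) => //.
  - move=> n; rewrite /step.
    have mlt : measurable_fun setT (fun t => X t < a_ n) by exact: measurable_fun_ltr.
    apply: measurable_fun_if => //.
    apply: measurable_fun_if => //; first exact: mlt.
    exact: measurable_funTS (measurable_fun_eqr mX (@measurable_cst _ _ _ _ setT (a_ n))).
  - move=> n x; rewrite /step; case: ifPn => _; first by rewrite normr1.
    case: ifPn => _; last by rewrite normr0.
    by rewrite ger0_norm ?expR_ge0// expR_le1 oppr_le0.
  - move=> x; have [xa|xa] := ltP (X x) a.
      rewrite indicE mem_set /=; last by rewrite /= in_itv.
      apply: cvg_near_cst; near=> n; rewrite /step ifT//.
      by near: n; apply: (@cvgr_gt _ _ _ _ _ a a_cvg).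
    rewrite indicE memNset /=; last by rewrite /= in_itv/=; apply/negP; rewrite -leNgt.
    rewrite (_ : (fun n => _) = fun=> 0); first exact: cvg_cst.
    apply/funext => n; rewrite /step; have := lt_le_trans (a_a n) xa.
    by case: ltgtP.
have := cvgs _ mu1oo; have := cvgs _ mu2oo.
move=> h2; under eq_fun do rewrite step_integral//.
by move=> h1; rewrite -(cvg_lim _ h1)// -(cvg_lim _ h2).
Unshelve. all: by end_near. Qed.

(** The half-lines []-oo, a[] form a pi-system that generates the Borel sets. The measures are
    compared on events determined by [X] only, since [T] may be much richer. *)
Lemma moments_unique (B : set (measurableTypeR R)) : measurable B ->
  mu1 (X @^-1` B) = mu2 (X @^-1` B).
Proof.
move=> mB.
apply: (@measure_unique _ _ _ (@RGenInftyO.G R) (fun n =>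
  `]-oo, n%:R[%classic) _ _ _ _ (pushforward mu1 X) (pushforward mu2 X)) => //.
- exact: RGenInftyO.measurableE.
- move=> _ _ [x ->] [y ->]; exists (Num.min x y).
  by apply/seteqP; split => z /=; rewrite !in_itv/= lt_min => /andP.
- by move=> n; exists n%:R.
- apply/seteqP; split => // x _; exists (Num.Def.truncn `|x|).+1 => //=.
  by rewrite in_itv/= (le_lt_trans (ler_norm _))// truncnS_gt.
- by move=> _ [x ->]; exact: below_integral.
- move=> n; apply: le_lt_trans mu1oo; rewrite /pushforward.
  have mXn : measurable (X @^-1` `]-oo, n%:R[).
    by rewrite -[X in measurable X]setTI; apply: mX => //; exact: measurable_itv.
  change (mu1 (X @^-1` `]-oo, n%:R[) <= mu1 setT)%E.
  apply: le_measure => //; apply/mem_set => //.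
Qed.

End moment_problem.

Lemma cvg_integral_nd d (T : measurableType d) (R : realType)
    (mu : {measure set T -> \bar R}) (f_ : (T -> \bar R)^nat) (f : T -> \bar R) :
  (forall n, measurable_fun setT (f_ n)) -> (forall n x, (0 <= f_ n x)%E) ->
  (forall x, nondecreasing_seq (f_ ^~ x)) -> (forall x, f_ n x @[n --> \oo] --> f x) ->
  (\int[mu]_x f_ n x)%E @[n --> \oo] --> (\int[mu]_x f x)%E.
Proof.
move=> mf f0 nd ff.
rewrite [X in _ --> X](_ : _ = \int[mu]_x limn (f_ ^~ x))%E.
  by apply: cvg_monotone_convergence => // x _; exact: nd.
by apply: eq_integral => x _; apply/esym/cvg_lim => //; exact: ff.
Qed.

(** Passes from indicators to functions while the weights stay fixed. It serves to replace one
    factor at a time in the independence of counts, and to extend the Markov property of paths from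
    events to functions. *)
Lemma weighted_law_eq d1 (T1 : measurableType d1) d2 (T2 : measurableType d2)
    d (T : measurableType d) (R : realType)
    (mu1 : {measure set T1 -> \bar R}) (mu2 : {measure set T2 -> \bar R})
    (X1 : T1 -> T) (X2 : T2 -> T) (G1 : T1 -> \bar R) (G2 : T2 -> \bar R) :
  measurable_fun setT X1 -> measurable_fun setT X2 ->
  measurable_fun setT G1 -> measurable_fun setT G2 ->
  (forall x, (0 <= G1 x)%E) -> (forall x, (0 <= G2 x)%E) ->
  (forall B, measurable B ->
    \int[mu1]_x ((\1_B (X1 x))%:E * G1 x) = \int[mu2]_x ((\1_B (X2 x))%:E * G2 x))%E ->
  forall g, measurable_fun setT g -> (forall y, (0 <= g y)%E) ->
  (\int[mu1]_x (g (X1 x) * G1 x) = \int[mu2]_x (g (X2 x) * G2 x))%E.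
Proof.
move=> mX1 mX2 mG1 mG2 G10 G20 H.
have m1 f : measurable_fun setT f -> measurable_fun setT (fun x => f (X1 x) * G1 x)%E.
  by move=> mf; apply: emeasurable_funM => //; exact: measurableT_comp mf mX1.
have m2 f : measurable_fun setT f -> measurable_fun setT (fun x => f (X2 x) * G2 x)%E.
  by move=> mf; apply: emeasurable_funM => //; exact: measurableT_comp mf mX2.
apply: ge0_measurable_ind => //.
- move=> c f c0 mf f0 E.
  under eq_integral do rewrite -muleA; under [RHS]eq_integral do rewrite -muleA.
  rewrite ge0_integralZl_EFin//; last 2 first.
    by move=> x _; rewrite mule_ge0.
    exact: m1.
  rewrite ge0_integralZl_EFin//; last 2 first.
    by move=> x _; rewrite mule_ge0.
    exact: m2.
  by rewrite E.
- move=> f g mf f0 Ef mg g0 Eg.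
  under eq_integral do rewrite ge0_muleDl//.
  under [RHS]eq_integral do rewrite ge0_muleDl//.
  transitivity (\int[mu1]_x (f (X1 x) * G1 x) + \int[mu1]_x (g (X1 x) * G1 x))%E.
    by apply: ge0_integralD => //; [move=> x _; rewrite mule_ge0|exact: m1|move=> x _;
      rewrite mule_ge0|exact: m1].
  transitivity (\int[mu2]_x (f (X2 x) * G2 x) + \int[mu2]_x (g (X2 x) * G2 x))%E.
    by rewrite Ef Eg.
  by apply/esym; apply: ge0_integralD => //; [move=> x _;
    rewrite mule_ge0|exact: m2|move=> x _; rewrite mule_ge0|exact: m2].
- move=> f_ f mf f0 nd ff E.
  have nd1 : forall x, nondecreasing_seq (fun n => f_ n (X1 x) * G1 x)%E.
    by move=> x a b ab; rewrite lee_wpmul2r// nd.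
  have nd2 : forall x, nondecreasing_seq (fun n => f_ n (X2 x) * G2 x)%E.
    by move=> x a b ab; rewrite lee_wpmul2r// nd.
  (* The product is discontinuous at [0 * +oo]. The case [G = 0] is constant, and in the case
     [l = 0] monotonicity forces all terms to be 0. *)
  have C (u : (\bar R)^nat) (l G : \bar R) : (forall n, 0 <= u n)%E -> nondecreasing_seq u -> (0
    <= G)%E ->
      u n @[n --> \oo] --> l -> (u n * G)%E @[n --> \oo] --> (l * G)%E.
    move=> u0 ndu G0 ul; have [->|Gn0] := eqVneq G 0%E.
      by under eq_fun do rewrite mule0; rewrite mule0; exact: cvg_cst.
    have [l0|ln0] := eqVneq l 0%E.
      have u00 n : u n = 0%E.
        apply/eqP; rewrite eq_le u0 andbT -l0; apply: (cvge_to_ge ul).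
        by near=> k; apply: ndu; near: k; exact: nbhs_infty_ge.
      rewrite l0 mul0e; under eq_fun do rewrite u00 mul0e.
      exact: cvg_cst.
    apply: cvgeM => //; last exact: cvg_cst.
    by rewrite mule_defE negb_or !negb_and ln0 Gn0.
  have h1 : (\int[mu1]_x (f_ n (X1 x) * G1 x))%E @[n --> \oo] --> (\int[mu1]_x (f (X1 x) * G1
    x))%E.
    apply: cvg_integral_nd => //.
    + by move=> n; exact: m1.
    + by move=> n x; rewrite mule_ge0.
    + by move=> x; apply: C; [move=> n; exact: f0|exact: nd|by []|exact: ff].
  have h2 : (\int[mu2]_x (f_ n (X2 x) * G2 x))%E @[n --> \oo] --> (\int[mu2]_x (f (X2 x) * G2
    x))%E.
    apply: cvg_integral_nd => //.
    + by move=> n; exact: m2.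
    + by move=> n x; rewrite mule_ge0.
    + by move=> x; apply: C; [move=> n; exact: f0|exact: nd|by []|exact: ff].
  by rewrite -(cvg_lim _ h1)// -(cvg_lim _ h2)//; under eq_fun do rewrite E.
Unshelve. all: by end_near. Qed.

Section weighted.
Context d (T : measurableType d) (R : realType).
Variables (mu : {measure set T -> \bar R}) (G : T -> R).
Hypotheses (mG : measurable_fun setT G) (G0 : forall x, 0 <= G x).

Let k (x : T) : {measure set T -> \bar R} := mscale (NngNum (G0 x)) \d_x.

Let mk A : measurable A -> measurable_fun setT (k ^~ A).
Proof.
move=> mA; apply: emeasurable_funM; first exact/measurable_EFinP.
by apply/measurable_EFinP; exact: measurable_indic.
Qed.

(** The measure with density [G] with respect to [mu], as a mixture of scaled Dirac masses, whence
    its integral formula. *)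
Definition weighted : {measure set T -> \bar R} :=
  mixture mu measurableT mk.

Lemma integral_weighted f : measurable_fun setT f -> (forall x, (0 <= f x)%E) ->
  (\int[weighted]_x f x = \int[mu]_x ((G x)%:E * f x))%E.
Proof.
move=> mf f0; rewrite (@integral_mixture _ _ _ _ _ mu setT measurableT k mk)//.
apply: eq_integral => x _; rewrite ge0_integral_mscale// integral_dirac//.
by rewrite diracT mul1e.
Qed.

Lemma weightedE A : measurable A ->
  (weighted A = \int[mu]_x ((G x)%:E * (\1_A x)%:E))%E.
Proof.
move=> mA; rewrite -integral_weighted//; first by rewrite integral_indic// setIT.
by apply/measurable_EFinP; exact: measurable_indic.
Qed.

End weighted.

(** * The function exp (- x) on [0, +oo] *)

Section enexp.
Context {R : realType}.
Implicit Types x y : \bar R.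

(* Meant for [0 <= x]; the value 0 at [-oo] is junk. *)
Definition enexp (x : \bar R) : R := if x is r%:E then expR (- r) else 0.

Lemma enexp0 : enexp 0%E = 1.
Proof. by rewrite /enexp /= oppr0 expR0. Qed.

Lemma enexp_ge0 x : 0 <= enexp x.
Proof. by case: x => [r||] //=; exact: expR_ge0. Qed.

Lemma enexp_le1 x : (0 <= x)%E -> enexp x <= 1.
Proof. by case: x => [r||] //=; rewrite lee_fin => r0; rewrite expR_le1 oppr_le0. Qed.

Lemma enexpD x y : (0 <= x)%E -> (0 <= y)%E -> enexp (x + y)%E = enexp x * enexp y.
Proof.
case: x => [r||] //; case: y => [s||] //= _ _; rewrite ?mulr0 ?mul0r//.
by rewrite opprD expRD.
Qed.

Lemma enexp_sum (I : Type) (s : seq I) (f : I -> \bar R) : (forall i, (0 <= f i)%E) ->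
  enexp (\sum_(i <- s) f i)%E = \prod_(i <- s) enexp (f i).
Proof.
move=> f0; elim: s => [|i s IH]; first by rewrite !big_nil enexp0.
by rewrite !big_cons enexpD ?IH// sume_ge0.
Qed.

Lemma measurable_enexp : measurable_fun setT enexp.
Proof.
rewrite (_ : enexp = fun x => if x \is a fin_num then expR (- fine x) else 0).
  apply: measurable_fun_ifT => //.
    apply: (measurable_fun_bool true).
    exact: emeasurable_fin_num (@measurable_id _ _ _).
  by apply: measurableT_comp => //; apply: measurableT_comp => //; exact: fine_measurable.
by apply/funext => -[r||].
Qed.

Lemma cvg_enexp (u : (\bar R)^nat) x : (0 <= x)%E -> u n @[n --> \oo] --> x ->
  enexp (u n) @[n --> \oo] --> enexp x.
Proof.
case: x => [r _ /fine_cvgP[ufin ur]|_ /cvgeyPge uoo|//].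
  apply: (@cvg_trans _ (expR (- fine (u n)) @[n --> \oo])).
    apply: near_eq_cvg; near=> n; have : u n \is a fin_num by near: n.
    by case: (u n).
  apply: (@cvg_comp _ _ _ (fun n => - fine (u n)) expR _ (nbhs (- r)));
    last exact: continuous_expR.
  exact: cvgN.
apply/cvgr0Pnorm_le => e e0; near=> n.
have : ((- ln e)%:E <= u n)%E by near: n; exact: uoo.
case: (u n) => [s||]//=; rewrite ?normr0 ?(ltW e0)// lee_fin => es.
by rewrite ger0_norm ?expR_ge0// -[leRHS]lnK ?posrE// ler_expR lerNl.
Unshelve. all: by end_near. Qed.

End enexp.

(** * Laplace functional of a Poisson random measure *)

Lemma nneseries_exp_coeff (R : realType) (y : R) :
  (\sum_(0 <= k <oo) (exp_coeff y k)%:E)%E = (expR y)%:E.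
Proof.
apply/cvg_lim => //.
rewrite (_ : (fun n => _) = EFin \o series (exp_coeff y)); last first.
  by apply/funext => n; rewrite /series /= sumEFin.
apply: cvg_EFin; first exact: nearW.
exact: is_cvg_series_exp_coeff.
Qed.

Lemma emeasurable_prod d (T : measurableType d) (R : realType) (D : set T)
    (I : Type) (s : seq I) (J : pred I) (h : I -> T -> \bar R) :
  (forall i, measurable_fun D (h i)) ->
  measurable_fun D (fun x => \prod_(i <- s | J i) h i x)%E.
Proof.
move=> mh; elim: s => [|i s IH].
  by under eq_fun do rewrite big_nil; exact: measurable_cst.
under eq_fun do rewrite big_cons.
by case: (J i) => //; exact: emeasurable_funM.
Qed.

Section poisson_laplace.
Context {R : realType} d (Omega : measurableType d) d' (E : measurableType d').
Variables (P : probability Omega R) (mu : {measure set E -> \bar R})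
  (N : Omega -> {measure set E -> \bar R}).
Hypothesis hN : poisson_random_measure P mu N.

Lemma poisson_measurable A : measurable A -> measurable_fun setT (fun w => N w A).
Proof. by case: hN => _ + _ _ _; exact. Qed.

Lemma poisson_integral_measurable f : measurable_fun setT f -> (forall x, (0 <= f x)%E) ->
  measurable_fun setT (fun w => \int[N w]_x f x)%E.
Proof.
by move=> mf f0; apply: measurable_fun_integral_kernel => // A; exact: poisson_measurable.
Qed.

Let value A k := [set w | N w A = k%:R%:E].

Let measurable_value A k : measurable A -> measurable (value A k).
Proof.
move=> mA; rewrite (_ : value A k = setT `&` (fun w => N w A) @^-1` [set k%:R%:E]); last first.
  by rewrite setTI.
exact: poisson_measurable.
Qed.

Let trivIset_value A : trivIset setT (value A).
Proof.
by move=> i j _ _ [w []]; rewrite /value /= => -> [/eqP]; rewrite eqr_nat => /eqP.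
Qed.

Let values A := \bigcup_k value A k.

Let measurable_values A : measurable A -> measurable (values A).
Proof. by move=> mA; apply: bigcupT_measurable => k; exact: measurable_value. Qed.

(** With [g = 1] the Poisson weights are seen to sum to 1, so that [N A] is almost surely a natural
    number; with [g k = expR (- (a * k))] this gives the Laplace transform of [N A]. *)
Let pmf_sum A (g : nat -> R) : measurable A -> (mu A < +oo)%E -> (forall k, 0 <= g k) ->
  (\sum_(0 <= k <oo) ((g k)%:E * P (value A k)) =
   (expR (- fine (mu A)))%:E * \sum_(0 <= k <oo) (g k * (exp_coeff (fine (mu A)) k))%:E)%E.
Proof.
move=> mA muA g0; rewrite -nneseriesZl//; last first.
  move=> k _; rewrite lee_fin mulr_ge0// exp_coeff_ge0// fine_ge0//.
apply: eq_eseriesr => k _; case: hN => _ _ -> // _ _.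
by rewrite -!EFinM /exp_coeff /=; congr (_%:E); ring.
Qed.

Let values_full A : measurable A -> (mu A < +oo)%E -> P (~` values A) = 0%E.
Proof.
move=> mA muA; rewrite probability_setC; last exact: measurable_values.
rewrite measure_semi_bigcup//; last 2 first.
- by move=> k; exact: measurable_value.
- exact: measurable_values.
have := @pmf_sum _ (fun=> 1) mA muA (fun=> ler01); rewrite /=.
under eq_eseriesr do rewrite mul1e.
under [in RHS]eq_eseriesr do rewrite mul1r.
move=> ->; rewrite nneseries_exp_coeff -EFinM -expRD addNr expR0.
by rewrite subee.
Qed.

Lemma poisson_finite A : measurable A -> (mu A < +oo)%E ->
  {ae P, forall w, (N w A < +oo)%E}.
Proof.
move=> mA muA; exists (~` values A); split.
- by apply: measurableC; exact: measurable_values.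
- exact: values_full.
- by move=> w /= + [k _ /= NA]; rewrite NA ltry; exact.
Qed.

Lemma poisson_null A : measurable A -> mu A = 0%E -> {ae P, forall w, N w A = 0%E}.
Proof.
move=> mA muA; exists (~` value A 0%N); split.
- by apply: measurableC; exact: measurable_value.
- rewrite probability_setC; last exact: measurable_value.
  case: hN => _ _ -> //; last by rewrite muA.
  by move=> _ _; rewrite muA /= expr0 fact0 divr1 mul1r oppr0 expR0 subee.
- by move=> w /= + NA; exact.
Qed.

Lemma poisson_infinite A : measurable A -> mu A = +oo%E ->
  {ae P, forall w, N w A = +oo%E}.
Proof.
move=> mA muA; have mB : measurable [set w | N w A = +oo%E].
  rewrite (_ : [set _ | _] = setT `&` (fun w => N w A) @^-1` [set +oo%E]).
    exact: poisson_measurable.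
  by rewrite setTI.
exists (~` [set w | N w A = +oo%E]); split.
- exact: measurableC.
- rewrite probability_setC//; case: hN => _ _ _ -> // _.
  by rewrite subee.
- by move=> w /= + NA; exact.
Qed.

Let measurable_exp (a : R) A : measurable A ->
  measurable_fun setT (fun w => enexp (a%:E * N w A)).
Proof.
move=> mA; apply: measurableT_comp; first exact: measurable_enexp.
by apply: measurable_funeM; exact: poisson_measurable.
Qed.

Lemma poisson_laplace1 (a : R) A : 0 <= a -> measurable A ->
  (\int[P]_w (enexp (a%:E * N w A))%:E = (enexp ((1 - expR (- a))%:E * mu A))%:E)%E.
Proof.
move=> a0 mA; have mI : measurable_fun setT (fun w => (enexp (a%:E * N w A))%:E).
  by apply/measurable_EFinP; exact: measurable_exp.
have [/eqP|muA] := boolP (mu A == +oo%E).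
  (* For [a = 0] both sides are 1, because [0 * +oo = 0]; for [a > 0] both are [enexp +oo = 0]. *)
  move=> muA; have [->|an0] := eqVneq a 0.
    rewrite oppr0 expR0 subrr mul0e enexp0.
    under eq_integral do rewrite mul0e enexp0.
    by rewrite integral_cst// mul1e; exact: probability_setT.
  have ap : 0 < a by rewrite lt_neqAle eq_sym an0.
  rewrite muA gt0_muley; last by rewrite lte_fin subr_gt0 expR_lt1 oppr_lt0.
  rewrite (ae_eq_integral (fun=> 0%E))//=; first by rewrite integral0.
  have := poisson_infinite mA muA; apply: filterS => w NA _.
  by rewrite NA gt0_muley// lte_fin.
have {}muA : (mu A < +oo)%E by rewrite ltey.
rewrite (ge0_negligible_integral (N := ~` values A))//; last 3 first.
- by apply: measurableC; exact: measurable_values.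
- by move=> w _; rewrite lee_fin enexp_ge0.
- exact: values_full.
rewrite setTD setCK ge0_integral_bigcup//; last 3 first.
- by move=> k; exact: measurable_value.
- exact: measurable_funTS.
- by move=> w _; rewrite lee_fin enexp_ge0.
transitivity (\sum_(0 <= k <oo) ((expR (- (a * k%:R)))%:E * P (value A k)))%E.
  apply: eq_eseriesr => k _; rewrite -integral_cst; last exact: measurable_value.
  by apply: eq_integral => w /set_mem; rewrite /value /= => ->.
rewrite (@pmf_sum _ (fun k => expR (- (a * k%:R))))//.
rewrite (_ : (\sum_(0 <= k <oo) _)%E = (expR (expR (- a) * fine (mu A)))%:E); last first.
  rewrite -nneseries_exp_coeff; apply: eq_eseriesr => k _; congr (_%:E).
  rewrite /exp_coeff /= exprMn mulrA; congr (_ * _ / _).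
  by rewrite -expRM_natl; congr expR; rewrite -mulr_natl; ring.
rewrite -EFinM -expRD -[in RHS](fineK (x := mu A)); last by rewrite ge0_fin_numE.
by rewrite -EFinM /=; congr ((expR _)%:E); ring.
Qed.

(** Independence is given for events. The induction is on a list [s] of indices whose factor may be
    arbitrary, the others being indicators; [weighted_law_eq], with the product of the other factors
    as weight, admits one more index to [s]. *)
Lemma poisson_indep n (A : 'I_n -> set E) (h : 'I_n -> \bar R -> \bar R) :
  (forall i, measurable (A i)) -> trivIset setT A ->
  (forall i, measurable_fun setT (h i)) -> (forall i x, (0 <= h i x)%E) ->
  (\int[P]_w \prod_(i < n) h i (N w (A i)) = \prod_(i < n) \int[P]_w h i (N w (A i)))%E.
Proof.
move=> mA tA.
have mX i : measurable_fun setT (fun w => N w (A i)) by exact: poisson_measurable.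
suff H (s : seq 'I_n) : forall h : 'I_n -> \bar R -> \bar R,
    (forall i, measurable_fun setT (h i)) -> (forall i x, (0 <= h i x)%E) ->
    (forall i, i \notin s -> exists2 B, measurable B & h i = (fun x => (\1_B x)%:E)) ->
    (\int[P]_w \prod_(i < n) h i (N w (A i)) = \prod_(i < n) \int[P]_w h i (N w (A i)))%E.
  move=> mh h0; apply: (H (enum 'I_n)) => // i.
  by rewrite mem_enum.
elim: s => [|i0 s IH] {}h mh h0 hs.
  have hB i : {B | measurable B & h i = (fun x => (\1_B x)%:E)}.
    by apply: cid2; exact: hs.
  pose B i := s2val (hB i).
  have mB i : measurable (B i) by rewrite /B; case: (hB i).
  have hE i : h i = (fun x => (\1_(B i) x)%:E) by rewrite /B; case: (hB i).
  case: hN => _ _ _ _ /(_ n A B mA tA mB) ind.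
  transitivity (P (\bigcap_(i in [set: 'I_n]) [set w | B i (N w (A i))])).
    rewrite -[X in P X]setIT -integral_indic//; last first.
      apply: fin_bigcap_measurable => // i _.
      rewrite (_ : [set _ | _] = setT `&` (fun w => N w (A i)) @^-1` (B i)); first exact: mX.
      by rewrite setTI.
    apply: eq_integral => w _; rewrite indicE.
    have [wB|/existsNP[i /not_implyP[_ wB]]] := pselect ((\bigcap_(i in [set: 'I_n]) [set w | B
      i (N w (A i))]) w).
      rewrite mem_set// big1// => i _; rewrite hE indicE mem_set//.
      exact: wB.
    rewrite memNset; last by move=> /(_ i I).
    by rewrite (bigD1 i)//= hE indicE memNset// mul0e.
  rewrite ind; apply: eq_bigr => i _.
  transitivity (\int[P]_w (\1_((fun w => N w (A i)) @^-1` B i) w)%:E)%E; last by rewrite hE.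
  rewrite integral_indic ?setIT//.
  by rewrite -[X in measurable X]setTI; exact: mX.
have mP (J : pred 'I_n) : measurable_fun setT (fun w => \prod_(i < n | J i) h i (N w (A i)))%E.
  by apply: emeasurable_prod => i; exact: measurableT_comp (mh i) (mX i).
have P0 (J : pred 'I_n) w : (0 <= \prod_(i < n | J i) h i (N w (A i)))%E.
  by apply: prode_ge0.
rewrite (bigD1 i0)//=; under eq_integral do rewrite (bigD1 i0)//=.
set c := (\prod_(i < n | i != i0) \int[P]_x h i (N x (A i)))%E.
have c0 : (0 <= c)%E by apply: prode_ge0 => i _; exact: integral_ge0.
rewrite -ge0_integralZr//; last exact: measurableT_comp (mh i0) (mX i0).
apply: (weighted_law_eq (G2 := fun=> c)) => // B mB.
pose h' j := if j == i0 then (fun x => (\1_B x)%:E) else h j.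
have h'i0 : h' i0 = (fun x => (\1_B x)%:E) by rewrite /h' eqxx.
have h'E j : j != i0 -> h' j = h j by rewrite /h' => /negbTE ->.
have mh' i : measurable_fun setT (h' i).
  by rewrite /h'; case: ifP => // _; apply/measurable_EFinP; exact: measurable_indic.
have h'0 i x : (0 <= h' i x)%E.
  by rewrite /h'; case: ifP => // _; rewrite lee_fin.
have /(IH _ mh' h'0) : forall i, i \notin s -> exists2 B, measurable B & h' i = (fun x =>
  (\1_B x)%:E).
  move=> i si; have [->|ii0] := eqVneq i i0; first by exists B.
  by rewrite h'E//; apply: hs; rewrite inE negb_or ii0.
rewrite (bigD1 i0)//= h'i0 => e.
transitivity (\int[P]_w \prod_(i < n) h' i (N w (A i)))%E.
  apply: eq_integral => w _; rewrite [RHS](bigD1 i0)//= h'i0; congr (_ * _)%E.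
  by apply: eq_bigr => j /h'E ->.
rewrite e; transitivity ((\int[P]_x (\1_B (N x (A i0)))%:E) * c)%E.
  by congr (_ * _)%E; apply: eq_bigr => j /h'E ->.
rewrite ge0_integralZr//.
apply/measurable_EFinP; apply: measurableT_comp (mX i0).
exact: measurable_indic.
Qed.

End poisson_laplace.

Lemma cvg_expRN (R : realType) (u : R^nat) (a : R) :
  u n @[n --> \oo] --> a -> expR (- u n) @[n --> \oo] --> expR (- a).
Proof.
move=> ua; apply: (@cvg_comp _ _ _ (fun n => - u n) expR _ (nbhs (- a))).
  exact: cvgN.
exact: continuous_expR.
Qed.

Section laplace_functional.
Context {R : realType} d (Omega : measurableType d) d' (E : measurableType d').
Variables (P : probability Omega R) (mu : {measure set E -> \bar R})
  (N : Omega -> {measure set E -> \bar R}).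
Hypothesis hN : poisson_random_measure P mu N.
Import HBNNSimple.

(** The level sets of [f] are disjoint, so their counts are independent and the exponential of the
    integral factors; [f] and [1 - exp (- f)] are both combinations of the indicators of these
    sets. *)
Let laplace_nnsfun (f : {nnsfun E >-> R}) :
  (\int[P]_w (enexp (\int[N w]_x (f x)%:E))%:E =
   (enexp (\int[mu]_x (1 - expR (- f x))%:E))%:E)%E.
Proof.
pose s : seq R := fset_set (range f).
have us : uniq s by exact: fset_uniq.
pose A (i : 'I_(size s)) := f @^-1` [set s`_i].
have fs x : f x \in s.
  have : f x \in fset_set (range f) by rewrite in_fset_set//; apply/mem_set; exists x.
  by [].
have s0 (i : 'I_(size s)) : 0 <= s`_i.
  have : s`_i \in fset_set (range f) by have := mem_nth 0 (ltn_ord i).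
  by rewrite in_fset_set// => /set_mem[x _ <-].
have mA i : measurable (A i) by exact: measurable_funPTI.
have tA : trivIset setT A.
  move=> i j _ _ [x [/= xi xj]]; apply/val_inj/eqP.
  by rewrite -(nth_uniq 0 (ltn_ord i) (ltn_ord j) us) -xi -xj.
have gE (g : R -> R) x : g (f x) = \sum_(i < size s) g s`_i * \1_(A i) x.
  have xi : (index (f x) s < size s)%N by rewrite index_mem.
  rewrite (bigD1 (Ordinal xi))//= big1 ?addr0.
    by rewrite nth_index// indicE mem_set ?mulr1// /A /= nth_index.
  move=> j /eqP ji; rewrite indicE memNset ?mulr0// => fx.
  by apply: ji; apply/val_inj; rewrite /= fx index_uniq.
have intE (nu : {measure set E -> \bar R}) (g : R -> R) :
    (forall i : 'I_(size s), 0 <= g s`_i) ->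
    (\int[nu]_x (g (f x))%:E = \sum_(i < size s) (g s`_i)%:E * nu (A i))%E.
  move=> g0; under eq_integral do rewrite gE -sumEFin.
  rewrite ge0_integral_sum//; last 2 first.
  - by move=> i; apply/measurable_EFinP; apply: measurable_funM => //; exact: measurable_indic.
  - by move=> i x _; rewrite lee_fin mulr_ge0.
  apply: eq_bigr => i _; under eq_integral do rewrite EFinM.
  rewrite ge0_integralZl//; last 2 first.
  - by apply/measurable_EFinP; exact: measurable_indic.
  - by rewrite lee_fin.
  by rewrite integral_indic// setIT.
have g0 (i : 'I_(size s)) : 0 <= 1 - expR (- s`_i).
  by rewrite subr_ge0 expR_le1 oppr_le0.
rewrite (intE mu (fun y => 1 - expR (- y)))// enexp_sum; last first.
  by move=> i; rewrite mule_ge0// lee_fin.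
rewrite -prodEFin.
transitivity (\int[P]_w \prod_(i < size s) (enexp ((s`_i)%:E * N w (A i)))%:E)%E.
  apply: eq_integral => w _; rewrite (intE _ id)// enexp_sum ?prodEFin// => i.
  by rewrite mule_ge0// lee_fin.
rewrite (poisson_indep hN (h := fun i y => (enexp ((s`_i)%:E * y))%:E))//.
- by apply: eq_bigr => i _; rewrite (poisson_laplace1 hN).
- move=> i; apply/measurable_EFinP; apply: measurableT_comp; first exact: measurable_enexp.
  exact: measurable_funeM.
- by move=> i x; rewrite lee_fin enexp_ge0.
Qed.

(** Both sides pass to the limit along simple functions increasing to [f]: monotone convergence for
    the integrals against [N] and [mu], bounded convergence under [P], and continuity of [enexp],
    also at [+oo]. *)
Lemma poisson_laplace (f : E -> R) : measurable_fun setT f -> (forall x, 0 <= f x) ->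
  (\int[P]_w (enexp (\int[N w]_x (f x)%:E))%:E =
   (enexp (\int[mu]_x (1 - expR (- f x))%:E))%:E)%E.
Proof.
move=> mf f0.
have mEf : measurable_fun setT (EFin \o f) by exact/measurable_EFinP.
pose f_ := nnsfun_approx measurableT mEf.
have f_cvg x : (f_ n x)%:E @[n --> \oo] --> (f x)%:E.
  by apply: (@cvg_nnsfun_approx _ _ _ _ measurableT _ mEf) => // y _; rewrite /= lee_fin.
have f_nd x : nondecreasing_seq (f_ ^~ x) by move=> a b ab; exact/lefP/nd_nnsfun_approx.
have cvgN w : (enexp (\int[N w]_x (f_ n x)%:E)%E) @[n --> \oo] -->
    enexp (\int[N w]_x (f x)%:E)%E.
  apply: cvg_enexp; first by apply: integral_ge0 => x _; rewrite lee_fin.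
  apply: cvg_integral_nd => //.
  - by move=> n; apply/measurable_EFinP.
  - by move=> n x; rewrite lee_fin.
have cvgL : (\int[P]_w (enexp (\int[N w]_x (f_ n x)%:E))%:E)%E @[n --> \oo] -->
    (\int[P]_w (enexp (\int[N w]_x (f x)%:E))%:E)%E.
  apply: (@bounded_cvg_integral _ _ _ _ _ _ 1) => //.
  - by apply: (@le_lt_trans _ _ 1%E); [exact: probability_le1|exact: ltry].
  - move=> n; apply: measurableT_comp; first exact: measurable_enexp.
    apply: (poisson_integral_measurable hN); first by apply/measurable_EFinP.
    by move=> x; rewrite lee_fin.
  - move=> n w; rewrite ger0_norm ?enexp_ge0// enexp_le1// integral_ge0// => x _.
    by rewrite lee_fin.
have cvgR : (enexp (\int[mu]_x (1 - expR (- f_ n x))%:E)%E) @[n --> \oo] -->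
    enexp (\int[mu]_x (1 - expR (- f x))%:E)%E.
  apply: cvg_enexp.
    by apply: integral_ge0 => x _; rewrite lee_fin subr_ge0 expR_le1 oppr_le0.
  apply: cvg_integral_nd => //.
  - move=> n; apply/measurable_EFinP; apply: measurable_funB => //.
    by apply: measurableT_comp => //; exact: measurableT_comp.
  - by move=> n x; rewrite lee_fin subr_ge0 expR_le1 oppr_le0.
  - by move=> x a b ab; rewrite lee_fin lerD2l lerN2 ler_expR lerN2 f_nd.
  - move=> x; apply: cvg_EFin; first exact: nearW.
    apply: cvgB; first exact: cvg_cst.
    have ff : f_ n x @[n --> \oo] --> f x by have /fine_cvgP[_] := f_cvg x.
    exact: (cvg_expRN (u := fun n => f_ n x)).
rewrite -(cvg_lim _ cvgL)//; under eq_fun do rewrite laplace_nnsfun.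
apply/cvg_lim => //; apply: cvg_EFin; last exact: cvgR.
exact: nearW.
Qed.

End laplace_functional.

(** * Branching mechanism and cumulants *)

Section branching.
Context {R : realType} (b c : R) (m : {measure set (measurableTypeR R) -> \bar R}).
Hypothesis hc : 0 <= c.
Hypothesis hm : (\int[m]_(u in `]0%R, +oo[) (Num.min u (u ^+ 2))%:E < +oo)%E.
Variable delta : R.
Hypothesis hdelta : derive_at_infty (branching_mechanism b c m) = delta%:E.

Local Notation phi := (branching_mechanism b c m).
Local Notation pos := (`]0%R, +oo[%classic : set R).

Let g (z u : R) := expR (- (z * u)) - 1 + z * u.

Let mexp (z : R) (A : set R) : measurable_fun A (fun u : R => expR (- (z * u))).
Proof.
by apply: measurable_funTS; apply: measurableT_comp => //; exact: measurableT_comp.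
Qed.

Let mg z A : measurable_fun A (g z).
Proof.
apply: measurable_funD; last exact: measurable_funM.
exact: measurable_funB.
Qed.

Let min_int : m.-integrable pos (fun u => (Num.min u (u ^+ 2))%:E).
Proof.
apply/integrableP; split.
  by apply/measurable_EFinP; apply: measurable_minr => //; exact: measurable_funX.
rewrite [X in (X < _)%E](_ : _ = \int[m]_(u in pos) (Num.min u (u ^+ 2))%:E)%E//.
apply: eq_integral => u /set_mem /=.
by rewrite in_itv/= andbT => u0; rewrite ger0_norm// le_min (ltW u0) sqr_ge0.
Qed.

Let expR_upper (y : R) : 0 <= y -> expR (- y) - 1 + y <= y ^+ 2.
Proof.
move=> y0; have y1 : 0 < 1 + y by rewrite ltr_wpDr.
have : expR (- y) <= (1 + y)^-1 by rewrite expRN lef_pV2 ?posrE ?expR_gt0// expR_ge1Dx.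
rewrite -[_^-1]mul1r ler_pdivlMr// => h.
rewrite -(ler_pM2r y1); nra.
Qed.

Let expR_lower (y : R) : 0 <= expR (- y) - 1 + y.
Proof. by have := expR_ge1Dx (- y); lra. Qed.

(** [expR (- y) - 1 + y] is at most [y] and at most [y ^+ 2]. With [y = z * u] the first bound
    serves large [u] and the second small [u]. *)
Let g_bound (z u : R) : 0 <= z -> 0 <= u -> 0 <= g z u <= (z + z ^+ 2) * Num.min u (u ^+ 2).
Proof.
move=> z0 u0; rewrite expR_lower /=.
have h2 := expR_upper (mulr_ge0 z0 u0).
have h1 : g z u <= z * u.
  have : expR (- (z * u)) <= 1 by rewrite expR_le1 oppr_le0 mulr_ge0.
  by rewrite /g; lra.
rewrite /g in h1 *; have z2 := sqr_ge0 z; have u2 := sqr_ge0 u.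
by rewrite minEle; case: ifP => _; nra.
Qed.

Let g_int (z : R) : 0 <= z -> m.-integrable pos (EFin \o g z).
Proof.
move=> z0.
apply: (@le_integrable _ _ _ m _ _ _ (fun u =>
  (z + z ^+ 2)%:E * (Num.min u (u ^+ 2))%:E)%E) => //.
- by apply/measurable_EFinP; exact: mg.
- move=> u /=; rewrite in_itv/= andbT => /ltW u0; rewrite lee_fin.
  have /andP[h1 h2] := g_bound z0 u0.
  by rewrite ger0_norm// (le_trans h2)// ler_norm.
- exact: integrableZl.
Qed.

Let d1g (z u : R) : is_derive z 1 (fun z => g z u) (u * (1 - expR (- (z * u)))).
Proof.
have h1 : is_derive z 1 (fun x : R => - (x * u)) (- u).
  rewrite (_ : (fun x => _) = (- u) \*: (@id R)); last first.
    by apply/funext => x; rewrite -[RHS]/(- u * x) mulNr mulrC.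
  by apply: is_derive_eq; rewrite -[LHS]/(- u * 1) mulr1.
have h2 := @is_derive1_comp _ expR (fun x : R => - (x * u)) z _ _ (is_derive_expR _) h1.
rewrite (_ : (fun z => _) = (expR \o (fun x : R => - (x * u))) - cst 1 - (fun x : R =>
  - (x * u))); last first.
  by apply/funext => x; rewrite !fctE /= opprK.
apply: is_derive_eq; rewrite /=; ring.
Qed.

Let F z : R := \int[m]_(u in pos) g z u.
Let F' z : R := \int[m]_(u in pos) (u * (1 - expR (- (z * u)))).

Let d1g_bound (z u : R) : 0 <= z -> 0 <= u ->
  0 <= u * (1 - expR (- (z * u))) <= (1 + z) * Num.min u (u ^+ 2).
Proof.
move=> z0 u0; have zu := mulr_ge0 z0 u0.
have e1 : expR (- (z * u)) <= 1 by rewrite expR_le1 oppr_le0.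
have e2 := expR_lower (z * u); have e3 := expR_ge0 (- (z * u)).
apply/andP; split; first by rewrite mulr_ge0// subr_ge0.
by rewrite minEle; case: ifP => _; nra.
Qed.

Let derF (z : R) : 0 < z -> is_derive z 1 F (F' z).
Proof.
move=> z0.
have Iz : [set` `]0, z + 1[] z by rewrite /= in_itv/= z0 ltrDl ltr01.
have pE x y : partial1of2 g x y = y * (1 - expR (- (x * y))).
  by rewrite partial1of2E; exact: derive_val.
have intf x : [set` `]0, z + 1[] x -> m.-integrable pos (EFin \o g x).
  by rewrite /= in_itv/= => /andP[x0 _]; exact/g_int/ltW.
have dg x y : [set` `]0, z + 1[] x -> pos y -> derivable (g ^~ y) x 1.
  by move=> _ _; exact: ex_derive.
(* For [x < z + 1] the factor [1 + x] of [d1g_bound] is at most [2 + z]; the absolute value keeps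
   [G] nonnegative at negative [u]. *)
pose G u : R := `| (2 + z) * Num.min u (u ^+ 2) |.
have G0 y : 0 <= G y by exact: normr_ge0.
have iG : m.-integrable pos (EFin \o G).
  rewrite (_ : EFin \o G = abse \o (fun u => (2 + z)%:E * (Num.min u (u ^+ 2))%:E)%E).
    by apply: integrable_abse; exact: integrableZl.
  by apply/funext => u; rewrite /= /G.
have Gub x y : [set` `]0, z + 1[] x -> pos y -> `|partial1of2 g x y| <= G y.
  rewrite /= !in_itv/= andbT => /andP[x0 xz] y0; rewrite pE.
  have /andP[h1 h2] := d1g_bound (ltW x0) (ltW y0).
  rewrite ger0_norm// (le_trans h2)// (le_trans _ (ler_norm _))// ler_wpM2r//; last lra.
  by rewrite le_min (ltW y0) sqr_ge0.
have := @derivable_under_integral _ _ _ m g pos _ _ _ _ Iz intf dg G G0 iG Gub.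
have := @differentiation_under_integral _ _ _ m g pos _ _ _ _ Iz intf dg G G0 iG Gub.
rewrite derive1E => /(_ (measurable_itv _)) FE /(_ (measurable_itv _)) dF.
apply: DeriveDef => //; rewrite FE; apply: eq_Rintegral => u _.
by rewrite pE.
Qed.

Let F'_int (z : R) : 0 <= z -> m.-integrable pos (fun u => (u * (1 - expR (- (z * u))))%:E).
Proof.
move=> z0.
apply: (@le_integrable _ _ _ m _ _ _ (fun u => (1 + z)%:E * (Num.min u (u ^+ 2))%:E)%E) => //.
- apply/measurable_EFinP;
    apply: (@measurable_funM _ _ _ pos id (fun u => 1 - expR (- (z * u)))) => //.
  by apply: measurable_funB => //; exact: mexp.
- move=> u /=; rewrite in_itv/= andbT => /ltW u0; rewrite lee_fin.
  have /andP[h1 h2] := d1g_bound z0 u0.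
  by rewrite ger0_norm// (le_trans h2)// ler_norm.
- exact: integrableZl.
Qed.

Let F'E (z : R) : 0 <= z -> (F' z)%:E = (\int[m]_(u in pos) (u * (1 - expR (- (z * u))))%:E)%E.
Proof. by move=> z0; rewrite /F' /Rintegral fineK// integrable_fin_num//; exact: F'_int. Qed.

Let F'_ge0 (z : R) : 0 <= z -> 0 <= F' z.
Proof.
move=> z0; apply: Rintegral_ge0 => u /=; rewrite in_itv/= andbT => /ltW u0.
by case/andP: (d1g_bound z0 u0).
Qed.

Let D (z : R) := b + 2 * c * z + F' z.

Let derphi (z : R) : 0 < z -> derive1 phi z = D z.
Proof.
move=> z0; have dF := derF z0.
rewrite derive1E (_ : phi = (b \*: (@id R)) + (c \*: ((@id R) ^+ 2)) + F); last first.
  apply/funext => x; rewrite /branching_mechanism !fctE /=.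
  by rewrite -[b *: x]/(b * x) -[c *: _]/(c * _).
rewrite derive_val /= /D.
by rewrite -[b *: 1]/(b * 1) -[c *: _]/(c * _) -[(_ : R) *: 1]/(_ * 1) expr1 /=; ring.
Qed.

Let D_nd (x y : R) : 0 < x -> x <= y -> D x <= D y.
Proof.
move=> x0 xy; rewrite /D; have y0 := lt_le_trans x0 xy.
rewrite lerD//; first by rewrite lerD2l ler_wpM2l// mulr_ge0.
rewrite /F'; apply: le_Rintegral => //; [exact/F'_int/ltW|exact/F'_int/ltW|].
move=> u /=; rewrite in_itv/= andbT => u0.
by rewrite ler_pM2l// lerD2l lerN2 ler_expR lerN2 ler_pM2r.
Qed.

Let D_cvg : (D z)%:E @[z --> +oo] --> delta%:E.
Proof.
(* [D] is monotone, and known to be the derivative of [phi], at positive arguments only. Freezing it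
   below 1 gives a function monotone on the whole line, so that the [lim] in [derive_at_infty] is a
   genuine limit. *)
pose h (z : R) := (D (Num.max z 1))%:E.
have hnd : nondecreasing_fun h.
  move=> x y xy; rewrite lee_fin; apply: D_nd; first by rewrite lt_max ltr01 orbT.
  by rewrite ge_max !le_max xy lexx orbT.
have hE : {near +oo, h =1 (fun z => (D z)%:E)}.
  by near=> z; rewrite /h max_l.
have hE' : {near +oo, h =1 (fun z => (derive1 phi z)%:E)}.
  near=> z; rewrite /h max_l//.
  by rewrite derphi.
have hcvg := nondecreasing_cvge hnd.
have <- : ereal_sup (range h) = delta%:E.
  rewrite -hdelta /derive_at_infty; apply/esym/cvg_lim => //.
  apply: cvg_trans hcvg; exact: near_eq_cvg.
by apply: cvg_trans hcvg; exact: near_eq_cvg.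
Unshelve. all: by end_near. Qed.

Let D_le (n : nat) : D n.+1%:R <= delta.
Proof.
rewrite -lee_fin; apply: (cvge_to_ge D_cvg); near=> z.
by rewrite lee_fin D_nd// ltr0n.
Unshelve. all: by end_near. Qed.

Lemma quadratic_coef0 : c = 0.
Proof.
apply/eqP; rewrite eq_le hc andbT leNgt; apply/negP => c0.
(* At [n.+1] the linear term [2 * c * z] exceeds [delta - b], while the integral term is
   nonnegative: this contradicts [D <= delta]. *)
pose n := Num.Def.truncn (`|delta - b| / (2 * c)).
have := D_le n; rewrite /D => h.
have := F'_ge0 (ler0n R n.+1).
have : `|delta - b| / (2 * c) < n.+1%:R by exact: truncnS_gt.
rewrite ltr_pdivrMr ?mulr_gt0// => h1 h2.
by have := ler_norm (delta - b); lra.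
Qed.

(** With [c = 0] the derivative minus [b] is the integral of [u * (1 - expR (- (n * u)))], which
    increases to [u]. *)
Lemma first_moment : (\int[m]_(u in `]0%R, +oo[) u%:E = (delta - b)%:E)%E.
Proof.
have lim1 : (D n%:R)%:E @[n --> \oo] --> delta%:E.
  by apply: (cvg_comp _ _ _ D_cvg); exact: cvgr_idn.
have lim2 : (\int[m]_(u in pos) (u * (1 - expR (- (n%:R * u))))%:E)%E @[n --> \oo] --> (delta -
  b)%:E.
  rewrite (_ : (fun n => _) = (fun n => (D n%:R)%:E - b%:E)%E).
    by rewrite EFinB; apply: cvgeB => //; exact: cvg_cst.
  apply/funext => n; rewrite -F'E// -EFinB /D quadratic_coef0; congr (_%:E); ring.
rewrite -(cvg_lim _ lim2)//; apply/esym/cvg_lim => //.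
rewrite (_ : (\int[m]_(u in _) u%:E)%E =
   (\int[m]_(u in pos) limn (fun n => (u * (1 - expR (- (n%:R * u))))%:E))%E).
  apply: cvg_monotone_convergence => //.
  - by move=> n; have /measurable_int := F'_int (ler0n R n).
  - move=> n u /=; rewrite in_itv/= andbT => /ltW u0.
    by rewrite lee_fin; case/andP: (d1g_bound (ler0n R n) u0).
  - move=> u /=; rewrite in_itv/= andbT => u0 i j ij.
    by rewrite lee_fin ler_pM2l// lerD2l lerN2 ler_expR lerN2 ler_pM2r// ler_nat.
apply: eq_integral => u /set_mem /=; rewrite in_itv/= andbT => u0.
apply/esym/cvg_lim => //; apply: cvg_EFin; first exact: nearW.
rewrite -[X in _ --> X]mulr1 -[X in _ --> u * X]subr0; apply: cvgMl_tmp; apply: cvgB;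
  first exact: cvg_cst.
under eq_fun do rewrite -mulrN expRM_natl.
by apply: cvg_expr; rewrite ger0_norm ?expR_ge0// expR_lt1 oppr_lt0.
Qed.

(* A finite [delta] forces [c = 0] and [delta = b + \int u m(du)], whence a
   formula for [phi] without compensator. *)
Lemma phiE (z : R) : 0 <= z ->
  (\int[m]_(u in `]0%R, +oo[) (1 - expR (- (u * z)))%:E = (delta * z - phi z)%:E)%E.
Proof.
move=> z0.
have iu : m.-integrable pos (fun u => u%:E).
  apply/integrableP; split; first exact/measurable_EFinP.
  rewrite (_ : (\int[m]_(x in _) _)%E = (delta - b)%:E) ?ltry// -first_moment.
  by apply: eq_integral => u /set_mem/=; rewrite in_itv/= andbT => u0; rewrite gtr0_norm.
have ig := g_int z0.
have Fz : (F z)%:E = (\int[m]_(u in pos) (g z u)%:E)%E.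
  by rewrite /F /Rintegral fineK// integrable_fin_num.
transitivity (\int[m]_(u in pos) (z%:E * u%:E - (g z u)%:E))%E.
  apply: eq_integral => u _; rewrite -EFinM -EFinB /g (mulrC u z); congr (_%:E); ring.
rewrite integralB//; last exact: integrableZl.
rewrite integralZl// first_moment -Fz -EFinM -EFinB; congr (_%:E).
rewrite /branching_mechanism quadratic_coef0 -/(F z); ring.
Qed.

(** By [phiE], [delta * z - phi z] is nondecreasing in [z], with increments at most those of [z]
    times the first moment [delta - b] of [m], because [1 - expR (- y) <= y]. *)
Lemma phi_lipschitz (x y : R) : 0 <= x -> 0 <= y ->
  `|phi x - phi y| <= (`|delta| + (delta - b)) * `|x - y|.
Proof.
wlog xy : x y / x <= y.
  move=> H x0 y0; have [/H|/ltW/H] := leP x y; first exact.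
  by rewrite distrC (distrC x); exact.
move=> x0 y0.
have mI (z : R) : measurable_fun pos (fun u : R => (1 - expR (- (u * z)))%:E).
  apply/measurable_EFinP; apply: measurable_funB => //.
  rewrite (_ : (fun u : R => _) = (fun u : R => expR (- (z * u)))); first exact: mexp.
  by apply/funext => u; rewrite mulrC.
have I0 (z u : R) : 0 <= z -> pos u -> 0 <= 1 - expR (- (u * z)).
  by move=> z0 /=; rewrite in_itv/= andbT => u0;
    rewrite subr_ge0 expR_le1 oppr_le0 mulr_ge0// ltW.
have db : 0 <= delta - b.
  rewrite -lee_fin -first_moment; apply: integral_ge0 => u /=.
  by rewrite in_itv/= andbT lee_fin => /ltW.
have h1 : delta * x - phi x <= delta * y - phi y.
  rewrite -lee_fin -(phiE x0) -(phiE y0).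
  apply: ge0_le_integral; [by []| |exact: mI|exact: mI|].
  - by move=> u up; rewrite lee_fin I0.
  - move=> u /=; rewrite in_itv/= andbT => u0.
    by rewrite lee_fin lerD2l lerN2 ler_expR lerN2 ler_pM2l.
have h2 : delta * y - phi y <= delta * x - phi x + (y - x) * (delta - b).
  have Z : ((y - x)%:E * \int[m]_(u in pos) u%:E = \int[m]_(u in pos) ((y - x)%:E * u%:E))%E.
    rewrite ge0_integralZl_EFin ?subr_ge0//.
    by move=> u /=; rewrite in_itv/= andbT lee_fin => /ltW.
  rewrite -lee_fin [leRHS]EFinD EFinM -(phiE x0) -(phiE y0) -first_moment Z.
  rewrite -ge0_integralD; [|by []| |exact: mI| |]; last 3 first.
  - by move=> u up; rewrite lee_fin I0.
  - move=> u /=; rewrite in_itv/= andbT -EFinM lee_fin => /ltW u0.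
    by rewrite mulr_ge0// subr_ge0.
  - by apply: measurable_funeM; exact/measurable_EFinP.
  apply: ge0_le_integral; [by []| |exact: mI| |].
  - by move=> u up; rewrite lee_fin I0.
  - apply: emeasurable_funD; first exact: mI.
    by apply: measurable_funeM; exact/measurable_EFinP.
  - move=> u up; rewrite -EFinM -EFinD lee_fin.
    have u0 : 0 < u by move: up; rewrite /= in_itv/= andbT.
    have e1 := expR_lower (u * (y - x)).
    have -> : expR (- (u * y)) = expR (- (u * x)) * expR (- (u * (y - x))).
      by rewrite -expRD; congr expR; ring.
    have e2 := I0 x u x0 up; have e3 := expR_ge0 (- (u * x)).
    have e4 : 0 <= 1 - expR (- (u * (y - x))) by apply: I0; rewrite ?subr_ge0.
    nra.
have -> : `|x - y| = y - x by rewrite ler0_norm ?subr_le0// opprB.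
have d1 := ler_norm delta; have d2 := ler_norm (- delta); rewrite normrN in d2.
by rewrite ler_norml; apply/andP; split; nra.
Qed.

End branching.

(** * Regularity of the cumulant and the clock identity *)

Section cumulant.
Context {R : realType}.
Variables (phi : R -> R) (L : R) (v : R -> R -> R) (delta lambda : R).
Hypothesis phiL : forall x y, 0 <= x -> 0 <= y -> `|phi x - phi y| <= L * `|x - y|.
Hypothesis hv : is_cumulant phi v.
Hypothesis lambda0 : 0 <= lambda.
Notation leb := (@lebesgue_measure R).

Let v_ge0 t : 0 <= t -> 0 <= v t lambda.
Proof. by move=> t0; case: (hv t0 lambda0). Qed.

(** [v] is constrained at nonnegative times only. Extending the integrand by 0, and [v] below 0 by
    its initial value in [w], makes the integral equation valid from any negative base point, so
    that continuity at 0 is two-sided. *)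
Let f : R -> R := (fun s => phi (v s lambda)) \_ `[0, +oo[.
Let w (q : R) := v (Num.max q 0) lambda.

Let w_ge0 q : 0 <= w q.
Proof. by apply: v_ge0; rewrite le_max lexx orbT. Qed.

Let wE q : 0 <= q -> w q = v q lambda.
Proof. by move=> q0; rewrite /w max_l. Qed.

Let intf a T : leb.-integrable `[a, T] (EFin \o f).
Proof.
rewrite /f -restrict_EFin; apply/integrable_restrict => //.
case: (hv (normr_ge0 T) lambda0) => _ + _; apply: integrableS => //.
  exact: measurableI.
move=> s [/=]; rewrite !in_itv/= andbT => /andP[_ sT] ->.
by rewrite (le_trans sT)// ler_norm.
Qed.

Let w_int a q : a < 0 -> w q = lambda - \int[leb]_(s in `[a, q]) f s.
Proof.
move=> a0; rewrite /f -Rintegral_mkcondr.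
have [q0|q0] := leP 0 q.
  rewrite wE//; case: (hv q0 lambda0) => _ _ ->; congr (_ - _).
  congr (Rintegral _ _ _); apply/seteqP; split => s /=; rewrite !in_itv/= andbT.
    by move=> /andP[s0 ->]; rewrite s0 (le_trans (ltW a0) s0).
  by move=> [/andP[_ ->] ->].
rewrite /w max_r ?(ltW q0)//; case: (hv (lexx 0) lambda0) => _ _ ->; congr (_ - _).
rewrite set_itv1 Rintegral_set1 (_ : _ `&` _ = set0) ?Rintegral_set0//.
apply/seteqP; split => // s /=; rewrite !in_itv/= andbT => -[/andP[_ sq] s0].
by have := le_lt_trans sq q0; rewrite ltNge s0.
Qed.

Let w_cont : continuous w.
Proof.
move=> q; pose a := - `|q| - 1; pose T := `|q| + 1.
have a0 : a < 0 by rewrite /a; have := normr_ge0 q; lra.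
have aT : a < T by rewrite /a /T; have := normr_ge0 q; lra.
have := parameterized_integral_continuous (ltW aT) (intf a T).
move=> /(@within_continuous_continuous _ _ _ _ _ _ q aT) h.
have wf : w = (fun q => lambda - \int[leb]_(s in `[a, q]) f s).
  by apply/funext => x; exact: w_int.
rewrite wf; apply: cvgB; first exact: cvg_cst.
apply: h; rewrite in_itv/= /a /T; have := ler_norm q; have := ler_norm (- q).
by rewrite normrN => ? ?; apply/andP; split; lra.
Qed.

Let phiw_cont : continuous (fun q => phi (w q)).
Proof.
have L0 : 0 <= L.
  by have := phiL (lexx 0) ler01; rewrite sub0r normrN normr1 mulr1; exact: le_trans.
move=> q; apply/cvgrPdist_lt => e e0.
have e1 : 0 < e / (L + 1) by rewrite divr_gt0// ltr_wpDl.
have /cvgrPdist_lt/(_ _ e1) : w y @[y --> q] --> w q by exact: w_cont.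
apply: filterS => y; rewrite ltr_pdivlMr ?ltr_wpDl// => h.
rewrite (le_lt_trans (phiL _ _))//.
by have := normr_ge0 (w q - w y); nra.
Qed.

Let w_derive (q : R) : 0 < q -> is_derive q 1 w (- phi (w q)).
Proof.
move=> q0.
have wf : w = cst lambda - (fun q => \int[leb]_(s in `[-1, q]) f s).
  by apply/funext => x; rewrite (w_int x (ltrN10 _)) !fctE.
have m1q : (BRight (-1) < BRight q)%O by rewrite bnd_simp (lt_trans (ltrN10 _)).
have fE y : 0 < y -> f y = phi (w y).
  by move=> y0; rewrite /f patchE mem_set ?wE ?(ltW y0)//= in_itv/= andbT ltW.
have fq : {for q, continuous f}.
  suff : f y @[y --> q] --> phi (w q) by rewrite -(fE q q0).
  apply: (@cvg_trans _ (phi (w y) @[y --> q])); last exact: phiw_cont.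
  apply: near_eq_cvg; near=> y; rewrite fE//.
  by near: y; exact: lt_nbhsr.
have [dF F'] := @continuous_FTC1_closed _ f (-1) q (q + 1) (ltr_pwDr ltr01 (lexx q)) (intf _ _)
  (lt_trans (ltrN10 _) q0) fq.
have dF' : is_derive q 1 (fun x => \int[leb]_(s in `[-1, x]) f s) (f q).
  apply: DeriveDef; first exact: dF.
  by rewrite -derive1E; exact: F'.
rewrite wf; apply: is_derive_eq; rewrite sub0r; congr (- _).
by rewrite -wf fE.
Unshelve. all: by end_near. Qed.

Lemma cumulant_integrable t : 0 <= t ->
  leb.-integrable `[0, t] (fun s => (v s lambda)%:E).
Proof.
move=> t0.
have : leb.-integrable `[0, t] (EFin \o w).
  apply: continuous_compact_integrable; first exact: segment_compact.
  exact: continuous_subspaceT.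
apply: eq_integrable => // s /set_mem/=; rewrite in_itv/= => /andP[s0 _].
by rewrite wE.
Qed.

Lemma measurable_cumulant_pos : measurable_fun setT w.
Proof. exact: continuous_measurable_fun. Qed.

Lemma measurable_phi_cumulant : measurable_fun setT (fun q => phi (w q)).
Proof. exact: continuous_measurable_fun. Qed.

Let clock_derive (s : R) : is_derive s 1 (clock delta) (expR (- (delta * s))).
Proof.
have d1 : is_derive s 1 (fun x : R => - (delta * x)) (- delta).
  rewrite (_ : (fun x => _) = (- delta) \*: (@id R)); last first.
    by apply/funext => x; rewrite -[RHS]/(- delta * x) mulNr.
  by apply: is_derive_eq; rewrite -[LHS]/(- delta * 1) mulr1.
have d2 := @is_derive1_comp _ expR (fun x : R => - (delta * x)) s _ _ (is_derive_expR _) d1.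
rewrite /clock; have [->|d0] := eqVneq delta 0.
  by rewrite mul0r oppr0 expR0; exact: is_derive_id.
rewrite (_ : (fun t => _) = delta^-1 \*: (cst 1 - (expR \o (fun x : R => - (delta * x)))));
  last first.
  by apply/funext => x.
by apply: is_derive_eq; rewrite -[LHS]/(delta^-1 * _) /=; field.
Qed.

Lemma delta_clock s : delta * clock delta s = 1 - expR (- (delta * s)).
Proof.
rewrite /clock; case: eqVneq => [->|d0]; first by rewrite !mul0r oppr0 expR0 subrr.
by rewrite mulVKf.
Qed.

(* Product rule for [clock delta s * v (t + r - s) lambda], where the clock
   satisfies [clock' = 1 - delta * clock]. *)
Lemma cumulant_clock_integral (t r : R) : 0 <= t -> 0 <= r ->
  (\int[leb]_(s in `[t, (t + r)%R])
     (clock delta s * (delta * v (t + r - s) lambda - phi (v (t + r - s) lambda)))%R%:E)%E =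
  (v r lambda * clock delta t + \int[leb]_(s in `[0%R, r]) v s lambda
      - lambda * clock delta (t + r))%:E.
Proof.
move=> t0; rewrite le_eqVlt => /predU1P[<-|r0].
  rewrite addr0 set_itv1 integral_set1 set_itv1 Rintegral_set1 addr0.
  by case: (hv (lexx 0) lambda0) => _ _ ->; rewrite set_itv1 Rintegral_set1 subr0 subrr.
pose h (s : R) := clock delta s * (delta * w (t + r - s) - phi (w (t + r - s))).
have ccont : continuous (clock delta).
  by move=> s; apply/differentiable_continuous/derivable1_diffP; exact: ex_derive.
have rcont : continuous (fun s : R => t + r - s).
  by move=> s; apply: cvgB; [exact: cvg_cst|exact: cvg_id].
have wrcont : continuous (fun s => w (t + r - s)).
  by move=> s; apply: (@continuous_comp _ _ _ (fun s : R => t + r - s) w);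
    [exact: rcont|exact: w_cont].
have hcont : continuous h.
  move=> s; apply: cvgM; first exact: ccont.
  apply: cvgB; first by apply: cvgMl_tmp; exact: wrcont.
  by apply: (@continuous_comp _ _ _ (fun s : R => t + r - s) (fun q => phi (w q)));
    [exact: rcont|exact: phiw_cont].
(* The base point [-1] keeps [q = 0] in the interior, so that [V] is differentiable there; this is
   the endpoint [s = t + r] below. *)
pose V (q : R) := \int[leb]_(s in `[-1, q]) w s.
have wint a T : leb.-integrable `[a, T] (EFin \o w).
  apply: continuous_compact_integrable; first exact: segment_compact.
  exact: continuous_subspaceT.
have dV (q : R) : 0 <= q -> is_derive q 1 V (w q).
  move=> q0.
  have [dF F'] := @continuous_FTC1_closed _ w (-1) q (q + 1) (ltr_pwDr ltr01 (lexx q)) (wint _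
    _) (lt_le_trans (ltrN10 _) q0) (@w_cont q).
  by apply: DeriveDef; [exact: dF|rewrite -derive1E; exact: F'].
(* The derivative of the product contains [w * expR (- (delta * s))], that is,
   [w - delta * clock delta s * w]; the term [V] absorbs the isolated [w]. *)
pose U (s : R) := - (w (t + r - s) * clock delta s + V (t + r - s)).
have dr (s : R) : is_derive s 1 (fun s : R => t + r - s) (-1).
  rewrite (_ : (fun s => _) = cst (t + r) - @id R); last by apply/funext.
  by apply: is_derive_eq; rewrite sub0r.
have Ucont (s : R) : s <= t + r -> {for s, continuous U}.
  move=> sr; apply: cvgN; apply: cvgD; first by apply: cvgM; [exact: wrcont|exact: ccont].
  apply: (@continuous_comp _ _ _ (fun s : R => t + r - s) V); first exact: rcont.
  apply/differentiable_continuous/derivable1_diffP.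
  have := dV (t + r - s); rewrite subr_ge0 => /(_ sr) ?; exact: ex_derive.
have dU (s : R) : s < t + r -> is_derive s 1 U (h s).
  move=> sr; have q0 : 0 < t + r - s by rewrite subr_gt0.
  have d1 := @is_derive1_comp _ w _ s _ _ (w_derive q0) (dr s).
  have d2 := @is_derive1_comp _ V _ s _ _ (dV _ (ltW q0)) (dr s).
  have d3 := clock_derive s.
  rewrite (_ : U = - ((w \o (fun s : R => t + r - s)) * clock delta + (V \o (fun s : R =>
    t + r - s)))); last by apply/funext.
  apply: is_derive_eq; rewrite /h /=.
  rewrite -[_ *: expR _]/(w (t + r - s) * expR _) -[_ *: (_ : R)]/(clock delta s * (- phi (w (t
    + r - s)) * -1)).
  by have := delta_clock s; nra.
have trt : t < t + r by rewrite ltrDl.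
have FTC : (\int[leb]_(s in `[t, (t + r)%R]) (h s)%:E = (U (t + r))%:E - (U t)%:E)%E.
  apply: continuous_FTC2 => //.
  - exact: continuous_subspaceT.
  - split.
    + by move=> s; rewrite in_itv/= => /andP[_ sr]; have := dU _ sr => ?; exact: ex_derive.
    + by apply: cvg_at_right_filter; apply: Ucont; exact: ltW.
    + by apply: cvg_at_left_filter; apply: Ucont.
  - move=> s; rewrite in_itv/= => /andP[_ sr]; have := dU _ sr => ?.
    by rewrite derive1E derive_val.
transitivity (\int[leb]_(s in `[t, (t + r)%R]) (h s)%:E)%E.
  apply: eq_integral => s /set_mem/=; rewrite in_itv/= => /andP[_ sr].
  by rewrite /h wE// subr_ge0.
rewrite FTC -EFinB /U; congr (_%:E).
have -> : t + r - (t + r) = 0 by rewrite subrr.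
have -> : t + r - t = r by rewrite addrC addKr.
rewrite (wE (lexx 0)) (wE (ltW r0)).
have -> : v 0 lambda = lambda.
  by case: (hv (lexx 0) lambda0) => _ _ ->; rewrite set_itv1 Rintegral_set1 subr0.
suff : V r - V 0 = \int[leb]_(s in `[0, r]) v s lambda by lra.
rewrite /V (Rintegral_itvB (wint _ _)) ?bnd_simp ?(ltW r0) ?oppr_le0//.
rewrite Rintegral_itv_obnd_cbnd; last first.
  by apply: integrableS (wint 0 r) => //; exact: subset_itv_oc_cc.
apply: eq_Rintegral => s /set_mem/=; rewrite in_itv/= => /andP[s0 _].
by rewrite wE.
Qed.

End cumulant.

(** * Path space and intensity *)

Section path_evaluation.
Context {R : realType}.
Implicit Types (w : D R) (n k : nat).

Lemma measurable_coordinate q : measurable_fun setT (fun w : D R => w q : measurableTypeR R).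
Proof.
have [q0|q0] := ltP q 0.
  rewrite (_ : (fun w : D R => _) = cst 0); first exact: measurable_cst.
  by apply/funext => w; rewrite path_lt0.
move=> _ B mB; apply: sub_sigma_algebra; exists q; first by rewrite /= in_itv/= q0.
by exists B.
Qed.

Lemma filtration_measurable t A : path_filtration t A -> measurable (A : set (D R)).
Proof.
apply: smallest_sub; first exact: smallest_sigma_algebra.
move=> B [s]; rewrite /= in_itv/= => /andP[s0 _] sB; apply: sub_sigma_algebra.
by exists s => //=; rewrite in_itv/= s0.
Qed.

Lemma path_filtration_mono s t : s <= t -> @path_filtration R s `<=` @path_filtration R t.
Proof.
move=> st; apply: smallest_sub; first exact: smallest_sigma_algebra.
move=> B [u]; rewrite /= in_itv/= => /andP[u0 us] uB; apply: sub_sigma_algebra.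
by exists u => //=; rewrite in_itv/= u0 (le_trans us).
Qed.

Lemma path_filtration_coordinate q t (B : set (measurableTypeR R)) : q <= t -> measurable B ->
  path_filtration t [set w : D R | B (w q)].
Proof.
move=> qt mB; have [q0|q0] := ltP q 0.
  have [B0|B0] := pselect (B 0).
    rewrite (_ : [set w : D R | _] = setT); first by rewrite -setC0; apply: sigma_algebraC;
      exact: sigma_algebra0.
    by apply/seteqP; split => // w _ /=; rewrite path_lt0.
  rewrite (_ : [set w : D R | _] = set0); first exact: sigma_algebra0.
  by apply/seteqP; split => // w /=; rewrite path_lt0.
apply: sub_sigma_algebra; exists q; first by rewrite /= in_itv/= q0.
by exists B => //; rewrite setTI.
Qed.

(** Of the two neighbouring points of the grid of mesh [n.+1%:R^-1], the upper one lies strictly to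
    the right of [r] and suits right-continuity; the lower one involves only the past of the path
    and suits the filtration. *)
Definition grid_index n (r : R) : nat := Num.truncn (r * n.+1%:R).
Definition grid_lo n (r : R) : R := (grid_index n r)%:R / n.+1%:R.
Definition grid_hi n (r : R) : R := (grid_index n r).+1%:R / n.+1%:R.

Lemma grid_lo_le n (r : R) : 0 <= r -> grid_lo n r <= r.
Proof.
by move=> r0; rewrite /grid_lo ler_pdivrMr// truncn_le// mulr_ge0.
Qed.

Lemma grid_hi_gt n (r : R) : r < grid_hi n r.
Proof. by rewrite /grid_hi ltr_pdivlMr// truncnS_gt. Qed.

Lemma grid_hiE n (r : R) : grid_hi n r = grid_lo n r + n.+1%:R^-1.
Proof. by rewrite /grid_hi /grid_lo -[in LHS]addn1 natrD mulrDl mul1r. Qed.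

Lemma grid_index_eq n k (r : R) : 0 <= r ->
  (grid_index n r = k) <-> (k%:R / n.+1%:R <= r /\ r < k.+1%:R / n.+1%:R).
Proof.
move=> r0; split=> [<-|[]].
  by split; [exact: grid_lo_le|exact: grid_hi_gt].
rewrite ler_pdivrMr// ltr_pdivlMr// => h1 h2.
by apply/eqP; rewrite truncn_eq ?mulr_ge0// h1.
Qed.

Lemma cvg_grid_hi (r : R) : 0 <= r -> grid_hi n r @[n --> \oo] --> r.
Proof.
move=> r0; apply: (@squeeze_cvgr _ _ _ _ (fun=> r) (fun n => r + harmonic n)).
- near=> n; rewrite ltW ?grid_hi_gt//= grid_hiE lerD2r.
  exact: grid_lo_le.
- exact: cvg_cst.
- rewrite -[X in _ --> X]addr0; apply: cvgD; [exact: cvg_cst|exact: cvg_harmonic].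
Unshelve. all: by end_near. Qed.

Lemma cvg_grid_lo (r : R) : 0 <= r -> grid_lo n r @[n --> \oo] --> r.
Proof.
move=> r0; apply: (@squeeze_cvgr _ _ _ _ (fun n => r - harmonic n) (fun=> r)).
- near=> n; rewrite grid_lo_le// andbT /= lerBlDr -grid_hiE.
  by rewrite ltW ?grid_hi_gt.
- rewrite -[X in _ --> X]subr0; apply: cvgB; [exact: cvg_cst|exact: cvg_harmonic].
- exact: cvg_cst.
Unshelve. all: by end_near. Qed.

Lemma measurable_grid_index n k : measurable ([set r | grid_index n r = k] : set
  (measurableTypeR R)).
Proof.
have mle j : measurable ([set r | (grid_index n r <= j)%N] : set (measurableTypeR R)).
  rewrite (_ : [set r | _] = `]-oo, j.+1%:R / n.+1%:R[%classic); first exact: measurable_itv.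
  by apply/seteqP; split => r /=; rewrite in_itv/= ltr_pdivlMr// truncn_le_nat.
case: k => [|k].
  rewrite (_ : [set r | _] = [set r | (grid_index n r <= 0)%N]); first exact: mle.
  by apply/seteqP; split => r /=; rewrite leqn0 => /eqP.
rewrite (_ : [set r | _] = [set r | (grid_index n r <= k.+1)%N] `\` [set r | (grid_index n r <=
  k)%N]).
  exact: measurableD.
apply/seteqP; split => r /= => [->|[]]; first by rewrite leqnn ltnn.
by move=> h1 /negP; rewrite -ltnNge => h2; apply/eqP; rewrite eqn_leq h1.
Qed.

(** By right-continuity the value is the limit of the values at the upper grid points, and for each
    mesh the preimages are countable unions of rectangles, one for each grid cell. *)
Lemma measurable_evaluation :
  measurable_fun setT (fun z : measurableTypeR R * D R => z.2 z.1 : measurableTypeR R).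
Proof.
pose X n (z : measurableTypeR R * D R) : R := if z.1 < 0 then 0 else z.2 (grid_hi n z.1).
apply: (@measurable_fun_cvg _ _ _ _ X); last first.
  move=> [r w] _ /=; rewrite /X /=; have [r0|r0] := ltP r 0.
    by rewrite path_lt0//; exact: cvg_cst.
  have /cvg_at_rightP := @path_right _ w r r0; apply; split.
    by move=> n; exact: grid_hi_gt.
  exact: cvg_grid_hi.
move=> n; rewrite /X; apply: measurable_fun_ifT; [|exact: measurable_cst|].
  by apply: measurable_fun_ltr => //; exact: measurable_fst.
move=> _ B mB; rewrite setTI.
rewrite (_ : _ @^-1` B = \bigcup_k ([set r | grid_index n r = k] `*`
    [set w : D R | B (w (k.+1%:R / n.+1%:R))])).
  apply: bigcupT_measurable => k; apply: measurableX; first exact: measurable_grid_index.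
  by rewrite -[X in measurable X]setTI; exact: measurable_coordinate.
by apply/seteqP; split => -[r w] /=; [exists (grid_index n r)|move=> [k _ [/= <-]]].
Qed.

(** A jump at [r] is coded by its direction [sg] and rationals [a < r] and [p] with
    [sg * w s < p < sg * w r] for all [s] in []a, r[]. Of two points with the same code, the smaller
    one would violate the condition of the larger one. *)
Lemma countable_jumps w : countable [set r : R | ~ (w s @[s --> r^'-] --> w r)].
Proof.
have left_cvg (r : R) : exists l : R, w s @[s --> r^'-] --> l.
  have [r0|r0] := ltP 0 r.
    by have /cvg_ex[l wl] := @path_left _ w r r0; exists l.
  exists 0; apply: (@cvg_trans _ (cst 0 s @[s --> r^'-])); last exact: cvg_cst.
  apply: near_eq_cvg; near=> s; rewrite path_lt0//.
  by apply: (lt_le_trans _ r0); near: s; exact: nbhs_left_lt.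
pose T (sg : R) (ap : rat * rat) := [set r : R | [/\ ratr ap.1 < r,
  forall s, ratr ap.1 < s -> s < r -> sg * w s < ratr ap.2 & ratr ap.2 < sg * w r]].
have TT sg ap : countable (T sg ap).
  have [[r Tr]|T0] := pselect (T sg ap !=set0); last first.
    rewrite (_ : T sg ap = set0); first exact: countable0.
    by apply/seteqP; split => // r Tr; apply: T0; exists r.
  apply: (sub_countable _ (countable1 r)); apply: subset_card_le => r' Tr' /=.
  case: Tr => ar rw rp; case: Tr' => ar' rw' rp'.
  have [rr|rr|//] := ltgtP r' r.
    by have := rw _ ar' rr; rewrite ltNge (ltW rp').
  by have := rw' _ ar rr; rewrite ltNge (ltW rp).
have jump (sg r l : R) : sg * w s @[s --> r^'-] --> sg * l -> sg * l < sg * w r ->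
    exists ap, T sg ap r.
  move=> wl lr; have [p] := rat_in_itvoo lr; rewrite in_itv/= => /andP[lp pr].
  have : \forall s \near r^'-, sg * w s < ratr p by apply: (cvgr_lt _ wl).
  move=> [e /= e0 he].
  have re : r - e < r by rewrite gtrBl.
  have [a] := rat_in_itvoo re; rewrite in_itv/= => /andP[ea ar].
  exists (a, p); split => //= s as_ sr; apply: he => //=.
  by rewrite gtr0_norm ?subr_gt0// ltrBlDr -ltrBlDl (lt_trans ea).
pose U (i : bool * (rat * rat)) := T (if i.1 then 1 else -1) i.2.
apply: (@sub_countable _ _ _ (\bigcup_i U i)); last first.
  by apply: bigcup_countable => [|i _]; [exact: countableP|exact: TT].
apply: subset_card_le => r /= nr; have [l wl] := left_cvg r.
have [lr|lr|lr] := ltgtP l (w r); last by move: wl; rewrite lr => /nr.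
  have [] := jump 1 r l; rewrite ?mul1r//.
    by under eq_fun do rewrite mul1r.
  by move=> ap Tap; exists (true, ap).
have [] := jump (-1) r l; rewrite ?mulN1r ?ltrN2//.
  by under eq_fun do rewrite mulN1r; exact: cvgN.
by move=> ap Tap; exists (false, ap).
Unshelve. all: by end_near. Qed.

End path_evaluation.

(** [mfrestr] turns the hypothesis on [nu] into an instance of a finite measure without changing the
    integrals. *)
Lemma ge0_tonelli_finite d1 d2 (T1 : measurableType d1) (T2 : measurableType d2) (R : realType)
    (m1 : {sigma_finite_measure set T1 -> \bar R}) (nu : {measure set T2 -> \bar R}) :
  (nu setT < +oo)%E ->
  forall f : T1 * T2 -> \bar R, measurable_fun setT f -> (forall z, (0 <= f z)%E) ->
  (\int[m1]_x \int[nu]_y f (x, y) = \int[nu]_y \int[m1]_x f (x, y))%E.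
Proof.
move=> nuoo f mf f0.
pose M := mfrestr measurableT nuoo.
have ME g : (\int[nu]_y g y = \int[M]_y g y)%E.
  apply: eq_measure_integral => A mA _; have e := congr1 nu (setIT A).
  by rewrite -[LHS]e.
transitivity (\int[m1]_x \int[M]_y f (x, y))%E.
  by apply: eq_integral => x _; exact: ME.
transitivity (\int[M]_y \int[m1]_x f (x, y))%E; last by rewrite ME.
exact: (@fubini_tonelli _ _ _ _ _ m1 M f mf f0).
Qed.

Lemma measurable_section_integral d1 d2 (T1 : measurableType d1) (T2 : measurableType d2)
    (R : realType) (nu : {measure set T2 -> \bar R}) :
  (nu setT < +oo)%E ->
  forall f : T1 * T2 -> \bar R, measurable_fun setT f -> (forall z, (0 <= f z)%E) ->
  measurable_fun setT (fun x => \int[nu]_y f (x, y))%E.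
Proof.
move=> nuoo f mf f0.
pose M := mfrestr measurableT nuoo.
rewrite (_ : (fun x => _) = (fun x => \int[M]_y f (x, y)))%E.
  exact: (@measurable_fun_fubini_tonelli_F _ _ _ _ _ M f mf f0).
apply/funext => x; apply: eq_measure_integral => A mA _; have e := congr1 nu (setIT A).
by rewrite -[LHS]e.
Qed.

Section intensity_integral.
Context {R : realType} (beta : {posnum R}) (delta : R).
Variables (m : {sigma_finite_measure set (measurableTypeR R) -> \bar R})
  (Q : R.-pker (measurableTypeR R) ~> (D R)).
Notation leb := (@lebesgue_measure R).
Local Notation times := (immigration_times beta delta).
Local Notation mu := (immigration_intensity beta delta m Q).

(** The clock is negative at negative times, whereas [mscale] asks for a nonnegative factor at every
    real [s]. *)
Let rate (s : R) : R := Num.max 0 (beta%:num * clock delta s).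

Let rate_ge0 s : 0 <= rate s. Proof. by rewrite /rate le_max lexx. Qed.

Let rateE s : 0 <= s -> rate s = beta%:num * clock delta s.
Proof. by move=> s0; rewrite /rate max_r// mulr_ge0// clock_ge0. Qed.

Let krate (s : measurableTypeR R) : {measure set (measurableTypeR R) -> \bar R} :=
  mscale (NngNum (rate_ge0 s)) \d_s.

Let mkrate A : measurable A -> measurable_fun setT (krate ^~ A).
Proof.
move=> mA; apply: emeasurable_funM.
  apply/measurable_EFinP; apply: measurable_maxr => //; apply: measurable_funM => //.
  exact: measurable_clock.
by apply/measurable_EFinP; exact: measurable_indic.
Qed.

Lemma integral_times (g : measurableTypeR R -> \bar R) :
  measurable_fun setT g -> (forall s, (0 <= g s)%E) ->
  (\int[times]_s g s =
   \int[leb]_(s in `]0%R, +oo[) ((beta%:num * clock delta s)%:E * g s))%E.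
Proof.
move=> mg g0.
rewrite (@integral_mixture _ _ _ _ _ leb `]0%R, +oo[%classic (measurable_itv _) krate mkrate)//.
  apply: eq_integral => s /set_mem/=; rewrite in_itv/= andbT => s0.
  rewrite ge0_integral_mscale// integral_dirac// diracT mul1e/=.
  by rewrite rateE// ltW.
move=> A mA; rewrite /= /immigration_times /mixture setIC integral_mkcondr.
apply: eq_integral => s /set_mem/=; rewrite in_itv/= andbT => s0.
rewrite /mscale /= rateE ?(ltW s0)// diracE patchE.
by case: ifP => _; rewrite ?mule1 ?mule0.
Qed.

Let slice_dirac (w : D R) (s : measurableTypeR R) :
  {measure set (measurableTypeR R * D R) -> \bar R} := \d_(s, w).

Let mslice_dirac w A : measurable A -> measurable_fun setT (slice_dirac w ^~ A).
Proof.
move=> mA; apply/measurable_EFinP.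
apply: (measurableT_comp (measurable_indic mA)).
exact: measurable_pair2.
Qed.

Let slice (w : D R) : {measure set (measurableTypeR R * D R) -> \bar R} :=
  mixture times measurableT (mslice_dirac w).

Let sliceE w A : measurable A -> slice w A = times (ysection A w).
Proof.
move=> mA; rewrite /slice /= /mixture.
rewrite -[ysection A w]setIT -integral_indic//; last exact: measurable_ysection.
by apply: eq_integral => s _; rewrite /slice_dirac /= diracE !indicE mem_ysection.
Qed.

Let mslice A : measurable A -> measurable_fun setT (slice ^~ A).
Proof.
move=> mA; rewrite (_ : slice ^~ A = times \o ysection A).
  exact: measurable_fun_ysection.
by apply/funext => w; rewrite sliceE.
Qed.

Let integral_slice w h : measurable_fun setT h -> (forall z, (0 <= h z)%E) ->
  (\int[slice w]_z h z = \int[times]_s h (s, w))%E.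
Proof.
move=> mh h0.
rewrite (@integral_mixture _ _ _ _ _ times setT measurableT _ (mslice_dirac w))//.
by apply: eq_integral => s _; rewrite integral_dirac// diracT mul1e.
Qed.

Lemma measurable_times_integral h : measurable_fun setT h -> (forall z, (0 <= h z)%E) ->
  measurable_fun setT (fun w : D R => \int[times]_s h (s, w))%E.
Proof.
move=> mh h0; rewrite (_ : (fun w => _) = (fun w => \int[slice w]_z h z))%E.
  exact: measurable_fun_integral_kernel.
by apply/funext => w; rewrite integral_slice.
Qed.

Lemma integral_mixed_path_law g : measurable_fun setT g -> (forall w, (0 <= g w)%E) ->
  (\int[mixed_path_law m Q]_w g w = \int[m]_(x in `]0%R, +oo[) \int[Q x]_w g w)%E.
Proof.
move=> mg g0.
have mQ A : measurable A -> measurable_fun setT (fun x => Q x A) by exact: measurable_kernel.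
exact: (@integral_mixture _ _ _ _ _ m `]0%R, +oo[%classic (measurable_itv _) Q mQ).
Qed.

(** The product measure is the mixture over paths [w] of [slice w], the image of [times] under
    [s -> (s, w)], and the path law is itself a mixture over starting points. *)
Lemma integral_intensity h : measurable_fun setT h -> (forall z, (0 <= h z)%E) ->
  (\int[mu]_z h z = \int[m]_(x in `]0%R, +oo[) \int[Q x]_w \int[times]_s h (s, w))%E.
Proof.
move=> mh h0.
have muE A : measurable A -> mu A = mixture (mixed_path_law m Q) measurableT mslice A.
  move=> mA; rewrite /= /immigration_intensity /product_measure2 /mixture.
  by apply: eq_integral => w _; rewrite sliceE.
rewrite (integral_mixture muE mh h0).
rewrite integral_mixed_path_law; last 2 first.
- by apply: measurable_fun_integral_kernel.
- by move=> w; exact: integral_ge0.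
by apply: eq_integral => x _; apply: eq_integral => w _; rewrite integral_slice.
Qed.

(** The exchange is made for each starting point [x] separately, between [times] and the finite
    measure [Q x]. *)
Lemma integral_intensity_swap h : measurable_fun setT h -> (forall z, (0 <= h z)%E) ->
  (\int[mu]_z h z = \int[m]_(x in `]0%R, +oo[) \int[times]_s \int[Q x]_w h (s, w))%E.
Proof.
move=> mh h0; rewrite integral_intensity//; apply: eq_integral => x _.
rewrite ge0_tonelli_finite//.
by apply: (@le_lt_trans _ _ 1%E); [exact: sprob_kernel_le1|exact: ltry].
Qed.

End intensity_integral.

(** * CB-processes *)

Lemma full_setC_null d (T : measurableType d) (R : realType)
    (nu : {measure set T -> \bar R}) (A : set T) :
  measurable A -> nu setT = 1%E -> nu A = 1%E -> nu (~` A) = 0%E.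
Proof.
move=> mA nuT nuA; have : nu (A `|` ~` A) = (nu A + nu (~` A))%E.
  by apply: measureU => //; [exact: measurableC|rewrite setICr].
rewrite setUv nuT nuA; move: (nu (~` A)) => z.
by case: z => [z||]//= -[]; rewrite -[LHS]addr0 => /addrI <-.
Qed.

Lemma transition_integral_full (R : realType)
    (K : R -> R.-pker (measurableTypeR R) ~> (measurableTypeR R)) (t x : R) f :
  transition_semigroup K -> 0 <= t -> 0 <= x ->
  measurable_fun setT f -> (forall y, (0 <= f y)%E) ->
  (\int[K t x]_y f y = \int[K t x]_(y in `[0%R, +oo[) f y)%E.
Proof.
move=> [K1 _ _] t0 x0 mf f0.
pose A : set (measurableTypeR R) := `[0%R, +oo[%classic.
have mA : measurable A by exact: measurable_itv.
rewrite (ge0_negligible_integral (N := ~` A))//.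
- by rewrite setTD setCK.
- exact: measurableC.
by apply: full_setC_null; [exact: mA|exact: prob_kernel|exact: K1].
Qed.

Section CB_facts.
Context {R : realType} (phi : R -> R) (v : R -> R -> R)
  (K : R -> R.-pker (measurableTypeR R) ~> (measurableTypeR R)).
Hypotheses (hv : is_cumulant phi v) (hK : CB_semigroup v K).

Let v_ge0 t lambda : 0 <= t -> 0 <= lambda -> 0 <= v t lambda.
Proof. by move=> t0 l0; case: (hv t0 l0). Qed.

Let hT : transition_semigroup K. Proof. by case: hK. Qed.

Let mexp (l : R) : measurable_fun setT (fun y : measurableTypeR R => (expR (- (l * y)))%:E).
Proof.
by apply/measurable_EFinP; apply: measurableT_comp => //; exact: measurableT_comp.
Qed.

Lemma CB_laplace t x lambda : 0 <= t -> 0 <= x -> 0 <= lambda ->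
  (\int[K t x]_y (expR (- (lambda * y)))%:E = (expR (- (x * v t lambda)))%:E)%E.
Proof.
move=> t0 x0 l0; case: hK => _ hL; rewrite -hL//.
exact: transition_integral_full.
Qed.

(** Chapman-Kolmogorov from the starting point 1, read on Laplace transforms. *)
Lemma cumulant_semigroup s t lambda : 0 <= s -> 0 <= t -> 0 <= lambda ->
  v (s + t) lambda = v s (v t lambda).
Proof.
move=> s0 t0 l0; have := CB_laplace (addr_ge0 s0 t0) ler01 l0.
have mK A : measurable A -> measurable_fun setT (fun y => K t y A) by exact: measurable_kernel.
case: hK => -[_ _ CK] _.
rewrite (@integral_mixture _ _ _ _ _ (K s 1) `[0, +oo[%classic (measurable_itv _) (K t) mK)//;
  last first.
  by move=> A mA; exact: CK.
have E : (\int[K s 1%R]_(x in `[0%R, +oo[) \int[K t x]_y (expR (- (lambda * y)))%:E =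
    \int[K s 1%R]_(y in `[0%R, +oo[) (expR (- (v t lambda * y)))%:E)%E.
  apply: eq_integral => y /set_mem/=; rewrite in_itv/= andbT => y0.
  by rewrite CB_laplace// mulrC.
rewrite E.
rewrite -(transition_integral_full hT)//.
rewrite CB_laplace// ?v_ge0// !mul1r => -[/expR_inj/eqP].
by rewrite eqr_opp => /eqP.
Qed.

Lemma cumulant_mono t : 0 <= t -> {in `[0, +oo[ &, {homo v t : x y / x <= y}}.
Proof.
move=> t0 x y; rewrite !in_itv/= !andbT => x0 y0 xy.
have := CB_laplace t0 ler01 x0; have := CB_laplace t0 ler01 y0.
rewrite !(transition_integral_full hT)//.
rewrite !mul1r => ey ex; rewrite -lerN2 -ler_expR -lee_fin -ex -ey.
apply: ge0_le_integral => //.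
- exact: measurable_funTS.
- exact: measurable_funTS.
- move=> z /=; rewrite in_itv/= andbT => z0.
  by rewrite lee_fin ler_expR lerN2 ler_wpM2r.
Qed.

(** [K t 1] has total mass 1 on finite values, so its Laplace transform tends to 1 as the argument
    tends to 0. *)
Lemma cvg_cumulant0 t : 0 <= t -> v t (harmonic n) @[n --> \oo] --> (0 : R).
Proof.
move=> t0.
have h0 n : 0 <= harmonic n :> R by rewrite /= invr_ge0.
(* The absolute value bounds the integrand by 1 on the whole line; the integral is unchanged because
   [K t 1] does not charge the negative half-line. *)
have absE n : (expR (- (v t (harmonic n))))%:E = (\int[K t 1%R]_y (expR (- (harmonic n *
  `|y|)))%:E)%E.
  rewrite -[v t _ in LHS]mul1r -(CB_laplace t0 ler01 (h0 n)).
  have mabs : measurable_fun setT (fun y : measurableTypeR R =>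
    (expR (- (harmonic n * `|y|)))%:E).
    apply: (measurableT_comp (mexp _)); exact: normr_measurable.
  rewrite !(transition_integral_full hT)//.
  by apply: eq_integral => y /set_mem/=; rewrite in_itv/= andbT => y0; rewrite ger0_norm.
have lim1 : (expR (- (v t (harmonic n))))%:E @[n --> \oo] --> (1%:E : \bar R).
  under eq_fun do rewrite absE.
  rewrite (_ : 1%:E = \int[K t 1%R]_y 1%:E)%E; last first.
    by rewrite integral_cst// mul1e; exact/esym/prob_kernel.
  apply: (@bounded_cvg_integral _ _ _ _ _ _ 1) => //.
  - by apply: (@le_lt_trans _ _ 1%E); [exact: sprob_kernel_le1|exact: ltry].
  - move=> n; apply/measurable_EFinP; apply: (measurableT_comp (mexp _)); exact: normr_measurable.
  - move=> n y; rewrite ger0_norm ?expR_ge0// expR_le1 oppr_le0 mulr_ge0//.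
  - move=> y; rewrite -[X in _ --> X]expR0 -[X in expR X]oppr0; apply: cvg_expRN.
    rewrite -[X in _ --> X](mul0r `|y|); apply: cvgMr_tmp; exact: cvg_harmonic.
have /fine_cvgP[_ lim2] := lim1.
rewrite (_ : (fun n => _) = (fun n => - ln (expR (- (v t (harmonic n)))))); last first.
  by apply/funext => n; rewrite expRK opprK.
rewrite -[X in _ --> X]oppr0 -[X in _ --> - X](@ln1 R); apply: cvgN.
apply: (@cvg_comp _ _ _ (fun n => expR (- v t (harmonic n))) (@ln R) _ (nbhs (1 : R)));
  first exact: lim2.
exact: continuous_ln.
Qed.

Section paths.
Variables (Q : R.-pker (measurableTypeR R) ~> (D R)).
Hypothesis hQ : forall x, 0 <= x ->
  markov_process (Q x) (@path_filtration R) K (fun t w => w t) /\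
  Q x [set w : D R | w 0 = x] = 1%E.

Let me_path (l : R) (q : R) :
  measurable_fun setT (fun w : D R => (expR (- (l * w q)))%:E).
Proof. exact: (measurableT_comp (mexp l) (measurable_coordinate q)). Qed.

(** The Markov property identifies the law of [w (q + r)] on [C] with the mixture over [C] of the
    kernels [K r (w q)]; the exponential is integrated against both. *)
Let path_laplace_indic x q r lambda (C : set (D R)) : 0 <= x -> 0 <= q -> 0 <= r ->
  0 <= lambda -> path_filtration q C ->
  (\int[Q x]_(w in C) (expR (- (lambda * w (q + r))))%:E =
   \int[Q x]_(w in C) (expR (- (v r lambda * w q)))%:E)%E.
Proof.
move=> x0 q0 r0 l0 qC; have mC := filtration_measurable qC.
have [_ _ _ /(_ q r _ q0 r0) H] := (hQ x0).1.
pose k1 (w : D R) : {measure set (measurableTypeR R) -> \bar R} := \d_(w (q + r) :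
  measurableTypeR R).
have mk1 A : measurable A -> measurable_fun setT (k1 ^~ A).
  move=> mA; apply/measurable_EFinP.
  exact: (measurableT_comp (measurable_indic mA) (measurable_coordinate (q + r))).
pose k2 (w : D R) : {measure set (measurableTypeR R) -> \bar R} := K r (w q).
have mk2 A : measurable A -> measurable_fun setT (k2 ^~ A).
  move=> mA; exact: (measurableT_comp (measurable_kernel (K r) A mA) (measurable_coordinate q)).
pose M1 := mixture (Q x) mC mk1.
have M1E A : measurable A -> M1 A = mixture (Q x) mC mk2 A.
  move=> mA; have [_ /(_ C qC)] := H A mA; rewrite /M1 /mixture => <-.
  rewrite -integral_indic//.
    by rewrite -[X in measurable X]setTI; exact: (measurable_coordinate (q + r)).
transitivity (\int[M1]_y (expR (- (lambda * y)))%:E)%E.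
  rewrite (@integral_mixture _ _ _ _ _ (Q x) C mC k1 mk1 M1 (fun _ _ => erefl))//.
  apply: eq_integral => w _; rewrite integral_dirac//.
  by rewrite diracT mul1e.
rewrite (@integral_mixture _ _ _ _ _ (Q x) C mC k2 mk2 M1 M1E)//.
apply: eq_integral => w _; rewrite /k2 CB_laplace//; first by rewrite mulrC.
exact: path_ge0.
Qed.

Lemma path_laplace x q r lambda (g : D R -> R) : 0 <= x -> 0 <= q -> 0 <= r ->
  0 <= lambda -> (forall w, 0 <= g w) ->
  (forall B : set (measurableTypeR R), measurable B -> path_filtration q (g @^-1` B)) ->
  (\int[Q x]_w (g w * expR (- (lambda * w (q + r))))%:E =
   \int[Q x]_w (g w * expR (- (v r lambda * w q)))%:E)%E.
Proof.
move=> x0 q0 r0 l0 g0 mg.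
(* The same paths with the coarser sigma-algebra of time [q]: [g] is measurable on [Dq], and
   [weighted_law_eq] for the identity into [Dq] needs only the indicators of observed events. *)
pose Dq := g_sigma_algebraType (@coordinate_events R `[0, q]).
have mid : measurable_fun setT (id : D R -> Dq).
  by move=> _ B mB; rewrite setTI; exact: (filtration_measurable mB).
have mgq : measurable_fun setT (fun w : Dq => (g w)%:E).
  by apply/measurable_EFinP => _ B mB; rewrite setTI; exact: mg.
under eq_integral do rewrite EFinM.
under [RHS]eq_integral do rewrite EFinM.
apply: (@weighted_law_eq _ _ _ _ _ Dq _ (Q x) (Q x) id id (fun w =>
  (expR (- (lambda * w (q + r))))%:E)
  (fun w => (expR (- (v r lambda * w q)))%:E) mid mid (me_path _ _) (me_path _ _) _ _ _ (fun w
    => (g w)%:E)); [by []|by []| |exact: mgq|by move=> w; rewrite lee_fin].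
- move=> B mB.
  have mB' : measurable (B : set (D R)) by exact: (filtration_measurable mB).
  have E h : (\int[Q x]_w ((\1_B w)%:E * h w) = \int[Q x]_(w in B) h w)%E.
    rewrite [RHS]integral_mkcond; apply: eq_integral => w _.
    rewrite patchE indicE; case: ifP => _; rewrite ?mul1e ?mul0e//.
  by rewrite !E; exact: path_laplace_indic.
Qed.

Lemma path_laplace0 x r lambda : 0 <= x -> 0 <= r -> 0 <= lambda ->
  (\int[Q x]_w (expR (- (lambda * w r)))%:E = (expR (- (x * v r lambda)))%:E)%E.
Proof.
move=> x0 r0 l0.
have mT : path_filtration 0 (setT : set (D R)).
  by rewrite -setC0; apply: sigma_algebraC; exact: sigma_algebra0.
have := path_laplace_indic x0 (lexx 0) r0 l0 mT; rewrite add0r => ->.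
rewrite (ae_eq_integral (fun=> (expR (- (x * v r lambda)))%:E))//.
- by rewrite integral_cst// prob_kernel mule1.
have [_ Qx] := hQ x0.
have m0 : measurable [set w : D R | w 0 = x].
  rewrite (_ : [set w : D R | _] = (fun w : D R => w 0) @^-1` [set x])//.
  by rewrite -[X in measurable X]setTI; exact: (measurable_coordinate 0).
exists (~` [set w : D R | w 0 = x]); split.
- exact: measurableC.
- by apply: full_setC_null => //; exact: prob_kernel.
- by move=> w /= + w0; apply => _; rewrite w0 mulrC.
Qed.

End paths.
End CB_facts.

Lemma integral_compl d (T : measurableType d) (R : realType)
    (nu : {measure set T -> \bar R}) (a : T -> R) : nu setT = 1%E ->
  measurable_fun setT a -> (forall x, 0 <= a x <= 1) ->
  (\int[nu]_x (1 - a x)%:E = 1 - \int[nu]_x (a x)%:E)%E.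
Proof.
move=> nu1 ma a01; have nuoo : (nu setT < +oo)%E by rewrite nu1 ltry.
under eq_integral do rewrite EFinB.
rewrite integralB//.
- by rewrite integral_cst// nu1 mule1.
- exact: integrable_cst_fin.
- apply: (@bounded_integrable _ _ _ _ _ 1) => // x.
  by have /andP[a0 a1] := a01 x; rewrite ger0_norm.
Qed.

(** * The intensity integral at times t and t + r *)

Section shift.
Context {R : realType} (b c : R).
Variable m : {sigma_finite_measure set (measurableTypeR R) -> \bar R}.
Hypothesis hc : 0 <= c.
Hypothesis hm : (\int[m]_(u in `]0%R, +oo[) (Num.min u (u ^+ 2))%:E < +oo)%E.
Variable delta : R.
Local Notation phi := (branching_mechanism b c m).
Hypothesis hdelta : derive_at_infty phi = delta%:E.
Variables (v : R -> R -> R) (K : R -> R.-pker (measurableTypeR R) ~> (measurableTypeR R)).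
Hypotheses (hv : is_cumulant phi v) (hK : CB_semigroup v K).
Variable Q : R.-pker (measurableTypeR R) ~> (D R).
Hypothesis hQ : forall x, 0 <= x ->
  markov_process (Q x) (@path_filtration R) K (fun t w => w t) /\
  Q x [set w : D R | w 0 = x] = 1%E.
Variable beta : {posnum R}.
Notation leb := (@lebesgue_measure R).
Local Notation times := (immigration_times beta delta).
Local Notation mu := (immigration_intensity beta delta m Q).

(* The mass at time [t] of the family that immigrated at time [z.1]. *)
Definition alive (t : R) (z : measurableTypeR R * D R) : R :=
  if (0 < z.1) && (z.1 <= t) then z.2 (t - z.1) else 0.

Lemma alive_ge0 t z : 0 <= alive t z.
Proof.
rewrite /alive; case: ifP => // /andP[_ zt].
by apply: path_ge0; rewrite subr_ge0.
Qed.

Lemma measurable_alive t : measurable_fun setT (alive t : _ -> measurableTypeR R).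
Proof.
apply: measurable_fun_ifT => //.
  apply: measurable_and; first by apply: measurable_fun_ltr => //; exact: measurable_fst.
  by apply: measurable_fun_ler => //; exact: measurable_fst.
apply: (@measurableT_comp _ _ _ _ _ _ (fun z : measurableTypeR R * D R => z.2 z.1) _
  (fun z : measurableTypeR R * D R => (t - z.1, z.2))); first exact: measurable_evaluation.
apply/measurable_fun_pairP; split; last exact: measurable_snd.
by apply: measurable_funB => //; exact: measurable_fst.
Qed.

(* Functions whose integral against the Poisson measure is known at time [t]:
   the path of an atom immigrated at time [s] is seen up to its age [t - s]. *)
Record adapted (t : R) (f : measurableTypeR R * D R -> R) : Prop := Adapted {
  adapted_measurable : measurable_fun setT f ;
  adapted_ge0 : forall z, 0 <= f z ;
  adapted_supp : forall s w, ~~ ((0 < s) && (s <= t)) -> f (s, w) = 0 ;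
  adapted_filtration : forall s, 0 < s -> s <= t ->
    forall B : set (measurableTypeR R), measurable B ->
    path_filtration (t - s) [set w | B (f (s, w))] }.

Section shift_one.
Variables (t r lambda : R) (f : measurableTypeR R * D R -> R).
Hypotheses (t0 : 0 <= t) (r0 : 0 <= r) (l0 : 0 <= lambda) (hf : adapted t f).

Let vr0 : 0 <= v r lambda. Proof. by case: (hv r0 l0). Qed.

Let g1 z := f z + lambda * alive (t + r) z.
Let g2 z := f z + v r lambda * alive t z.

Let g1_ge0 z : 0 <= g1 z.
Proof. by rewrite addr_ge0 ?(adapted_ge0 hf)// mulr_ge0// alive_ge0. Qed.

Let g2_ge0 z : 0 <= g2 z.
Proof. by rewrite addr_ge0 ?(adapted_ge0 hf)// mulr_ge0// alive_ge0. Qed.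

Let mg1 : measurable_fun setT g1.
Proof.
apply: measurable_funD; first exact: (adapted_measurable hf).
by apply: measurable_funM => //; exact: measurable_alive.
Qed.

Let mg2 : measurable_fun setT g2.
Proof.
apply: measurable_funD; first exact: (adapted_measurable hf).
by apply: measurable_funM => //; exact: measurable_alive.
Qed.

Let mexpR (g : measurableTypeR R * D R -> R) : measurable_fun setT g ->
  measurable_fun setT (fun z => expR (- g z)).
Proof. by move=> mg; apply: measurableT_comp => //; exact: measurableT_comp. Qed.

Let h (g : measurableTypeR R * D R -> R) z : \bar R := (1 - expR (- g z))%:E.

Let mh g : measurable_fun setT g -> measurable_fun setT (h g).
Proof.
by move=> mg; apply/measurable_EFinP; apply: measurable_funB => //; exact: mexpR.
Qed.

Let h_ge0 (g : measurableTypeR R * D R -> R) z : (forall z, 0 <= g z) -> (0 <= h g z)%E.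
Proof. by move=> g0; rewrite lee_fin subr_ge0 expR_le1 oppr_le0. Qed.

(** The expectation under [Q x] of [1 - exp (- lambda * w (t + r - s))] for a family that immigrates
    at [s] after time [t]. The maximum with 0 keeps the time argument of [v] in its domain; the
    indicator makes it harmless. *)
Let kappa (s x : R) : R :=
  (\1_(`]t, (t + r)%R]%classic : set R) s) * (1 - expR (- (x * v (Num.max (t + r - s) 0)
    lambda))).

(** For [0 < s <= t] the Markov property at age [t - s] equates the two integrals; for
    [t < s <= t + r] the function [g2] vanishes and the path is seen from its starting point; for
    all other [s] both functions vanish. *)
Let section_eq x s : 0 < x ->
  (\int[Q x]_w h g1 (s, w) = \int[Q x]_w h g2 (s, w) + (kappa s x)%:E)%E.
Proof.
move=> x0; have x0' := ltW x0.
have Q1 : Q x setT = 1%E by exact: prob_kernel.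
have ms (g : measurableTypeR R * D R -> R) : measurable_fun setT g ->
    measurable_fun setT (fun w : D R => expR (- g (s, w))).
  by move=> mg; apply: (measurableT_comp (mexpR mg)); exact: measurable_pair1.
have b01 (g : measurableTypeR R * D R -> R) w : (forall z, 0 <= g z) -> 0 <= expR (- g (s, w))
  <= 1.
  by move=> g0; rewrite expR_ge0 expR_le1 oppr_le0 g0.
rewrite /h (integral_compl Q1 (ms _ mg1)); last by move=> w; exact: b01.
rewrite (integral_compl Q1 (ms _ mg2)); last by move=> w; exact: b01.
have kappa0 : (s <= t) || (t + r < s) -> kappa s x = 0.
  move=> h0; rewrite /kappa indicE memNset ?mul0r//= in_itv/= => /andP[ts sr].
  by move: h0; rewrite !leNgt ts /= ltNge sr.
have alive0 u w : ~~ ((0 < s) && (s <= u)) -> alive u (s, w) = 0.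
  by rewrite /alive /= => /negbTE ->.
have [/andP[s0 st]|st] := boolP ((0 < s) && (s <= t)).
  rewrite kappa0 ?st// adde0; congr (_ - _)%E.
  have str : s <= t + r by rewrite (le_trans st)// lerDl.
  have ts0 : 0 <= t - s by rewrite subr_ge0.
  have mgq (B : set (measurableTypeR R)) : measurable B ->
      path_filtration (t - s) ((fun w : D R => expR (- f (s, w))) @^-1` B).
    move=> mB; have := adapted_filtration hf s0 st
      (B := (fun y : measurableTypeR R => expR (- y)) @^-1` B); apply.
    rewrite -[X in measurable X]setTI; apply: measurableT_comp => //.
  have := path_laplace hK hQ x0' ts0 r0 l0 (fun w => expR_ge0 (- f (s, w))) mgq.
  rewrite (_ : t - s + r = t + r - s); last by ring.
  move=> e; transitivity (\int[Q x]_w (expR (- f (s, w)) * expR (- (lambda * w (t + r -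
    s)%R)))%:E)%E.
    by apply: eq_integral => w _; rewrite -expRD /g1 /alive /= s0 str opprD.
  rewrite e; apply: eq_integral => w _.
  by rewrite -expRD /g2 /alive /= s0 st opprD.
have f0 w : f (s, w) = 0 by exact: adapted_supp hf _ _ st.
have g20 w : g2 (s, w) = 0 by rewrite /g2 f0 alive0// mulr0 addr0.
under [X in _ = (_ - X + _)%E]eq_integral do rewrite g20 oppr0 expR0.
rewrite integral_cst// mul1e Q1 subee// add0e.
have [/andP[ts str]|tsr] := boolP ((t < s) && (s <= t + r)).
  have s0 : 0 < s by exact: le_lt_trans ts.
  have q0 : 0 <= t + r - s by rewrite subr_ge0.
  rewrite /kappa indicE mem_set ?mul1r/=; last by rewrite /= in_itv/= ts str.
  rewrite max_l// EFinB -(path_laplace0 hK hQ x0' q0 l0); congr (_ - _)%E.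
  by apply: eq_integral => w _; rewrite /g1 f0 add0r /alive /= s0 str.
rewrite kappa0; last by move: tsr; rewrite negb_and -!leNgt -ltNge.
rewrite (_ : (\int[Q x]_w _)%E = (\int[Q x]_w 1)%E).
  by rewrite integral_cst// mul1e Q1 subee.
apply: eq_integral => w _; rewrite /g1 f0 alive0 ?mulr0 ?addr0 ?oppr0 ?expR0//.
move: tsr st; rewrite !negb_and -!leNgt -!ltNge => /orP[h1|->]; last by rewrite orbT.
by case/orP => [->//|]; rewrite ltNge h1.
Qed.

Let vv (s : R) : R := v (Num.max (t + r - s) 0) lambda.

Let vv_ge0 s : 0 <= vv s.
Proof. by have := hv (t := Num.max (t + r - s) 0) _ l0; case=> //; rewrite le_max lexx orbT. Qed.

Let mvv : measurable_fun setT vv.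
Proof.
apply: (@measurableT_comp _ _ _ _ _ _ (fun q : R => v (Num.max q 0) lambda) _ (fun s : R =>
  t + r - s)).
  exact: (measurable_cumulant_pos hv l0).
exact: measurable_funB.
Qed.

Let kappa_ge0 s x : 0 < x -> 0 <= kappa s x.
Proof.
by move=> x0; rewrite mulr_ge0// subr_ge0 expR_le1 oppr_le0 mulr_ge0 ?(ltW x0)// vv_ge0.
Qed.

Let mkappa : measurable_fun setT (fun z : measurableTypeR R * measurableTypeR R => kappa z.1 z.2).
Proof.
apply: measurable_funM.
  have mI : measurable (`]t, (t + r)%R]%classic : set (measurableTypeR R)) by exact:
    measurable_itv.
  exact: (measurableT_comp (measurable_indic mI) measurable_fst).
apply: measurable_funB => //; apply: measurableT_comp => //; apply: measurableT_comp => //.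
apply: (@measurable_funM _ _ _ setT (fun z : measurableTypeR R * measurableTypeR R => z.2 : R)
  (fun z => vv z.1)); first exact: measurable_snd.
exact: (measurableT_comp mvv measurable_fst).
Qed.

(** [kappa] is nonnegative for [x > 0]; cutting it off elsewhere allows Tonelli on the whole
    product. *)
Let Kp (z : measurableTypeR R * measurableTypeR R) : \bar R :=
  (\1_(`]0, +oo[%classic : set R) z.2 * kappa z.1 z.2)%:E.

Let mKp : measurable_fun setT Kp.
Proof.
apply/measurable_EFinP; apply: measurable_funM; last exact: mkappa.
have mI : measurable (`]0%R, +oo[%classic : set (measurableTypeR R)) by exact: measurable_itv.
exact: (measurableT_comp (measurable_indic mI) measurable_snd).
Qed.

Let Kp_ge0 z : (0 <= Kp z)%E.
Proof.
rewrite lee_fin /Kp indicE; case: (boolP (_ \in _)) => [/set_mem/=|_]; last by rewrite mul0r.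
by rewrite in_itv/= andbT mul1r => x0; exact: kappa_ge0.
Qed.

Let KpE s x : 0 < x -> Kp (s, x) = (kappa s x)%:E.
Proof. by move=> x0; rewrite /Kp indicE mem_set ?mul1r//= in_itv/= x0. Qed.

Let int_kappa_m s : (\int[m]_x Kp (s, x) =
   (\1_(`]t, (t + r)%R]%classic : set R) s * (delta * vv s - phi (vv s)))%:E)%E.
Proof.
have vs := vv_ge0 s.
transitivity (\int[m]_(x in `]0%R, +oo[) ((\1_(`]t, (t + r)%R]%classic : set R) s)%:E * (1 -
  expR (- (x * vv s)))%:E))%E.
  rewrite [RHS]integral_mkcond; apply: eq_integral => x _; rewrite /Kp /= patchE indicE.
  by case: (_ \in _); rewrite ?mul1r ?mul0r// -EFinM.
rewrite ge0_integralZl_EFin//.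
- by rewrite (phiE hc hm hdelta vs).
- move=> x /=; rewrite in_itv/= andbT => x0.
  by rewrite lee_fin subr_ge0 expR_le1 oppr_le0 mulr_ge0// ltW.
- apply/measurable_EFinP; apply: measurable_funTS; apply: measurable_funB => //.
  by apply: measurableT_comp => //; apply: measurableT_comp => //; exact: measurable_funM.
Qed.

(** Integrating over the starting point first turns [kappa] into [delta * vv s - phi (vv s)] by
    [phiE]; the density of [times] then produces the integral of [cumulant_clock_integral]. *)
Let int_kappa : (\int[m]_(x in `]0%R, +oo[) \int[times]_s (kappa s x)%:E =
     (beta%:num * (v r lambda * clock delta t + \int[leb]_(s in `[0%R, r]) v s lambda
      - lambda * clock delta (t + r)))%R%:E)%E.
Proof.
transitivity (\int[m]_x \int[times]_s Kp (s, x))%E.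
  rewrite integral_mkcond; apply: eq_integral => x _; rewrite patchE.
  case: ifPn => [/set_mem/=|x0].
    by rewrite in_itv/= andbT => x0; apply: eq_integral => s _; rewrite KpE.
  rewrite integral0_eq// => s _; rewrite /Kp indicE /=.
  by rewrite (negbTE x0) mul0r.
transitivity (\int[times]_s \int[m]_x Kp (s, x))%E.
  exact/esym/(@fubini_tonelli _ _ _ _ _ times m Kp mKp Kp_ge0).
pose G (s : R) := clock delta s * (delta * vv s - phi (vv s)).
have G0 s : 0 <= s -> 0 <= G s.
  move=> s0; rewrite mulr_ge0 ?clock_ge0// -lee_fin -(phiE hc hm hdelta (vv_ge0 s)).
  apply: integral_ge0 => x /=; rewrite in_itv/= andbT => x0.
  by rewrite lee_fin subr_ge0 expR_le1 oppr_le0 mulr_ge0 ?vv_ge0// ltW.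
have mG : measurable_fun setT G.
  apply: measurable_funM; first exact: measurable_clock.
  apply: measurable_funB; first by apply: measurable_funM => //; exact: mvv.
  apply: (@measurableT_comp _ _ _ _ _ _ (fun q : R =>
    phi (v (Num.max q 0) lambda)) _ (fun s : R => t + r - s)).
    exact: (measurable_phi_cumulant (phi_lipschitz hc hm hdelta) hv l0).
  exact: measurable_funB.
rewrite integral_times; last 2 first.
- exact: (@measurable_fun_fubini_tonelli_F _ _ _ _ _ m Kp mKp Kp_ge0).
- by move=> s; apply: integral_ge0 => x _; exact: Kp_ge0.
transitivity (\int[leb]_(s in `]t, (t + r)%R]) (beta%:num%:E * (G s)%:E))%E.
  rewrite integral_mkcond [RHS]integral_mkcond; apply: eq_integral => s _; rewrite !patchE.
  have [str|str] := boolP (s \in `]t, (t + r)%R]%classic).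
    have s0 : 0 < s by move: str => /set_mem/=; rewrite in_itv/= => /andP[ts _];
      exact: le_lt_trans ts.
    rewrite mem_set/= ?in_itv/= ?s0// int_kappa_m indicE str mul1r -!EFinM /G.
    by congr (_%:E); ring.
  case: ifP => // _; rewrite int_kappa_m indicE (negbTE str).
  by rewrite mul0r mule0.
rewrite integral_itv_obnd_cbnd; last first.
  by apply: measurable_funTS; apply: measurable_funeM; exact/measurable_EFinP.
rewrite ge0_integralZl_EFin//; last 2 first.
- move=> s /=; rewrite in_itv/= => /andP[ts _]; rewrite lee_fin G0//.
  exact: le_trans ts.
- by apply: measurable_funTS; exact/measurable_EFinP.
rewrite [RHS]EFinM; congr (_ * _)%E.
rewrite -(cumulant_clock_integral delta (phi_lipschitz hc hm hdelta) hv l0 t0 r0).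
apply: eq_integral => s /set_mem/=; rewrite in_itv/= => /andP[_ sr].
by rewrite /G /vv max_l// subr_ge0.
Qed.

(* Atoms with [s <= t] contribute the same to both integrals by the Markov
   property of the path at age [t - s]; the remainder comes from those with
   [t < s <= t + r]. *)
Lemma intensity_shift :
  (\int[mu]_z h g1 z = \int[mu]_z h g2 z +
     (beta%:num * (v r lambda * clock delta t + \int[leb]_(s in `[0%R, r]) v s lambda
      - lambda * clock delta (t + r)))%R%:E)%E.
Proof.
have h10 z : (0 <= h g1 z)%E by exact: h_ge0.
have h20 z : (0 <= h g2 z)%E by exact: h_ge0.
have mh1 := mh mg1; have mh2 := mh mg2.
rewrite (integral_intensity_swap _ _ _ _ mh1 h10) (integral_intensity_swap _ _ _ _ mh2 h20)
  -int_kappa.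
have Qoo x : (Q x setT < +oo)%E by rewrite prob_kernel ltry.
have mk x : measurable_fun setT (fun s : measurableTypeR R => (kappa s x)%:E).
  by apply/measurable_EFinP; exact: (measurableT_comp mkappa (measurable_pair2 x)).
transitivity (\int[m]_(x in `]0%R, +oo[) (\int[times]_s \int[Q x]_w h g2 (s, w) + \int[times]_s
  (kappa s x)%:E))%E.
  apply: eq_integral => x /set_mem/=; rewrite in_itv/= andbT => x0.
  under eq_integral do rewrite section_eq//.
  rewrite ge0_integralD//.
  - by move=> s _; exact: integral_ge0.
  - exact: measurable_section_integral (Qoo x) _ mh2 h20.
  - by move=> s _; rewrite lee_fin kappa_ge0.
rewrite ge0_integralD//.
- by move=> x _; apply: integral_ge0 => s _; exact: integral_ge0.
- apply: measurable_funTS.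
  rewrite (_ : (fun x => _) = (fun x => \int[Q x]_w \int[times]_s h g2 (s, w)))%E.
    apply: measurable_fun_integral_kernel => //.
    + by move=> A mA; exact: measurable_kernel.
    + by move=> w; exact: integral_ge0.
    + exact: measurable_times_integral.
  by apply/funext => x; rewrite ge0_tonelli_finite.
- by move=> x /=; rewrite in_itv/= andbT => x0; apply: integral_ge0 => s _;
    rewrite lee_fin kappa_ge0.
- apply: (eq_measurable_fun (fun x => \int[times]_s Kp (s, x))%E).
    move=> x /set_mem/=; rewrite in_itv/= andbT => x0.
    by apply: eq_integral => s _; rewrite KpE.
  apply: measurable_funTS.
  exact: (@measurable_fun_fubini_tonelli_G _ _ _ _ _ times Kp mKp Kp_ge0).
Qed.

End shift_one.
End shift.

(** * Laplace transforms at integers, and convolution *)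

Section laplace_unique.
Context {R : realType}.
Local Notation nonneg := (`[0%R, +oo[%classic : set (measurableTypeR R)).

(** On the half-line, [expR (- (k%:R * y))] is the [k]-th power of [X y = expR (- y)], which lies in
    [[0, 1]] and has the measurable inverse [- ln]. *)
Lemma laplace_unique (nu1 nu2 : {measure set (measurableTypeR R) -> \bar R}) :
  (nu1 nonneg < +oo)%E -> (nu2 nonneg < +oo)%E ->
  (forall k : nat, \int[nu1]_(y in nonneg) (expR (- (k%:R * y)))%:E =
                   \int[nu2]_(y in nonneg) (expR (- (k%:R * y)))%:E)%E ->
  forall B, measurable B -> nu1 (B `&` nonneg) = nu2 (B `&` nonneg).
Proof.
move=> oo1 oo2 L B mB.
have mN : measurable nonneg by exact: measurable_itv.
pose X (y : measurableTypeR R) : R := expR (- Num.max y 0).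
have mX : measurable_fun setT (X : _ -> measurableTypeR R).
  by apply: measurableT_comp => //; apply: measurableT_comp => //; exact: measurable_maxr.
have X01 y : 0 <= X y <= 1 by rewrite expR_ge0 expR_le1 oppr_le0 le_max lexx orbT.
pose m1 := mrestr nu1 mN; pose m2 := mrestr nu2 mN.
have mE (nu : {measure set (measurableTypeR R) -> \bar R}) k :
    (\int[mrestr nu mN]_y (X y ^+ k)%:E = \int[nu]_(y in nonneg) (expR (- (k%:R * y)))%:E)%E.
  pose k0 (y : measurableTypeR R) : {measure set (measurableTypeR R) -> \bar R} := \d_y.
  have mk0 A : measurable A -> measurable_fun setT (k0 ^~ A).
    by move=> mA; apply/measurable_EFinP; exact: measurable_indic.
  have nuE A : measurable A -> mrestr nu mN A = mixture nu mN mk0 A.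
    by move=> mA; exact/esym/integral_indic.
  rewrite (integral_mixture nuE)//; last 2 first.
  - by apply/measurable_EFinP; exact: measurable_funX.
  - by move=> y; rewrite lee_fin exprn_ge0// expR_ge0.
  apply: eq_integral => y /set_mem/=; rewrite in_itv/= andbT => y0.
  rewrite integral_dirac//; last by apply/measurable_EFinP; exact: measurable_funX.
  by rewrite diracT mul1e /X max_l// -mulrN expRM_natl.
have m1oo : (m1 setT < +oo)%E by rewrite /m1 /mrestr setTI.
have m2oo : (m2 setT < +oo)%E by rewrite /m2 /mrestr setTI.
have mom k : (\int[m1]_y (X y ^+ k)%:E = \int[m2]_y (X y ^+ k)%:E)%E.
  by rewrite !mE.
pose B' : set (measurableTypeR R) := (fun y : R => - ln y) @^-1` B.
have mB' : measurable B'.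
  rewrite -[X in measurable X]setTI.
  by apply: (measurableT_comp (@oppr_measurable _ setT) (@measurable_ln _)).
have <- : X @^-1` B' `&` nonneg = B `&` nonneg.
  by apply/seteqP; split => y /= [+ y0]; move: (y0); rewrite in_itv/= andbT => y0' h; split => //;
    move: h; rewrite /B' /X /= max_l// expRK opprK.
exact: (moments_unique m1oo m2oo mX X01 mom mB').
Qed.

End laplace_unique.

Section convolution.
Context {R : realType} d (Omega : measurableType d) (P : probability Omega R).
Variable (kappa : R.-pker (measurableTypeR R) ~> (measurableTypeR R)).
Variable (Z : Omega -> measurableTypeR R) (mZ : measurable_fun setT Z).

Let shifted (y : measurableTypeR R) (w : Omega) : {measure set (measurableTypeR R) -> \bar R} :=
  \d_(Z w + y : measurableTypeR R).

Let mshifted y A : measurable A -> measurable_fun setT (shifted y ^~ A).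
Proof.
move=> mA; apply/measurable_EFinP; apply: (measurableT_comp (measurable_indic mA)).
exact: measurable_funD.
Qed.

Let law (y : measurableTypeR R) : {measure set (measurableTypeR R) -> \bar R} :=
  mixture P measurableT (mshifted y).

Lemma measurable_convolution_integrand (f : measurableTypeR R -> \bar R) :
  measurable_fun setT f -> (forall y, (0 <= f y)%E) ->
  measurable_fun setT (fun y : measurableTypeR R => \int[P]_w f (Z w + y)%R)%E.
Proof.
move=> mf f0.
apply: (@measurable_section_integral _ _ _ _ _ P _
  (fun z : measurableTypeR R * Omega => f (Z z.2 + z.1)%R)) => //.
- by apply: (@le_lt_trans _ _ 1%E); [exact: probability_le1|exact: ltry].
- apply: (measurableT_comp mf); apply: measurable_funD; last exact: measurable_fst.
  exact: (measurableT_comp mZ measurable_snd).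
Qed.

Let mlaw A : measurable A -> measurable_fun setT (law ^~ A).
Proof.
move=> mA; apply: (measurable_convolution_integrand (f := fun y => (\1_A y)%:E)).
- by apply/measurable_EFinP; exact: measurable_indic.
- by move=> y; rewrite lee_fin.
Qed.

Definition convolution := fun x : measurableTypeR R =>
  (mixture (kappa x) measurableT mlaw : {measure set (measurableTypeR R) -> \bar R}).

Let mconv A : measurable A -> measurable_fun setT (convolution ^~ A).
Proof.
move=> mA; apply: (@measurable_fun_integral_kernel _ _ _ _ _ kappa _ (law ^~ A)) => //.
- by move=> B mB; exact: measurable_kernel.
- exact: mlaw.
Qed.

HB.instance Definition _ := isKernel.Build _ _ _ _ _ convolution mconv.

Let conv_prob x : convolution x setT = 1%E.
Proof.
rewrite /convolution /= /mixture.
transitivity (\int[kappa x]_y 1)%E; last by rewrite integral_cst// mul1e prob_kernel.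
apply: eq_integral => y _; rewrite /law /= /mixture.
transitivity (\int[P]_w 1)%E; last by rewrite integral_cst// mul1e; exact: probability_setT.
by apply: eq_integral => w _; exact: diracT.
Qed.

HB.instance Definition _ := Kernel_isProbability.Build _ _ _ _ _ convolution conv_prob.

(* The law of [Z + X] with [X] independent of [Z] and of law [kappa x]. *)
Definition convolution_kernel : R.-pker (measurableTypeR R) ~> (measurableTypeR R) :=
  convolution.

Lemma integral_convolution x f : measurable_fun setT f -> (forall y, (0 <= f y)%E) ->
  (\int[convolution_kernel x]_y f y = \int[kappa x]_y \int[P]_w f (Z w + y)%R)%E.
Proof.
move=> mf f0.
rewrite (@integral_mixture _ _ _ _ _ (kappa x) setT measurableT law mlaw)//.
apply: eq_integral => y _.
rewrite (@integral_mixture _ _ _ _ _ P setT measurableT (shifted y) (mshifted y))//.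
by apply: eq_integral => w _; rewrite integral_dirac// diracT mul1e.
Qed.

End convolution.

(** * Conditional law of the immigration process *)

Lemma enexpDr (R : realType) (x : \bar R) (r : R) : (0 <= x)%E ->
  enexp (x + r%:E)%E = enexp x * expR (- r).
Proof. by case: x => [s||] //= _; rewrite ?mul0r// opprD expRD. Qed.

Section immigration.
Context {R : realType} (b c : R).
Variable m : {sigma_finite_measure set (measurableTypeR R) -> \bar R}.
Hypothesis hc : 0 <= c.
Hypothesis hm : (\int[m]_(u in `]0%R, +oo[) (Num.min u (u ^+ 2))%:E < +oo)%E.
Variable delta : R.
Local Notation phi := (branching_mechanism b c m).
Hypothesis hdelta : derive_at_infty phi = delta%:E.
Variables (v : R -> R -> R) (K : R -> R.-pker (measurableTypeR R) ~> (measurableTypeR R)).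
Hypotheses (hv : is_cumulant phi v) (hK : CB_semigroup v K).
Variable Q : R.-pker (measurableTypeR R) ~> (D R).
Hypothesis hQ : forall x, 0 <= x ->
  markov_process (Q x) (@path_filtration R) K (fun t w => w t) /\
  Q x [set w : D R | w 0 = x] = 1%E.
Variables (beta : {posnum R}) (d : measure_display) (Omega : measurableType d)
  (P : probability Omega R)
  (N : Omega -> {measure set (measurableTypeR R * D R) -> \bar R}).
Hypothesis hN : poisson_random_measure P (immigration_intensity beta delta m Q) N.
Notation leb := (@lebesgue_measure R).
Local Notation mu := (immigration_intensity beta delta m Q).
Local Notation sum := (immigration_sum beta%:num delta N).

Definition immigration_exponent (r lambda : R) : R :=
  \int[leb]_(s in `[0%R, r]) (beta%:num * v s lambda).
Local Notation kappa := immigration_exponent.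

Lemma immigration_sumE t w :
  sum t w = ((beta%:num * clock delta t)%:E + \int[N w]_z (alive t z)%:E)%E.
Proof.
rewrite /immigration_sum; congr (_ + _)%E.
rewrite integral_mkcond; apply: eq_integral => -[s p] _.
rewrite patchE /alive /=; case: ifPn => [/set_mem|/negP h].
  by move=> [/= + _]; rewrite in_itv/= => ->.
by rewrite ifF//; apply/negbTE/negP => sp; apply: h; apply/mem_set; split => //=.
Qed.

Lemma immigration_sum_ge0 t w : 0 <= t -> (0 <= sum t w)%E.
Proof.
move=> t0; rewrite immigration_sumE adde_ge0//.
  by rewrite lee_fin mulr_ge0// clock_ge0.
by apply: integral_ge0 => z _; rewrite lee_fin alive_ge0.
Qed.

Lemma immigration_sum0 w : sum 0 w = 0%E.
Proof.
rewrite immigration_sumE (_ : clock delta 0 = 0) ?mulr0 ?add0e; last first.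
  by rewrite /clock mulr0 oppr0 expR0 subrr mulr0; case: ifP.
rewrite integral0_eq// => -[s p] _; rewrite /alive /=.
by case: ifP => // /andP[s0]; rewrite leNgt s0.
Qed.

Let malive t : measurable_fun setT (fun z => (alive t z)%:E : \bar R).
Proof. by apply/measurable_EFinP; exact: measurable_alive. Qed.

Lemma measurable_immigration_sum t : measurable_fun setT (sum t).
Proof.
rewrite (_ : sum t = fun w => ((beta%:num * clock delta t)%:E + \int[N w]_z (alive t z)%:E)%E).
  apply: emeasurable_funD => //; apply: (poisson_integral_measurable hN) => //.
  by move=> z; rewrite lee_fin alive_ge0.
by apply/funext => w; rewrite immigration_sumE.
Qed.

Let Y t w : R := fine (sum t w).

Let enexp_split t lambda (f : measurableTypeR R * D R -> R) w : 0 <= t -> 0 <= lambda ->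
  measurable_fun setT f -> (forall z, 0 <= f z) ->
  enexp (\int[N w]_z (f z)%:E) * enexp (lambda%:E * sum t w) =
  expR (- (lambda * (beta%:num * clock delta t))) *
    enexp (\int[N w]_z (f z + lambda * alive t z)%:E).
Proof.
move=> t0 l0 mf f0.
have a0 z : (0 <= (alive t z)%:E)%E by rewrite lee_fin alive_ge0.
have la0 z : (0 <= lambda%:E * (alive t z)%:E)%E by apply: mule_ge0; rewrite ?lee_fin ?alive_ge0.
rewrite (_ : (\int[N w]_z (f z + lambda * alive t z)%:E =
    \int[N w]_z (f z)%:E + lambda%:E * \int[N w]_z (alive t z)%:E)%E); last first.
  under eq_integral do rewrite EFinD EFinM.
  rewrite ge0_integralD//; last 3 first.
  - by move=> z _; rewrite lee_fin.
  - exact/measurable_EFinP.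
  - exact: measurable_funeM.
  by congr (_ + _)%E; rewrite ge0_integralZl_EFin//.
have Ia : (0 <= \int[N w]_z (alive t z)%:E)%E by exact: integral_ge0.
rewrite immigration_sumE ge0_muleDr//; last by rewrite lee_fin mulr_ge0// clock_ge0.
set I := (\int[N w]_z (alive t z)%:E)%E in Ia *.
have lI : (0 <= lambda%:E * I)%E by apply: mule_ge0; rewrite ?lee_fin.
have If : (0 <= \int[N w]_z (f z)%:E)%E by apply: integral_ge0 => z _; rewrite lee_fin.
rewrite -EFinM (addeC (lambda * _)%:E) enexpDr//.
by rewrite [in RHS]enexpD//; ring.
Qed.

Let kappaE r lambda : 0 <= r -> 0 <= lambda ->
  kappa r lambda = beta%:num * \int[leb]_(s in `[0, r]) v s lambda.
Proof.
move=> r0 l0; rewrite /kappa RintegralZl//.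
exact: (cumulant_integrable hv l0 r0).
Qed.

Let mean_sum t r lambda f : 0 <= t -> 0 <= r -> 0 <= lambda -> adapted t f ->
  (\int[P]_w (enexp (\int[N w]_z (f z)%:E) * enexp (lambda%:E * sum (t + r)%R w))%:E =
   (expR (- kappa r lambda))%:E *
   \int[P]_w (enexp (\int[N w]_z (f z)%:E) * enexp ((v r lambda)%:E * sum t w))%:E)%E.
Proof.
move=> t0 r0 l0 hf.
have mf := adapted_measurable hf; have f0 := adapted_ge0 hf.
have vr0 : 0 <= v r lambda by case: (hv r0 l0).
have G u l : 0 <= u -> 0 <= l ->
    (\int[P]_w (enexp (\int[N w]_z (f z)%:E) * enexp (l%:E * sum u w))%:E =
     (expR (- (l * (beta%:num * clock delta u))) *
       enexp (\int[mu]_z (1 - expR (- (f z + l * alive u z)))%:E)%E)%:E)%E.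
  move=> u0 l0'; have g0 z : 0 <= f z + l * alive u z by rewrite addr_ge0// mulr_ge0// alive_ge0.
  have mg : measurable_fun setT (fun z => f z + l * alive u z).
    by apply: measurable_funD => //; apply: measurable_funM => //; exact: measurable_alive.
  under eq_integral do rewrite enexp_split// EFinM.
  rewrite ge0_integralZl_EFin ?expR_ge0//.
  - by rewrite (poisson_laplace hN mg g0) -EFinM.
  - by move=> w _; rewrite lee_fin enexp_ge0.
  - apply/measurable_EFinP; apply: measurableT_comp; first exact: measurable_enexp.
    apply: (poisson_integral_measurable hN); first exact/measurable_EFinP.
    by move=> z; rewrite lee_fin.
rewrite (G _ _ (addr_ge0 t0 r0) l0) (G _ _ t0 vr0) (intensity_shift hc hm hdelta hv hK hQ beta
  t0 r0 l0 hf).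
rewrite enexpDr; last first.
  apply: integral_ge0 => z _; rewrite lee_fin subr_ge0 expR_le1 oppr_le0.
  by rewrite addr_ge0// mulr_ge0// alive_ge0.
rewrite -EFinM; congr (_%:E).
set A := enexp _; rewrite kappaE//.
set I := \int[leb]_(s in `[0, r]) v s lambda.
(* The deterministic part of [Y] at time [t + r] cancels the last term of [intensity_shift]; there
   remain the exponent [kappa] and the deterministic part at time [t] with [v r lambda] for
   [lambda]. *)
transitivity (A * (expR (- (lambda * (beta%:num * clock delta (t + r)))) *
  expR (- (beta%:num * (v r lambda * clock delta t + I - lambda * clock delta (t + r)))))).
  by ring.
rewrite -expRD.
transitivity (A * (expR (- (beta%:num * I)) * expR (- (v r lambda * (beta%:num * clock delta
  t))))).
  by rewrite -expRD; congr (_ * expR _); ring.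
by ring.
Qed.

(** Dominated convergence: by monotonicity in [lambda], [v s 1] is an integrable majorant. *)
Lemma cvg_exponent0 r : 0 <= r -> kappa r (harmonic n) @[n --> \oo] --> (0 : R).
Proof.
move=> r0.
have h0 n : 0 <= harmonic n :> R by rewrite /= invr_ge0.
have h1 n : harmonic n <= 1 :> R by rewrite /= invf_le1// ler1n.
have [] := @dominated_convergence _ _ _ leb `[0, r]%classic (measurable_itv _)
  (fun n s => (v s (harmonic n))%:E) (fun=> 0%E) (fun s => (v s 1)%:E).
- by move=> n; have /measurable_int := cumulant_integrable hv (h0 n) r0.
- exact: measurable_cst.
- apply/aeW => s /=; rewrite in_itv/= => /andP[s0 _].
  by apply: cvg_EFin; [exact: nearW|exact: (cvg_cumulant0 hK s0)].
- exact: (cumulant_integrable hv ler01 r0).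
- apply/aeW => s n /=; rewrite in_itv/= => /andP[s0 _]; rewrite lee_fin ger0_norm; last first.
    by case: (hv s0 (h0 n)).
  by apply: (cumulant_mono hK s0 _ _ (h1 n)); rewrite in_itv/= ?ler01 ?andbT//; exact: h0.
move=> _ _; rewrite integral0 => /fine_cvgP[_ lim].
rewrite [X in X @ _ --> _](_ : _ = fun n =>
  beta%:num * fine (\int[leb]_(s in `[0%R, r]) (v s (harmonic n))%:E)).
  by have := cvgMl_tmp (a := beta%:num) lim; rewrite mulr0; exact.
by apply/funext => n; rewrite kappaE//; exact: h0.
Qed.

Let mean_sum0 r lambda : 0 <= r -> 0 <= lambda ->
  (\int[P]_w (enexp (lambda%:E * sum r w))%:E = (expR (- kappa r lambda))%:E)%E.
Proof.
move=> r0 l0.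
have ad0 : adapted 0 (fun _ : measurableTypeR R * D R => 0).
  split => //.
  by move=> s s0; rewrite leNgt s0.
have := mean_sum (lexx 0) r0 l0 ad0; rewrite add0r.
under eq_integral do rewrite integral0 enexp0 mul1r.
move=> ->; under eq_integral do rewrite integral0 enexp0 mul1r immigration_sum0 mule0 enexp0.
rewrite [X in (_ * X)%E](_ : _ = 1%E) ?mule1// integral_cst// mul1e.
exact: probability_setT.
Qed.

(** As [lambda] decreases to 0 along [harmonic n], the mean of [enexp (lambda * sum)] tends to the
    probability that the sum is finite, and by [mean_sum0] it tends to 1. *)
Lemma immigration_sum_finite t : 0 <= t -> {ae P, forall w, (sum t w < +oo)%E}.
Proof.
move=> t0.
have h0 n : 0 <= harmonic n :> R by rewrite /= invr_ge0.
have hp n : 0 < harmonic n :> R by rewrite /= invr_gt0.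
have ms := measurable_immigration_sum t.
have mF : measurable [set w | (sum t w < +oo)%E].
  rewrite (_ : [set w | _] = sum t @^-1` (~` [set +oo%E])).
    by rewrite -[X in measurable X]setTI; apply: ms => //; apply: measurableC;
      exact: emeasurable_set1.
  by apply/seteqP; split => w /=; rewrite ltey => /eqP.
have lim1 : (\int[P]_w (enexp ((harmonic n)%:E * sum t w))%:E)%E @[n --> \oo] -->
    (\int[P]_w (\1_[set w | (sum t w < +oo)%E] w)%:E)%E.
  apply: (@bounded_cvg_integral _ _ _ _ _ _ 1).
  - by apply: (@le_lt_trans _ _ 1%E); [exact: probability_le1|exact: ltry].
  - move=> n; apply: measurableT_comp; first exact: measurable_enexp.
    exact: measurable_funeM.
  - move=> n w; rewrite ger0_norm ?enexp_ge0// enexp_le1//.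
    by rewrite mule_ge0// ?lee_fin// immigration_sum_ge0.
  - move=> w; rewrite indicE; have := immigration_sum_ge0 w t0.
    case E : (sum t w) => [s| |]// _.
      rewrite mem_set; last by rewrite /= E ltry.
      by have := cvg_expRN (cvgMr_tmp (b := s) (@cvg_harmonic R)); rewrite mul0r oppr0 expR0;
        exact.
    rewrite memNset; last by rewrite /= E ltxx.
    rewrite (_ : (fun n => _) = fun=> 0); first exact: cvg_cst.
    by apply/funext => n; rewrite gt0_muley ?lte_fin.
rewrite integral_indic// setIT in lim1.
have lim2 : (\int[P]_w (enexp ((harmonic n)%:E * sum t w))%:E)%E @[n --> \oo] --> 1%E.
  under eq_fun do rewrite mean_sum0//.
  apply: cvg_EFin; first exact: nearW.
  by have := cvg_expRN (cvg_exponent0 t0); rewrite oppr0 expR0; exact.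
have P1 : P [set w | (sum t w < +oo)%E] = 1%E.
  by rewrite -(cvg_lim _ lim1)// (cvg_lim _ lim2).
exists (~` [set w | (sum t w < +oo)%E]); split.
- exact: measurableC.
- by rewrite probability_setC// P1 subee.
- by [].
Qed.

Lemma measurable_immigration t : measurable_fun setT (Y t).
Proof.
by apply: measurableT_comp; [exact: fine_measurable|exact: measurable_immigration_sum].
Qed.

Lemma immigration_ge0 t w : 0 <= t -> 0 <= Y t w.
Proof. by move=> t0; rewrite fine_ge0// immigration_sum_ge0. Qed.

Lemma mean_immigration t r lambda f : 0 <= t -> 0 <= r -> 0 <= lambda -> adapted t f ->
  (\int[P]_w (enexp (\int[N w]_z (f z)%:E) * expR (- (lambda * Y (t + r)%R w)))%:E =
   \int[P]_w (enexp (\int[N w]_z (f z)%:E) * (expR (- kappa r lambda) * expR (- (v r lambda * Y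
     t w))))%:E)%E.
Proof.
move=> t0 r0 l0 hf.
have vr0 : 0 <= v r lambda by case: (hv r0 l0).
have mf := adapted_measurable hf; have f0 := adapted_ge0 hf.
have mE : measurable_fun setT (fun w => enexp (\int[N w]_z (f z)%:E)).
  apply: measurableT_comp; first exact: measurable_enexp.
  apply: (poisson_integral_measurable hN); first exact/measurable_EFinP.
  by move=> z; rewrite lee_fin.
have me l u : measurable_fun setT (fun w => expR (- (l * Y u w))).
  apply: measurableT_comp => //; apply: measurableT_comp => //.
  by apply: measurable_funM => //; exact: measurable_immigration.
have Yf l u : 0 <= u -> (\int[P]_w (enexp (\int[N w]_z (f z)%:E) * enexp (l%:E * sum u w))%:E =
    \int[P]_w (enexp (\int[N w]_z (f z)%:E) * expR (- (l * Y u w)))%:E)%E.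
  move=> u0; apply: ae_eq_integral => //.
  - apply/measurable_EFinP; apply: measurable_funM => //.
    apply: measurableT_comp; first exact: measurable_enexp.
    by apply: measurable_funeM; exact: measurable_immigration_sum.
  - by apply/measurable_EFinP; apply: measurable_funM.
  have := immigration_sum_finite u0; apply: filterS => w wf _.
  rewrite /Y; have := immigration_sum_ge0 w u0.
  by case: (sum u w) wf.
rewrite -Yf ?addr_ge0// mean_sum// Yf// -ge0_integralZl_EFin ?expR_ge0//.
- by apply: eq_integral => w _; rewrite -EFinM mulrCA.
- by move=> w _; rewrite lee_fin mulr_ge0// ?enexp_ge0// expR_ge0.
- by apply/measurable_EFinP; apply: measurable_funM.
Qed.

Lemma mean_immigration0 r lambda : 0 <= r -> 0 <= lambda ->
  (\int[P]_w (expR (- (lambda * Y r w)))%:E = (expR (- kappa r lambda))%:E)%E.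
Proof.
move=> r0 l0.
have ad0 : adapted 0 (fun _ : measurableTypeR R * D R => 0).
  split => //.
  by move=> s s0; rewrite leNgt s0.
have := mean_immigration (lexx 0) r0 l0 ad0; rewrite add0r.
under eq_integral do rewrite integral0 enexp0 mul1r.
move=> ->; under eq_integral do rewrite integral0 enexp0 mul1r /Y immigration_sum0 /= mulr0
  oppr0 expR0 mulr1.
rewrite integral_cst// [X in (_ * X)%E](_ : _ = 1%E) ?mule1//.
exact: probability_setT.
Qed.

End immigration.

(** The pi-system generated by [U] and the whole space, given inductively so that one generator at a
    time can be added. *)
Inductive finite_meets T (U : set (set T)) : set T -> Prop :=
| finite_meets0 : finite_meets U setT
| finite_meets1 A C : U A -> finite_meets U C -> finite_meets U (A `&` C).

Lemma finite_meets_setI T (U : set (set T)) : setI_closed (finite_meets U).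
Proof.
move=> A B; elim=> [|A' C UA _ IH] fB; first by rewrite setTI.
by rewrite -setIA; apply: finite_meets1 => //; exact: IH.
Qed.

Lemma finite_meets_sub T (U : set (set T)) : U `<=` finite_meets U.
Proof. by move=> A UA; rewrite -[A]setIT; apply: finite_meets1 => //; exact: finite_meets0. Qed.

(** [enexp] is injective on [[0, +oo]] with a measurable inverse, so the events defined by [N F],
    including [N F = +oo], are events of the bounded variable [enexp (N F)]. *)
Lemma measurable_preimage_enexp (R : realType) (B : set (\bar R)) : measurable B ->
  exists2 B' : set (measurableTypeR R), measurable B' &
    forall x, (0 <= x)%E -> B x <-> B' (enexp x).
Proof.
move=> mB.
pose g (y : measurableTypeR R) : \bar R := if y <= 0 then +oo%E else (- ln y)%:E.
have mg : measurable_fun setT g.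
  apply: measurable_fun_ifT.
  - exact: measurable_fun_ler.
  - exact: measurable_cst.
  - by apply/measurable_EFinP; apply: measurableT_comp => //; exact: measurable_ln.
exists (g @^-1` B); first by rewrite -[X in measurable X]setTI; exact: mg.
case => [r||] // _; rewrite /g /= ?lexx//.
by rewrite leNgt expR_gt0/= expRK opprK.
Qed.

Section adapted.
Context {R : realType}.
Implicit Types (f g : measurableTypeR R * D R -> R) (A : set (D R)).

Let section_measurable (t s : R) (h : D R -> R) :
  (forall B : set (measurableTypeR R), measurable B -> path_filtration (t - s) [set w | B (h
    w)]) ->
  measurable_fun setT (h : g_sigma_algebraType (@coordinate_events R `[0, t - s]) ->
    measurableTypeR R).
Proof. by move=> hh _ B mB; rewrite setTI; exact: hh. Qed.

Lemma adaptedD t f g : adapted t f -> adapted t g -> adapted t (fun z => f z + g z).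
Proof.
move=> hf hg; split.
- by apply: measurable_funD; [exact: adapted_measurable hf|exact: adapted_measurable hg].
- by move=> z; rewrite addr_ge0 ?(adapted_ge0 hf) ?(adapted_ge0 hg).
- by move=> s w st; rewrite (adapted_supp hf _ st) (adapted_supp hg _ st) addr0.
- move=> s s0 st B mB.
  have hfs := section_measurable (adapted_filtration hf s0 st).
  have hgs := section_measurable (adapted_filtration hg s0 st).
  by have := measurable_funD hfs hgs measurableT mB; rewrite setTI.
Qed.

Lemma adapted_zero t : adapted t (fun _ : measurableTypeR R * D R => 0 : R).
Proof.
split => // s s0 st B mB.
have -> : [set w : D R | B 0] = if `[< B 0 >] then setT else set0.
  by apply/seteqP; split => w /=; case: asboolP.
case: asboolP => _; last exact: sigma_algebra0.
by rewrite -setC0; apply: sigma_algebraC; exact: sigma_algebra0.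
Qed.

(** An atom with [s <= u] has at time [t] an age [t - s] of at least [t - u], so that [A] has been
    observed. *)
Lemma adapted_indic t u k A : 0 <= u -> u <= t -> 0 <= k ->
  path_filtration (t - u) A ->
  adapted t (fun z => k * \1_((`]0, u] : set (measurableTypeR R)) `*` A) z).
Proof.
move=> u0 ut k0 hA.
have mA : measurable A by exact: filtration_measurable hA.
have mF : measurable ((`]0, u] : set (measurableTypeR R)) `*` A).
  by apply: measurableX => //; exact: measurable_itv.
split.
- by apply: measurable_funM => //; exact: measurable_indic.
- by move=> z; rewrite mulr_ge0.
- move=> s w /negP st; rewrite indicE memNset ?mulr0//= in_itv/= => -[/andP[s0 su] _].
  by apply: st; rewrite s0 (le_trans su).
- move=> s s0 st B mB; have [su|us] := leP s u.
    have hA' : path_filtration (t - s) A by apply: path_filtration_mono hA; rewrite lerB.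
    have mA' : measurable (A : set (g_sigma_algebraType (@coordinate_events R `[0, t - s]))) by
      [].
    have mk : measurable_fun setT (fun w : g_sigma_algebraType (@coordinate_events R `[0, t -
      s]) =>
        k * \1_A w : measurableTypeR R).
      by apply: measurable_funM => //; exact: measurable_indic.
    have := mk measurableT _ mB; rewrite setTI; congr (path_filtration _ _).
    apply/seteqP; split=> w /=;
      rewrite !indicE in_setX/= [_ \in `]0, u]%classic]mem_set//= in_itv/= s0 su.
      by [].
    by [].
  have E w : (s, w) \in (`]0, u] : set (measurableTypeR R)) `*` A = false.
    by apply/negbTE/negP => /set_mem[/=]; rewrite in_itv/= leNgt us andbF.
  have := adapted_filtration (adapted_zero t) s0 st mB; congr (path_filtration _ _).
  by apply/seteqP; split=> w /=; rewrite indicE E mulr0.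
Qed.

End adapted.

(** * From functionals of the past to events of the past *)

Section mean_on_events.
Context {R : realType}.
Variable m : {sigma_finite_measure set (measurableTypeR R) -> \bar R}.
Variables (delta : R) (Q : R.-pker (measurableTypeR R) ~> (D R)).
Variables (beta : {posnum R}) (d : measure_display) (Omega : measurableType d)
  (P : probability Omega R)
  (N : Omega -> {measure set (measurableTypeR R * D R) -> \bar R}).
Hypothesis hN : poisson_random_measure P (immigration_intensity beta delta m Q) N.
Local Notation G := (immigration_filtration N).

Definition immigration_events (t : R) : set (set Omega) :=
  \bigcup_(uA in [set uA : R * set (D R) |
                     0 <= uA.1 <= t /\ path_filtration (t - uA.1) uA.2])
        preimage_set_system setT
          (fun w => N w ((`]0%R, uA.1] : set (measurableTypeR R)) `*` uA.2))
          measurable.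

Let window_measurable t u A : path_filtration (t - u) A ->
  measurable ((`]0, u] : set (measurableTypeR R)) `*` (A : set (D R))).
Proof.
move=> hA; apply: measurableX; first exact: measurable_itv.
exact: filtration_measurable hA.
Qed.

Lemma immigration_events_measurable t : immigration_events t `<=` measurable.
Proof.
move=> _ [[u A] /= [_ hA]] [B mB <-].
have [_ mN _ _ _] := hN.
by apply: (mN _ (window_measurable hA)).
Qed.

Lemma immigration_filtration_measurable t : G t `<=` measurable.
Proof.
apply: smallest_sub; first exact: sigma_algebra_measurable.
exact: immigration_events_measurable.
Qed.

Let finite_meets_measurable t : finite_meets (immigration_events t) `<=` measurable.
Proof.
move=> C; elim=> [|A B /immigration_events_measurable mA _ mB]; first exact: measurableT.
exact: measurableI.
Qed.

Section bounded_functional.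
Variables (t : R) (E1 E2 : Omega -> R).
Hypotheses (mE1 : measurable_fun setT E1) (mE2 : measurable_fun setT E2).
Hypotheses (E1_01 : forall w, 0 <= E1 w <= 1) (E2_01 : forall w, 0 <= E2 w <= 1).
Hypothesis E12 : forall f, adapted t f ->
  (\int[P]_w (enexp (\int[N w]_z (f z)%:E) * E1 w)%:E =
   \int[P]_w (enexp (\int[N w]_z (f z)%:E) * E2 w)%:E)%E.

Let Eon C (E : Omega -> R) w := \1_C w * E w.

Let mE f C E : adapted t f -> measurable C -> measurable_fun setT E ->
  measurable_fun setT (fun w => enexp (\int[N w]_z (f z)%:E) * Eon C E w).
Proof.
move=> hf mC mE; apply: measurable_funM.
  apply: measurableT_comp; first exact: measurable_enexp.
  apply: (poisson_integral_measurable hN).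
    by apply/measurable_EFinP; exact: adapted_measurable hf.
  by move=> z; rewrite lee_fin (adapted_ge0 hf).
by apply: measurable_funM => //; exact: measurable_indic.
Qed.

Let E_01 f C E w : adapted t f -> (forall w, 0 <= E w <= 1) ->
  0 <= enexp (\int[N w]_z (f z)%:E) * Eon C E w <= 1.
Proof.
move=> hf /(_ w)/andP[Ege0 Ele1]; rewrite /Eon.
rewrite !mulr_ge0 ?enexp_ge0//= mulr_ile1 ?mulr_ge0 ?enexp_ge0//.
  rewrite enexp_le1//; apply: integral_ge0 => z _.
  by rewrite lee_fin (adapted_ge0 hf).
by rewrite mulr_ile1// indicE; case: (_ \in _).
Qed.

Let weightedoo (F : Omega -> R) (mF : measurable_fun setT F)
  (F01 : forall w, 0 <= F w <= 1) (F0 : forall w, 0 <= F w) :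
  (weighted P mF F0 setT < +oo)%E.
Proof.
rewrite weightedE//; apply: (@le_lt_trans _ _ (\int[P]_w 1)%E).
  apply: ge0_le_integral => //.
  - by move=> w _; apply: mule_ge0; rewrite lee_fin.
  - apply: emeasurable_funM; first exact/measurable_EFinP.
    by apply/measurable_EFinP; exact: (measurable_indic measurableT).
  - by move=> w _; rewrite indicT mule1 lee_fin; case/andP: (F01 w).
rewrite integral_cst// mul1e.
by apply: (@le_lt_trans _ _ 1%E); [exact: probability_le1|exact: ltry].
Qed.

(* Adding [k * \1_F] to [f] multiplies the integrand by the [k]-th power of
   [exp (- N F)], so the moments of the latter determine the integrals over the
   events defined by [N F]. *)
Lemma mean_on_meets C : finite_meets (immigration_events t) C -> forall f, adapted t f ->
  (\int[P]_w (enexp (\int[N w]_z (f z)%:E) * (\1_C w * E1 w))%:E =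
   \int[P]_w (enexp (\int[N w]_z (f z)%:E) * (\1_C w * E2 w))%:E)%E.
Proof.
elim=> [f hf|A {}C UA hC IH f hf].
  under eq_integral do rewrite indicT mul1r.
  by under [RHS]eq_integral do rewrite indicT mul1r; exact: E12.
have mC := finite_meets_measurable hC.
case: UA => -[u W] /= [/andP[u0 ut] hW] [B mB <-].
pose F := (`]0, u] : set (measurableTypeR R)) `*` W.
have mF : measurable F := window_measurable hW.
have [B' mB' BB'] := measurable_preimage_enexp mB.
pose X w := enexp (N w F).
have mX : measurable_fun setT (X : _ -> measurableTypeR R).
  apply: measurableT_comp; first exact: measurable_enexp.
  by have [_ mN _ _ _] := hN; exact: mN.
have X01 w : 0 <= X w <= 1 by rewrite enexp_ge0 enexp_le1.
have w0 (E : Omega -> R) : (forall w, 0 <= E w <= 1) ->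
  forall w, 0 <= enexp (\int[N w]_z (f z)%:E) * Eon C E w.
  by move=> E01 w; case/andP: (E_01 C w hf E01).
(* The densities are [exp (- N f) * \1_C * E1] and the same with [E2]; the [k]-th moments of [X] are
   the two sides of the induction hypothesis for [f + k * \1_F]. *)
pose m1 := weighted P (mE hf mC mE1) (w0 _ E1_01).
pose m2 := weighted P (mE hf mC mE2) (w0 _ E2_01).
have m1oo : (m1 setT < +oo)%E by apply: weightedoo => w; exact: E_01.
have m2oo : (m2 setT < +oo)%E by apply: weightedoo => w; exact: E_01.
have mom (E : Omega -> R) (mE' : measurable_fun setT E) (E01 : forall w, 0 <= E w <= 1) k :
    (\int[weighted P (mE hf mC mE') (w0 _ E01)]_w (X w ^+ k)%:E =
     \int[P]_w (enexp (\int[N w]_z (f z + k%:R * \1_F z)%:E) * (\1_C w * E w))%:E)%E.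
  rewrite integral_weighted; last 2 first.
  - by apply/measurable_EFinP; exact: measurable_funX.
  - by move=> w; rewrite lee_fin exprn_ge0// enexp_ge0.
  apply: eq_integral => w _; rewrite -EFinM /Eon; congr (_%:E).
  rewrite (_ : (\int[N w]_z (f z + k%:R * \1_F z)%:E)%E =
      (\int[N w]_z (f z)%:E + k%:R%:E * N w F)%E); last first.
    under eq_integral do rewrite EFinD EFinM.
    rewrite ge0_integralD; last 5 first.
    - by [].
    - by move=> z _; rewrite lee_fin (adapted_ge0 hf).
    - by apply/measurable_EFinP; exact: adapted_measurable hf.
    - by move=> z _; rewrite -EFinM lee_fin mulr_ge0.
    - by apply: measurable_funeM; apply/measurable_EFinP; exact: measurable_indic.
    congr (_ + _)%E; rewrite ge0_integralZl_EFin//.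
    - by rewrite integral_indic// setIT.
    - by apply/measurable_EFinP; exact: measurable_indic.
  rewrite [in RHS]enexpD; last 2 first.
  - by apply: integral_ge0 => z _; rewrite lee_fin (adapted_ge0 hf).
  - by rewrite mule_ge0// lee_fin.
  rewrite (_ : enexp (k%:R%:E * N w F)%E = X w ^+ k); first by ring.
  rewrite /X; elim: k => [|k IHk]; first by rewrite mul0e enexp0 expr0.
  rewrite exprS -IHk -enexpD//.
  by congr enexp; rewrite -natr1 EFinD ge0_muleDl ?lee_fin// mul1e addeC.
have moments k : (\int[m1]_w (X w ^+ k)%:E = \int[m2]_w (X w ^+ k)%:E)%E.
  rewrite !mom; apply: IH; apply: adaptedD => //.
  exact: adapted_indic.
have := moments_unique m1oo m2oo mX X01 moments mB'.
have mXB : measurable (X @^-1` B') by rewrite -[X in measurable X]setTI; exact: mX.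
rewrite !weightedE//.
have E (e : Omega -> R) w :
  (enexp (\int[N w]_z (f z)%:E) * (\1_([set: Omega] `&` (fun w =>
    N w F) @^-1` B `&` C) w * e w))%:E =
  ((enexp (\int[N w]_z (f z)%:E) * Eon C e w)%:E * (\1_(X @^-1` B') w)%:E)%E.
  rewrite -EFinM /Eon setTI indicI /= (_ : (fun w => N w F) @^-1` B = X @^-1` B');
    first by congr _%:E; ring.
  by apply/seteqP; split => w' /=; rewrite /X; apply BB'.
by under eq_integral do rewrite -E; under [X in _ = X]eq_integral do rewrite -E.
Qed.

(** For [f = 0] the finite measures with densities [E1] and [E2] agree on the pi-system
    [finite_meets], which contains the whole space and generates [G t]. *)
Lemma mean_on_filtration C : G t C ->
  (\int[P]_(w in C) (E1 w)%:E = \int[P]_(w in C) (E2 w)%:E)%E.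
Proof.
move=> GC; have mC := immigration_filtration_measurable GC.
have w0 (E : Omega -> R) : (forall w, 0 <= E w <= 1) -> forall w, 0 <= E w.
  by move=> E01 w; case/andP: (E01 w).
pose m1 := weighted P mE1 (w0 _ E1_01).
pose m2 := weighted P mE2 (w0 _ E2_01).
have := @g_sigma_algebra_measure_unique _ _ _ (finite_meets (immigration_events t))
  (@finite_meets_measurable t) (fun=> setT) (fun=> finite_meets0 _) _ m1 m2
  (@finite_meets_setI _ _).
have -> : \bigcup_(_ in [set: nat]) [set: Omega] = setT by apply/seteqP; split => // w _;
  exists 0%N.
move=> /(_ erefl).
have agree A : finite_meets (immigration_events t) A -> m1 A = m2 A.
  move=> hA; have mA := finite_meets_measurable hA.
  rewrite /m1 /m2 !weightedE//.
  have E (e : Omega -> R) : (\int[P]_w ((e w)%:E * (\1_A w)%:E) =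
      \int[P]_w (enexp (\int[N w]_z 0%:E) * (\1_A w * e w))%:E)%E.
    by apply: eq_integral => w _; rewrite integral0 enexp0 mul1r mulrC EFinM muleC.
  by rewrite !E; exact: mean_on_meets hA _ (adapted_zero t).
move=> /(_ agree (fun=> weightedoo mE1 E1_01 _)) /(_ C).
have sC : <<s finite_meets (immigration_events t) >> C.
  apply: smallest_sub GC; first exact: smallest_sigma_algebra.
  by move=> A UA; apply: sub_sigma_algebra; exact: finite_meets_sub.
move=> /(_ sC); rewrite /m1 /m2 !weightedE//.
have E (e : Omega -> R) : (\int[P]_w ((e w)%:E * (\1_C w)%:E) = \int[P]_(w in C) (e w)%:E)%E.
  rewrite [RHS]integral_mkcond; apply: eq_integral => w _.
  by rewrite patchE indicE; case: (_ \in _); rewrite ?mule1 ?mule0.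
by rewrite !E.
Qed.

End bounded_functional.
End mean_on_events.

Lemma integral_mixture_in d1 (T1 : measurableType d1) d2 (T2 : measurableType d2) (R : realType)
    (mu : {measure set T1 -> \bar R}) (A : set T1) (mA : measurable A)
    (k : T1 -> {measure set T2 -> \bar R})
    (mk : forall B, measurable B -> measurable_fun setT (k ^~ B)) (C : set T2) (f : T2 -> \bar
      R) :
  measurable C -> measurable_fun setT f -> (forall y, (0 <= f y)%E) ->
  (\int[mixture mu mA mk]_(y in C) f y = \int[mu]_(x in A) \int[k x]_(y in C) f y)%E.
Proof.
move=> mC mf f0; rewrite [LHS]integral_mkcond.
rewrite (@integral_mixture _ _ _ _ _ mu A mA k mk); last 3 first.
- by [].
- by apply/(measurable_restrictT _ mC); exact: measurable_funTS.
- by move=> y; rewrite patchE; case: ifP.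
by apply: eq_integral => x _; rewrite [RHS]integral_mkcond.
Qed.

Lemma full_setI d (T : measurableType d) (R : realType)
    (nu : {measure set T -> \bar R}) (A B : set T) :
  measurable A -> measurable B -> nu setT = 1%E -> nu A = 1%E -> nu B = nu (B `&` A).
Proof.
move=> mA mB nuT nuA; have n0 := full_setC_null mA nuT nuA.
have mAC := measurableC mA.
rewrite (measureDI nu mB mA) [X in (X + _)%E](_ : _ = 0%E) ?add0e//.
apply/eqP; rewrite eq_le measure_ge0 andbT -n0; apply: le_measure.
- by apply/mem_set; exact: measurableD.
- exact/mem_set.
- by move=> x [].
Qed.

(** * The CBI-semigroup and the conditional law *)

Section immigration_kernel.
Context {R : realType} (b c : R).
Variable m : {sigma_finite_measure set (measurableTypeR R) -> \bar R}.
Hypothesis hc : 0 <= c.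
Hypothesis hm : (\int[m]_(u in `]0%R, +oo[) (Num.min u (u ^+ 2))%:E < +oo)%E.
Variable delta : R.
Local Notation phi := (branching_mechanism b c m).
Hypothesis hdelta : derive_at_infty phi = delta%:E.
Variables (v : R -> R -> R) (K : R -> R.-pker (measurableTypeR R) ~> (measurableTypeR R)).
Hypotheses (hv : is_cumulant phi v) (hK : CB_semigroup v K).
Variable Q : R.-pker (measurableTypeR R) ~> (D R).
Hypothesis hQ : forall x, 0 <= x ->
  markov_process (Q x) (@path_filtration R) K (fun t w => w t) /\
  Q x [set w : D R | w 0 = x] = 1%E.
Variables (beta : {posnum R}) (d : measure_display) (Omega : measurableType d)
  (P : probability Omega R)
  (N : Omega -> {measure set (measurableTypeR R * D R) -> \bar R}).
Hypothesis hN : poisson_random_measure P (immigration_intensity beta delta m Q) N.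
Local Notation sum := (immigration_sum beta%:num delta N).
Local Notation Y := (fun t w => fine (sum t w)).
Local Notation kappa := (immigration_exponent v beta).
Local Notation nonneg := (`[0%R, +oo[%classic : set (measurableTypeR R)).
Local Notation psi := (fun lambda => beta%:num * lambda).

Definition immigration_kernel (t : R) : R.-pker (measurableTypeR R) ~> (measurableTypeR R) :=
  convolution_kernel P (K t) (measurable_immigration hN t).
Local Notation K' := immigration_kernel.

Let hT : transition_semigroup K. Proof. by case: hK. Qed.

Let mnonneg : measurable nonneg. Proof. exact: measurable_itv. Qed.

Let mexp (l : R) : measurable_fun setT (fun y : measurableTypeR R =>
  (expR (- (l * y)))%:E : \bar R).
Proof.
by apply/measurable_EFinP; apply: measurableT_comp => //; apply: measurableT_comp.
Qed.

Let mY l t : measurable_fun setT (fun w => expR (- (l * Y t w))).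
Proof.
apply: measurableT_comp => //; apply: measurableT_comp => //.
by apply: measurable_funM => //; exact: (measurable_immigration hN t).
Qed.

Lemma immigration_kernel_nonneg t x : 0 <= t -> 0 <= x -> K' t x nonneg = 1%E.
Proof.
move=> t0 x0; have [K1 _ _] := hT.
have m1 : measurable_fun setT ((cst 1%E : measurableTypeR R -> \bar R) \_ nonneg).
  by apply/(measurable_restrictT _ mnonneg); exact: measurable_cst.
have ge1 y : (0 <= ((cst 1%E : measurableTypeR R -> \bar R) \_ nonneg) y)%E.
  by rewrite patchE; case: ifP.
rewrite -[LHS]mul1e -integral_cst// [LHS]integral_mkcond integral_convolution//.
rewrite (transition_integral_full hT)//; last 2 first.
- exact: (measurable_convolution_integrand P (measurable_immigration hN t) m1 ge1).
- by move=> y; exact: integral_ge0.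
transitivity (\int[K t x]_(y in nonneg) 1)%E; last by rewrite integral_cst// mul1e K1.
apply: eq_integral => y /set_mem/=; rewrite in_itv/= andbT => y0.
transitivity (\int[P]_w 1)%E; last by rewrite integral_cst// mul1e; exact: probability_setT.
apply: eq_integral => w _; rewrite patchE ifT//; apply/mem_set => /=.
by rewrite in_itv/= andbT addr_ge0// immigration_ge0.
Qed.

Lemma immigration_kernel_laplace t x l : 0 <= t -> 0 <= x -> 0 <= l ->
  (\int[K' t x]_(y in nonneg) (expR (- (l * y)))%:E =
   (expR (- (x * v t l)) * expR (- kappa t l))%:E)%E.
Proof.
move=> t0 x0 l0; have [_ KL] := hK.
have E0 y : (0 <= (expR (- (l * y)) : R)%:E)%E by rewrite lee_fin expR_ge0.
rewrite (_ : (\int[K' t x]_(y in nonneg) _)%E = \int[K' t x]_y (expR (- (l * y)))%:E)%E;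
  last first.
  rewrite [RHS](ge0_negligible_integral (N := ~` nonneg))//.
  - by rewrite setTD setCK.
  - exact: measurableC.
  apply: full_setC_null; [exact: mnonneg|exact: prob_kernel|exact: immigration_kernel_nonneg].
rewrite integral_convolution//.
transitivity (\int[K t x]_y ((expR (- kappa t l))%:E * (expR (- (l * y)))%:E))%E.
  apply: eq_integral => y _.
  rewrite -(mean_immigration0 hc hm hdelta hv hK hQ hN t0 l0).
  rewrite muleC -ge0_integralZl_EFin ?expR_ge0//.
  - by apply: eq_integral => w _; rewrite -EFinM -expRD; congr (expR _)%:E; ring.
  - by apply/measurable_EFinP; exact: mY.
rewrite ge0_integralZl_EFin ?expR_ge0//.
by rewrite (transition_integral_full hT)// KL// -EFinM mulrC.
Qed.

(** The Laplace transform of [Y (s + t)] is computed directly, and by shifting from time [s] with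
    the test function 0. *)
Lemma immigration_exponentD s t l : 0 <= s -> 0 <= t -> 0 <= l ->
  expR (- kappa (s + t) l) = expR (- kappa t l) * expR (- kappa s (v t l)).
Proof.
move=> s0 t0 l0.
have vt0 : 0 <= v t l by case: (hv t0 l0).
have ad0 : adapted s (fun _ : measurableTypeR R * D R => 0 : R) by exact: adapted_zero.
have := mean_immigration hc hm hdelta hv hK hQ hN s0 t0 l0 ad0.
under eq_integral do rewrite integral0 enexp0 mul1r.
rewrite (mean_immigration0 hc hm hdelta hv hK hQ hN (addr_ge0 s0 t0) l0).
under eq_integral do rewrite integral0 enexp0 mul1r EFinM.
rewrite ge0_integralZl_EFin ?expR_ge0//.
- by rewrite (mean_immigration0 hc hm hdelta hv hK hQ hN s0 vt0) -EFinM => -[].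
- by apply/measurable_EFinP; exact: mY.
Qed.

(** Both sides of Chapman-Kolmogorov are probabilities on the half-line, so their Laplace transforms
    at integers suffice; these agree by the flow property of [v] and the additivity of the exponent.
    The identity at time 0 holds since [Y] starts at 0. *)
Lemma immigration_kernel_semigroup : CBI_semigroup psi v K'.
Proof.
split; last first.
  by move=> t x l t0 x0 l0; rewrite immigration_kernel_laplace// -expRD.
split; first exact: immigration_kernel_nonneg.
  move=> x B x0 mB.
  have [_ <-// _] := hT; rewrite -[B]setIT -!integral_indic//.
  rewrite integral_convolution//; last by apply/measurable_EFinP; exact: measurable_indic.
  apply: eq_integral => y _; under eq_integral do rewrite immigration_sum0 add0r.
  by rewrite integral_cst// [X in (_ * X)%E]probability_setT mule1.
move=> s t x B s0 t0 x0 mB.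
have mk A : measurable A -> measurable_fun setT (fun y => K' t y A) by exact: measurable_kernel.
pose nu : {measure set (measurableTypeR R) -> \bar R} := mixture (K' s x) mnonneg mk.
have nuE A : nu A = (\int[K' s x]_(y in nonneg) K' t y A)%E by [].
rewrite -nuE.
have K1 : K' (s + t) x nonneg = 1%E by rewrite immigration_kernel_nonneg// addr_ge0.
have nu1 A : (forall y, 0 <= y -> K' t y A = 1%E) -> nu A = 1%E.
  move=> KA; rewrite nuE; transitivity (\int[K' s x]_(y in nonneg) 1)%E; last first.
    by rewrite integral_cst// mul1e immigration_kernel_nonneg.
  by apply: eq_integral => y /set_mem/=; rewrite in_itv/= andbT => y0; rewrite KA.
have nun : nu nonneg = 1%E by apply: nu1 => y y0; exact: immigration_kernel_nonneg.
rewrite (full_setI mnonneg mB _ K1); last exact: prob_kernel.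
rewrite (full_setI mnonneg mB _ nun); last by apply: nu1 => y _; exact: prob_kernel.
apply: laplace_unique => //; rewrite ?K1 ?nun ?ltry// => k.
have k0 : 0 <= k%:R :> R by [].
have vk0 : 0 <= v t k%:R by case: (hv t0 k0).
rewrite immigration_kernel_laplace ?addr_ge0//.
rewrite integral_mixture_in//.
transitivity (\int[K' s x]_(y in nonneg) ((expR (- kappa t k%:R))%:E * (expR (- (v t k%:R *
  y)))%:E))%E.
  rewrite ge0_integralZl_EFin ?expR_ge0//; last exact: measurable_funTS.
  rewrite immigration_kernel_laplace// -EFinM; congr _%:E.
  by rewrite (cumulant_semigroup hv hK s0 t0 k0) immigration_exponentD//; ring.
apply: eq_integral => y /set_mem/=; rewrite in_itv/= andbT => y0.
by rewrite immigration_kernel_laplace// -EFinM mulrC [y * _]mulrC.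
Qed.

(** The law of [Y (t + r)] on [C] and the mixture over [C] of the kernels [K' r (Y t w)] live on the
    half-line. Their Laplace transforms at an integer [k] agree by [mean_on_filtration], whose
    hypothesis is [mean_immigration]. *)
Lemma immigration_cond_law t r B C : 0 <= t -> 0 <= r -> measurable B ->
  immigration_filtration N t C ->
  P (Y (t + r) @^-1` B `&` C) = (\int[P]_(w in C) K' r (Y t w) B)%E.
Proof.
move=> t0 r0 mB GC; have mC := immigration_filtration_measurable hN GC.
have Ytr0 w : 0 <= Y (t + r) w by rewrite immigration_ge0// addr_ge0.
have Yt0 w : 0 <= Y t w by exact: immigration_ge0.
pose k1 w : {measure set (measurableTypeR R) -> \bar R} := \d_(Y (t + r) w : measurableTypeR R).
have mk1 A : measurable A -> measurable_fun setT (k1 ^~ A).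
  move=> mA; apply/measurable_EFinP; apply: (measurableT_comp (measurable_indic mA)).
  exact: (measurable_immigration hN (t + r)).
pose k2 w : {measure set (measurableTypeR R) -> \bar R} := K' r (Y t w).
have mk2 A : measurable A -> measurable_fun setT (k2 ^~ A).
  move=> mA; apply: (@measurableT_comp _ _ _ _ _ _ (fun y : measurableTypeR R => K' r y A)
    _ (Y t : Omega -> measurableTypeR R)); first exact: measurable_kernel.
  exact: (measurable_immigration hN t).
pose nu1 := mixture P mC mk1; pose nu2 := mixture P mC mk2.
have full (k : Omega -> {measure set (measurableTypeR R) -> \bar R})
    (mk : forall A, measurable A -> measurable_fun setT (k ^~ A)) :
    (forall w, k w nonneg = 1%E) -> (forall w, k w setT = 1%E) ->
    forall A, measurable A -> mixture P mC mk A = mixture P mC mk (A `&` nonneg).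
  move=> kn kT A mA; rewrite /mixture; apply: eq_integral => w _.
  exact: (full_setI mnonneg mA (kT w) (kn w)).
have k1n w : k1 w nonneg = 1%E.
  by rewrite /k1 /= diracE mem_set//= in_itv/= Ytr0.
have k1T w : k1 w setT = 1%E by rewrite /k1 /= diracT.
have k2T w : k2 w setT = 1%E by exact: prob_kernel.
have k2n w : k2 w nonneg = 1%E by exact: immigration_kernel_nonneg.
have -> : P (Y (t + r) @^-1` B `&` C) = nu1 B.
  have mYB : measurable (Y (t + r) @^-1` B).
    by rewrite -[X in measurable X]setTI; exact: (measurable_immigration hN (t + r)).
  by rewrite -integral_indic//.
have -> : (\int[P]_(w in C) K' r (Y t w) B)%E = nu2 B by [].
apply: (etrans (full _ mk1 k1n k1T _ mB)).
apply: (etrans _ (esym (full _ mk2 k2n k2T _ mB))).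
have oo (k : Omega -> {measure set (measurableTypeR R) -> \bar R})
    (mk : forall A, measurable A -> measurable_fun setT (k ^~ A)) :
    (forall w, k w nonneg = 1%E) -> (mixture P mC mk nonneg < +oo)%E.
  move=> kn; rewrite /mixture (_ : (\int[P]_(x in C) _)%E = \int[P]_(x in C) 1)%E.
    rewrite integral_cst// mul1e.
    by apply: (@le_lt_trans _ _ 1%E); [exact: probability_le1|exact: ltry].
  by apply: eq_integral => w _; rewrite kn.
apply: laplace_unique => //; [exact: oo|exact: oo|move=> k].
have k0 : 0 <= k%:R :> R by [].
have vr0 : 0 <= v r k%:R by case: (hv r0 k0).
have e0 y : (0 <= (expR (- (k%:R * y)) : R)%:E)%E by rewrite lee_fin expR_ge0.
rewrite !integral_mixture_in//.
transitivity (\int[P]_(w in C) (expR (- (k%:R * Y (t + r) w)))%:E)%E.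
  apply: eq_integral => w _.
  rewrite integral_dirac//; last exact: measurable_funTS.
  by rewrite -/(k1 w nonneg) k1n mul1e.
transitivity (\int[P]_(w in C) (expR (- kappa r k%:R) * expR (- (v r k%:R * Y t w)))%:E)%E;
  last first.
  apply: eq_integral => w _.
  by rewrite /k2 immigration_kernel_laplace// mulrC [Y t w * _]mulrC.
have kap0 : 0 <= kappa r k%:R.
  apply: Rintegral_ge0 => s /=; rewrite in_itv/= => /andP[s0 _].
  by rewrite mulr_ge0//; case: (hv s0 k0).
apply: (mean_on_filtration hN _ _ _ _ _ GC).
- exact: mY.
- by apply: measurable_funM => //; exact: mY.
- by move=> w; rewrite expR_ge0 expR_le1 oppr_le0 mulr_ge0.
- move=> w; rewrite mulr_ge0 ?expR_ge0//= mulr_ile1 ?expR_ge0// expR_le1 oppr_le0//.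
  by rewrite mulr_ge0.
- by move=> f hf; exact: (mean_immigration hc hm hdelta hv hK hQ hN t0 r0 k0 hf).
Qed.

End immigration_kernel.

(** * Measurability of the process at a fixed time *)

Section ae_measurable_closure.
Context {R : realType} d (Omega : measurableType d) (P : {measure set Omega -> \bar R}).
Variable U : set (set Omega).
Local Notation aem := (ae_measurable P <<s U>>).
Local Notation OU := (g_sigma_algebraType U).

Lemma ae_measurable_exact d' (T : measurableType d') (f : Omega -> T) :
  (forall B, measurable B -> <<s U>> (f @^-1` B)) -> aem f.
Proof. by move=> mf; exists f; split => //; exact: aeW. Qed.

Lemma ae_measurable_eq d' (T : measurableType d') (f1 f2 : Omega -> T) :
  {ae P, forall w, f1 w = f2 w} -> aem f1 -> aem f2.
Proof.
move=> f12 [g [mg f1g]]; exists g; split => //.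
by apply: filterS2 f12 f1g => w ->.
Qed.

Lemma ae_measurable_comp d1 (T1 : measurableType d1) d2 (T2 : measurableType d2)
    (h : T1 -> T2) (f : Omega -> T1) :
  measurable_fun setT h -> aem f -> aem (fun w => h (f w)).
Proof.
move=> mh [g [mg fg]]; exists (fun w => h (g w)); split.
  by move=> B mB; apply: (mg (h @^-1` B)); rewrite -[X in measurable X]setTI; exact: mh.
by apply: filterS fg => w ->.
Qed.

Let version d' (T : measurableType d') (f : Omega -> T) : aem f ->
  exists2 g : OU -> T, measurable_fun setT g & {ae P, forall w, f w = g w}.
Proof.
move=> [g [mg fg]]; exists g; last by apply: filterS fg => w; exact.
by move=> _ B mB; rewrite setTI; exact: mg.
Qed.

Let of_version d' (T : measurableType d') (f : Omega -> T) (g : OU -> T) :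
  measurable_fun setT g -> {ae P, forall w, f w = g w} -> aem f.
Proof.
move=> mg fg; exists g; split; last by apply: filterS fg => w ->.
move=> B mB; by have := mg measurableT B mB; rewrite setTI.
Qed.

Lemma ae_measurableD (f1 f2 : Omega -> \bar R) : aem f1 -> aem f2 -> aem (fun w => f1 w + f2 w)%E.
Proof.
move=> /version[g1 mg1 fg1] /version[g2 mg2 fg2].
apply: (of_version (emeasurable_funD mg1 mg2)).
by apply: filterS2 fg1 fg2 => w -> ->.
Qed.

Lemma ae_measurableB (f1 f2 : Omega -> \bar R) : aem f1 -> aem f2 -> aem (fun w => f1 w - f2 w)%E.
Proof.
move=> /version[g1 mg1 fg1] /version[g2 mg2 fg2].
apply: (of_version (emeasurable_funB mg1 mg2)).
by apply: filterS2 fg1 fg2 => w -> ->.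
Qed.

Lemma ae_measurable_cvg (f_ : (Omega -> \bar R)^nat) (f : Omega -> \bar R) :
  (forall n, aem (f_ n)) -> {ae P, forall w, f_ n w @[n --> \oo] --> f w} -> aem f.
Proof.
move=> aef f_f; have /choice[g_ gP] n : exists g : OU -> \bar R,
    measurable_fun setT g /\ {ae P, forall w, f_ n w = g w}.
  by have [g] := version (aef n); exists g.
(* The upper limit of the versions is measurable everywhere, and it is [f] wherever the versions
   converge to [f]. *)
apply: (of_version (g := fun w => limn_esup (g_ ^~ w))).
  by apply: measurable_fun_limn_esup => n; case: (gP n).
have fg : {ae P, forall w, forall n, f_ n w = g_ n w}.
  by apply: ae_foralln => n; case: (gP n).
apply: filterS2 fg f_f => w fgw /cvg_limn_einf_sup[_ <-].
by congr limn_esup; apply/funext.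
Qed.

End ae_measurable_closure.

(** * Windows observed at time t and their counts *)

Section observed_windows.
Context {R : realType}.
Variable m : {sigma_finite_measure set (measurableTypeR R) -> \bar R}.
Variables (delta : R) (Q : R.-pker (measurableTypeR R) ~> (D R)).
Hypothesis hQ0 : forall x, 0 <= x -> Q x [set w : D R | w 0 = x] = 1%E.
Variables (beta : {posnum R}) (d : measure_display) (Omega : measurableType d)
  (P : probability Omega R)
  (N : Omega -> {measure set (measurableTypeR R * D R) -> \bar R}).
Hypothesis hN : poisson_random_measure P (immigration_intensity beta delta m Q) N.
Notation leb := (@lebesgue_measure R).
Local Notation mu := (immigration_intensity beta delta m Q).
Local Notation times := (immigration_times beta delta).

Definition window (u : R) (A : set (D R)) : set (measurableTypeR R * D R) :=
  (`]0%R, u] : set (measurableTypeR R)) `*` A.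

Lemma measurable_window u A : measurable A -> measurable (window u A).
Proof. by move=> mA; apply: measurableX => //; exact: measurable_itv. Qed.

Definition windows (t : R) : set (set (measurableTypeR R * D R)) :=
  [set B | exists u A, [/\ 0 <= u, u <= t, path_filtration (t - u) A & B = window u A]].

Lemma windows_measurable t : windows t `<=` measurable.
Proof.
move=> _ [u [A [_ _ hA ->]]]; apply: measurable_window.
exact: filtration_measurable hA.
Qed.

(** The intersection is a window up to the smaller of the two times, where the path filtration is
    the larger one and contains both path events. *)
Lemma windows_setI t : setI_closed (windows t).
Proof.
move=> _ _ [u [A [u0 ut hA ->]]] [u' [A' [u0' ut' hA' ->]]].
have [le1 le2] : Num.min u u' <= u /\ Num.min u u' <= u' by rewrite !ge_min !lexx orbT.
exists (Num.min u u'), (A `&` A'); split.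
- by rewrite le_min u0.
- exact: le_trans le1 ut.
- have hA1 : path_filtration (t - Num.min u u') A by apply: path_filtration_mono hA; rewrite lerB.
  have hA1' : path_filtration (t - Num.min u u') A' by apply: path_filtration_mono hA';
    rewrite lerB.
  exact: (@measurableI _ (g_sigma_algebraType (@coordinate_events R `[0, t - Num.min u u']))).
- apply/seteqP; split => -[s w] /=; rewrite /window /= !in_itv/= le_min.
    by move=> [[/andP[-> ->] Aw] [/andP[_ ->]]].
  by move=> [/andP[-> /andP[-> ->]] []].
Qed.

Lemma generated_measurable t : <<s windows t >> `<=` measurable.
Proof.
by apply: smallest_sub; [exact: sigma_algebra_measurable|exact: windows_measurable].
Qed.

Lemma times_finite t : (times (`]0%R, t]%classic : set R) < +oo)%E.
Proof.
have [t0|t0] := ltP t 0.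
  by rewrite set_itv_ge ?measure0 ?ltry// bnd_simp -leNgt ltW.
pose M := beta%:num * (t + `|delta^-1| * (1 + expR (`|delta| * t))).
have E : `]0%R, t] `&` `]0%R, +oo[ = `]0%R, t]%classic :> set R.
  apply/seteqP; split => s /=; rewrite !in_itv/= andbT; first by case.
  by move=> /andP[s0 st]; rewrite s0.
rewrite /= /immigration_times E.
apply: (@le_lt_trans _ _ (\int[leb]_(s in `]0%R, t] : set R) M%:E)%E).
  apply: ge0_le_integral => //.
  - move=> s /=; rewrite in_itv/= => /andP[s0 _].
    by rewrite lee_fin mulr_ge0// clock_ge0// ltW.
  - apply: measurable_funTS; apply/measurable_EFinP; apply: measurable_funM => //.
    exact: measurable_clock.
  - move=> s /=; rewrite in_itv/= => /andP[s0 st].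
    by rewrite lee_fin ler_wpM2l// clock_le// ltW.
rewrite integral_cst//= lebesgue_measure_itv/=; case: ifPn => _.
  by rewrite -EFinB -EFinM ltry.
by rewrite mule0.
Qed.

Lemma measurable_initial (F : set (measurableTypeR R)) : measurable F -> measurable [set w : D R
  | F (w 0)].
Proof.
by move=> mF; have := measurable_coordinate (0 : R) measurableT mF; rewrite setTI.
Qed.

(** Under [Q x] the path starts at [x] almost surely, so this mass is at most [m F]. *)
Lemma mixed_initial_finite (F : set (measurableTypeR R)) : measurable F -> (m F < +oo)%E ->
  (mixed_path_law m Q [set w : D R | F (w 0%R)] < +oo)%E.
Proof.
move=> mF Foo; have mFw := measurable_initial mF.
apply: le_lt_trans Foo; rewrite /mixed_path_law -[F in leRHS]setIT -integral_indic//.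
apply: (@le_trans _ _ (\int[m]_(x in `]0%R, +oo[) (\1_F x)%:E)%E); last first.
  apply: ge0_subset_integral => //.
  by apply/measurable_EFinP; exact: measurable_indic.
apply: ge0_le_integral => //.
- by apply: measurable_funTS; exact: measurable_kernel.
- by apply: measurable_funTS; apply/measurable_EFinP; exact: measurable_indic.
move=> x /=; rewrite in_itv/= andbT => x0.
rewrite indicE; have [xF|xF] := boolP (x \in F).
  apply: (@le_trans _ _ (Q x setT)); last by rewrite prob_kernel.
  by apply: le_measure => //; exact/mem_set.
have mx : measurable [set w : D R | w 0 = x] by exact: (measurable_initial (measurable_set1 x)).
apply: (@le_trans _ _ (Q x (~` [set w : D R | w 0%R = x]))); last first.
  by rewrite (full_setC_null mx (@prob_kernel _ _ _ _ _ Q x) (hQ0 (ltW x0))).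
apply: le_measure; [exact/mem_set|exact/mem_set/measurableC|].
by move=> w /= Fw wx; move/negP: xF; apply; rewrite -wx; exact/mem_set.
Qed.

Section fixed_time.
Variables (t : R).
Hypothesis t0 : 0 <= t.
Local Notation aem := (ae_measurable P (immigration_filtration N t)).
Local Notation W := (window t setT).

Let mW : measurable W. Proof. exact: measurable_window. Qed.

(** Sets of finite [m]-measure restrict the starting points of paths. A starting point is seen at
    age 0, so these restrictions are windows up to time [t] itself. *)
Let exhaustion : exists C : (set (measurableTypeR R * D R))^nat,
  [/\ forall j, windows t (C j), nondecreasing_seq C, \bigcup_j C j = W &
      forall j, (mu (C j) < +oo)%E].
Proof.
have /sigma_finiteP[F [FT ndF Foo]] := @sigma_finiteT _ _ _ m.
exists (fun j => window t [set w | F j (w 0)]); split.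
- move=> j; exists t, [set w | F j (w 0)]; split => //.
  have [mF _] := Foo j; have tt : (0 : R) <= t - t by rewrite subrr.
  exact: (path_filtration_coordinate tt mF).
- move=> i j ij; apply/subsetPset => -[s w] [/= ts Fw]; split => //=.
  by have /subsetPset := ndF _ _ ij; exact.
- apply/seteqP; split => [[s w] [j _ [/= ? _]]|[s w] [/= ? _]]; first by split.
  have : setT (w 0) by [].
  by rewrite FT => -[j _ Fj]; exists j.
- move=> j; have [mF Fj] := Foo j.
  rewrite /= /immigration_intensity product_measure2E;
    [|exact: measurable_itv|exact: (measurable_initial mF)].
  by rewrite lte_mul_pinfty// ?ge0_fin_numE// ?times_finite// mixed_initial_finite.
Qed.

Let window_count B : windows t B -> aem (fun w => N w B).
Proof.
move=> [u [A [u0 ut hA ->]]]; apply: ae_measurable_exact => B' mB'.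
apply: sub_sigma_algebra; exists (u, A); first by split => //=; rewrite u0.
by exists B' => //; rewrite setTI.
Qed.

(** A monotone class argument over the pi-system of windows. Proper differences require subtracting
    counts, which is legitimate almost surely inside the window [C] of finite intensity. *)
Let finite_count C B : windows t C -> (mu C < +oo)%E -> <<s windows t >> B ->
  aem (fun w => N w (B `&` C)).
Proof.
move=> hC Coo; have mC := windows_measurable hC.
pose H := [set B | measurable B /\ aem (fun w => N w (B `&` C))].
suff : <<s windows t >> `<=` H by move=> sub /sub[].
apply: (lambda_system_subset (@windows_setI t)) => //.
  split => //.
  - by split; [exact: measurableT|rewrite setTI; exact: window_count].
  - move=> A A' A'A [mA hA] [mA' hA']; split; first exact: measurableD.
    apply: ae_measurable_eq (ae_measurableB hA hA').
    have := poisson_finite hN mC Coo; apply: filterS => w wC.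
    rewrite (_ : (A `\` A') `&` C = (A `&` C) `\` (A' `&` C)); last first.
      apply/seteqP; split => z /=; first by move=> [[Az nA'z] Cz]; split => // -[].
      by move=> [[Az Cz] h]; split => //; split => // A'z; apply: h.
    rewrite measureD; last 3 first.
    - exact: measurableI.
    - exact: measurableI.
    - apply: le_lt_trans wC; apply: le_measure; [exact/mem_set/measurableI|exact/mem_set|].
      exact: subIsetr.
    congr (_ - N w _)%E; apply/seteqP; split => z /=; last by move=> [_].
    by move=> [A'z Cz]; split; split => //; exact: A'A.
  - move=> F ndF hF; have mF i : measurable (F i) by case: (hF i).
    split; first exact: bigcupT_measurable.
    apply: (ae_measurable_cvg (f_ := fun n w => N w (F n `&` C))).
      by move=> n; case: (hF n).
    apply: aeW => w; rewrite setI_bigcupl; apply: nondecreasing_cvg_mu.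
    - by move=> i; exact: measurableI.
    - by apply: bigcupT_measurable => i; exact: measurableI.
    - by move=> i j ij; apply/subsetPset; apply: setSI; apply/subsetPset; exact: ndF.
move=> B' hB'; split; first exact: windows_measurable hB'.
exact/window_count/windows_setI.
Qed.

Let count B : <<s windows t >> B -> aem (fun w => N w (B `&` W)).
Proof.
move=> hB; have mB := generated_measurable hB.
have [C [hC ndC CW Coo]] := exhaustion.
have mC j : measurable (C j) by exact: windows_measurable (hC j).
apply: (ae_measurable_cvg (f_ := fun n w => N w (B `&` C n))).
  by move=> n; exact: finite_count.
apply: aeW => w; rewrite -CW setI_bigcupr; apply: nondecreasing_cvg_mu.
- by move=> i; exact: measurableI.
- by apply: bigcupT_measurable => i; exact: measurableI.
- by move=> i j ij; apply/subsetPset; apply: setIS; apply/subsetPset; exact: ndC.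
Qed.

Lemma window_integral (f : g_sigma_algebraType (windows t) -> \bar R) :
  measurable_fun setT f -> (forall z, (0 <= f z)%E) ->
  aem (fun w => \int[N w]_(z in W) f z)%E.
Proof.
have sub (g : g_sigma_algebraType (windows t) -> \bar R) : measurable_fun setT g ->
    measurable_fun W (g : measurableTypeR R * D R -> \bar R).
  move=> mg; apply: measurable_funTS => _ B mB; apply: generated_measurable.
  exact: (mg measurableT B mB).
move: f; apply: ge0_measurable_ind.
- move=> A hA; have mA : measurable (A : set (measurableTypeR R * D R)) by exact:
    (generated_measurable hA).
  rewrite (_ : (fun w => _) = (fun w => N w (A `&` W))); first exact: count.
  by apply/funext => w; rewrite integral_indic.
- move=> k f k0 mf f0 hf.
  rewrite (_ : (fun w => _) = (fun w => k%:E * \int[N w]_(z in W) f z)%E).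
    by apply: (ae_measurable_comp (h := fun x => (k%:E * x)%E)) => //; exact: measurable_funeM.
  by apply/funext => w; rewrite ge0_integralZl//; exact: sub.
- move=> f g mf f0 hf mg g0 hg.
  rewrite (_ : (fun w => _) = (fun w => \int[N w]_(z in W) f z + \int[N w]_(z in W) g z)%E).
    exact: ae_measurableD.
  by apply/funext => w; rewrite ge0_integralD//; exact: sub.
- move=> f_ f mf f0 ndf ff hf.
  have -> : f = fun z => limn (f_ ^~ z).
    by apply/funext => z; apply/esym/cvg_lim => //; exact: ff.
  apply: (ae_measurable_cvg hf); apply: aeW => w.
  apply: cvg_monotone_convergence => // n; exact: sub.
Qed.

End fixed_time.
End observed_windows.

(** * Left grid approximation of the immigration process *)

Section observed_immigration.
Context {R : realType}.
Notation leb := (@lebesgue_measure R).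

Definition grid_alive (t : R) n (z : measurableTypeR R * D R) : R :=
  if (0 < z.1) && (z.1 <= t) then z.2 (grid_lo n (t - z.1)) else 0.

(** The lower grid point of the age [t - s] is [q k] exactly for [t - q k.+1 < s <= t - q k]. Such a
    slab is a difference of two windows, whose common path event concerns the coordinate [q k] and
    is observed at the ages [q k] and [q k.+1]. *)
Lemma measurable_grid_alive (t : R) n :
  measurable_fun setT (grid_alive t n : g_sigma_algebraType (windows t) -> measurableTypeR R).
Proof.
move=> _ B mB; rewrite setTI.
pose q k : R := k%:R / n.+1%:R.
have q0 k : 0 <= q k by rewrite /q divr_ge0.
have qS k : q k <= q k.+1 by rewrite /q ler_wpM2r ?invr_ge0// ler_nat.
pose A k := [set w : D R | B (w (q k))].
(* In the cell that contains age [t] the lower time bound would be negative; the maximum with 0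
   makes the removed window empty there. *)
pose slab k := if q k <= t then window (t - q k) (A k) `\` window (Num.max 0 (t - q k.+1)) (A k)
  else set0.
have mslab k : measurable (slab k : set (g_sigma_algebraType (windows t))).
  rewrite /slab; case: ifP => [qt|_]; last exact: measurable0.
  apply: measurableD; apply: sub_sigma_algebra.
    exists (t - q k), (A k); split => //; rewrite ?subr_ge0// ?gerBl//.
    by apply: path_filtration_coordinate => //; rewrite opprB addrCA subrr addr0.
  exists (Num.max 0 (t - q k.+1)), (A k); split => //.
  - by rewrite le_max lexx.
  - by rewrite ge_max gerBl q0 (le_trans (q0 k)).
  - apply: path_filtration_coordinate => //; rewrite lerBrDr addrC -lerBrDr.
    by rewrite ge_max subr_ge0 qt lerB.
rewrite (_ : _ @^-1` B = (\bigcup_k slab k) `|` (if `[< B 0 >] then ~` window t setT else set0)).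
  apply: measurableU; first exact: bigcupT_measurable.
  case: asboolP => [B0|_]; last exact: measurable0.
  have [t0|t0] := ltP t 0.
    rewrite (_ : window t setT = set0) ?setC0//.
    apply/seteqP; split => -[s w] //= [/=]; rewrite in_itv/= => /andP[s0 st] _.
    by have := lt_le_trans s0 (le_trans st (ltW t0)); rewrite ltxx.
  apply: measurableC; apply: sub_sigma_algebra; exists t, setT; split => //.
  by rewrite -setC0; apply: sigma_algebraC; exact: sigma_algebra0.
apply/seteqP; split => -[s w]; rewrite /grid_alive /=.
  case: ifPn => [/andP[s0 st] Bw|st B0]; last first.
    right; case: asboolP => // _ [/=]; rewrite in_itv/= => h _.
    by rewrite h in st.
  left; have ts : 0 <= t - s by rewrite subr_ge0.
  have [qlo qhi] := (grid_index_eq n (grid_index n (t - s)) ts).1 erefl.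
  exists (grid_index n (t - s)) => //; rewrite /slab -/(q _) ifT; last first.
    by rewrite (le_trans qlo)// gerBl ltW.
  split; first by split => //=; rewrite in_itv/= s0 lerBrDr addrC -lerBrDr.
  move=> [/=]; rewrite in_itv/= s0/= le_max leNgt s0/= => h _.
  by move: qhi; rewrite ltNge -/(q _) lerBrDr addrC -lerBrDr h.
case=> [[k _]|]; last first.
  case: asboolP => // B0 h; rewrite ifN//; apply/negP => st.
  by apply: h; split => //=; rewrite in_itv.
rewrite /slab; case: ifP => // qt [[/=]]; rewrite in_itv/= => /andP[s0 sq] Aw h.
have st : s <= t by rewrite (le_trans sq)// gerBl.
rewrite s0 st/= /grid_lo (_ : grid_index n (t - s) = k)//.
apply/grid_index_eq; rewrite ?subr_ge0//; split; rewrite -/(q _).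
  by rewrite lerBrDr addrC -lerBrDr.
rewrite ltNge; apply/negP => qs; apply: h; split => //=; rewrite in_itv/= s0 le_max.
by rewrite [X in _ || X]lerBrDr addrC -lerBrDr qs orbT.
Qed.

Lemma cvg_grid_alive (t : R) (z : measurableTypeR R * D R) :
  (0 < z.1 <= t -> z.2 s @[s --> (t - z.1)^'-] --> z.2 (t - z.1)) ->
  grid_alive t n z @[n --> \oo] --> alive t z.
Proof.
rewrite /grid_alive /alive; case: ifP => [/andP[s0 st]|_ _]; last exact: cvg_cst.
move=> /(_ isT) left_cvg; set r := t - z.1 in left_cvg *.
have r0 : 0 <= r by rewrite subr_ge0.
apply/cvgrPdist_lt => e e0.
have left_e : \forall s \near r^'-, `|z.2 r - z.2 s| < e.
  by move/cvgrPdist_lt : left_cvg; exact.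
have left_r : nbhs r [set s | s < r -> `|z.2 r - z.2 s| < e] by exact: left_e.
have near_r : \forall n \near \oo, grid_lo n r < r -> `|z.2 r - z.2 (grid_lo n r)| < e.
  exact: (cvg_grid_lo r0 left_r).
apply: filterS near_r => n /= small.
(* The left limit says nothing when the grid point is [r] itself, but then the difference is 0. *)
have := grid_lo_le n r0; rewrite le_eqVlt => /orP[/eqP ->|]; last exact: small.
by rewrite subrr normr0.
Qed.

Variable m : {sigma_finite_measure set (measurableTypeR R) -> \bar R}.
Variables (delta : R) (Q : R.-pker (measurableTypeR R) ~> (D R)).
Hypothesis hQ0 : forall x, 0 <= x -> Q x [set w : D R | w 0 = x] = 1%E.
Variables (beta : {posnum R}) (d : measure_display) (Omega : measurableType d)
  (P : probability Omega R)
  (N : Omega -> {measure set (measurableTypeR R * D R) -> \bar R}).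
Hypothesis hN : poisson_random_measure P (immigration_intensity beta delta m Q) N.
Local Notation mu := (immigration_intensity beta delta m Q).
Local Notation times := (immigration_times beta delta).
Local Notation sum := (immigration_sum beta%:num delta N).

Section fixed_time.
Variable t : R.
Hypothesis t0 : 0 <= t.

(* Path values at the last grid time before the current age generate observed
   events; except at the countably many jumps of the path, which the intensity
   does not charge, they converge to [alive t]. *)
Let hbar (z : measurableTypeR R * D R) : \bar R :=
  `|limn_esup (fun n => (grid_alive t n z)%:E)|%E.

Let mhbar : measurable_fun setT (hbar : g_sigma_algebraType (windows t) -> \bar R).
Proof.
apply: measurableT_comp => //; apply: measurable_fun_limn_esup => n.
by apply/measurable_EFinP; exact: measurable_grid_alive.
Qed.

Let mhbarE : measurable_fun setT hbar.
Proof.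
move=> _ B mB; apply: generated_measurable (mhbar measurableT mB).
Qed.

Let malive : measurable_fun setT (fun z => (alive t z)%:E : \bar R).
Proof. by apply/measurable_EFinP; exact: measurable_alive. Qed.

Let Z := [set z | hbar z != (alive t z)%:E].

Let mZ : measurable Z.
Proof. by rewrite -[Z]setTI; exact: measurable_neqe. Qed.

Let section_countable (w : D R) : countable [set s | Z (s, w)].
Proof.
have := countable_jumps w; apply: sub_countable.
apply: (@card_le_trans _ _ _ ((fun r => t - r) @` [set r : R | ~ (w s @[s --> r^'-] --> w r)])).
  apply: subset_card_le => s Zs; exists (t - s); last by rewrite opprB addrCA subrr addr0.
  move=> left_cvg; move/negP: Zs; apply; apply/eqP.
  have /cvg_limn_einf_sup[_ e] : (grid_alive t n (s, w))%:E @[n --> \oo] --> (alive t (s, w))%:E.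
    by apply: cvg_EFin; [exact: nearW|exact: cvg_grid_alive].
  by rewrite /hbar e gee0_abs// lee_fin alive_ge0.
exact: card_image_le.
Qed.

(** For a fixed path the time integral is taken first: its section of [Z] is countable, and [times]
    has a density with respect to Lebesgue measure. *)
Let muZ : mu Z = 0%E.
Proof.
have m1 : measurable_fun setT (fun z => (\1_Z z)%:E : \bar R).
  by apply/measurable_EFinP; exact: measurable_indic.
rewrite -[Z]setIT -integral_indic// integral_intensity//.
apply: integral0_eq => x _; apply: integral0_eq => w _.
have ms : measurable_fun setT (fun s : measurableTypeR R => (\1_Z (s, w))%:E : \bar R).
  exact: (measurableT_comp m1 (measurable_pair2 w)).
rewrite integral_times//.
pose C : set (measurableTypeR R) := [set s | Z (s, w)].
have mC : measurable C by apply: countable_measurable (section_countable w) => s;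
  exact: measurable_set1.
rewrite (ge0_negligible_integral (N := C))//.
- apply: integral0_eq => s [_ nC].
  by rewrite indicE memNset ?mule0.
- apply: emeasurable_funM; last exact: measurable_funTS.
  by apply: measurable_funTS; apply/measurable_EFinP; apply: measurable_funM => //;
    exact: measurable_clock.
- move=> s /=; rewrite in_itv/= andbT => s0.
  by rewrite mule_ge0// lee_fin// mulr_ge0// clock_ge0// ltW.
- exact: countable_lebesgue_measure0 (section_countable w).
Qed.

Lemma ae_measurable_immigration :
  ae_measurable P (immigration_filtration N t)
    (fun w => fine (sum t w) : measurableTypeR R).
Proof.
apply: (ae_measurable_comp (h := fine : \bar R -> measurableTypeR R) (f := sum t)).
  exact: fine_measurable.
apply: (ae_measurable_eq (f1 := fun w =>
  (beta%:num * clock delta t)%:E + \int[N w]_(z in window t setT) hbar z)%E).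
  have := poisson_null hN mZ muZ; apply: filterS => w wZ.
  rewrite /immigration_sum; congr (_ + _)%E.
  transitivity (\int[N w]_(z in window t setT) (alive t z)%:E)%E.
    apply: ge0_ae_eq_integral.
    - exact: measurable_window.
    - exact: measurable_funTS.
    - exact: measurable_funTS.
    - by move=> z _; rewrite /hbar abse_ge0.
    - by move=> z _; rewrite lee_fin alive_ge0.
    exists Z; split => // z /= h; apply/eqP => e; apply: h => _; exact: e.
  apply: eq_integral => -[s p] /set_mem[/=]; rewrite in_itv/= => st _.
  by rewrite /alive /= st.
apply: (ae_measurable_comp (h := fun x => ((beta%:num * clock delta t)%:E + x)%E)
  (f := fun w => \int[N w]_(z in window t setT) hbar z)%E).
  exact: emeasurable_funD.
apply: (window_integral hQ0 hN t0) => // z.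
exact: abse_ge0.
Qed.

End fixed_time.
End observed_immigration.

Lemma immigration_filtration_mono (R : realType) d (Omega : measurableType d)
    (N : Omega -> {measure set (measurableTypeR R * D R) -> \bar R}) (s t : R) :
  s <= t -> immigration_filtration N s `<=` immigration_filtration N t.
Proof.
move=> st; apply: smallest_sub; first exact: smallest_sigma_algebra.
move=> A [[u B] /= [/andP[u0 us] hB] hA]; apply: sub_sigma_algebra; exists (u, B) => //=.
split; first by rewrite u0 (le_trans us).
by apply: path_filtration_mono hB; rewrite lerB.
Qed.

Theorem theorem6p8 (R : realType) (b c : R)
    (m : {sigma_finite_measure set (measurableTypeR R) -> \bar R})
    (hc : 0 <= c)
    (hm : (\int[m]_(u in `]0%R, +oo[) (Num.min u (u ^+ 2))%:E < +oo)%E)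
    (delta : R)
    (hdelta : derive_at_infty (branching_mechanism b c m) = delta%:E)
    (Q : R.-pker (measurableTypeR R) ~> (D R))
    (hQ : CB_law (branching_mechanism b c m) Q)
    (beta : {posnum R})
    (d : measure_display) (Omega : measurableType d) (P : probability Omega R)
    (N : Omega -> {measure set (measurableTypeR R * D R) -> \bar R})
    (hN : poisson_random_measure P (immigration_intensity beta delta m Q) N) :
  (forall t, 0 <= t ->
     {ae P, forall w, (immigration_sum beta%:num delta N t w < +oo)%E}) /\
  CBI_process (branching_mechanism b c m) (fun lambda => beta%:num * lambda)
    P (immigration_filtration N)
    (fun t w => fine (immigration_sum beta%:num delta N t w)).
Proof.
have [v [K [hv hK hQx]]] := hQ.
split; first by move=> t t0; exact: (immigration_sum_finite hc hm hdelta hv hK hQx hN t0).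
exists v, (immigration_kernel K hN); split => //.
  exact: (immigration_kernel_semigroup hc hm hdelta hv hK hQx hN).
split.
- split; last by move=> s t _; exact: immigration_filtration_mono.
  move=> t _; split; first exact: smallest_sigma_algebra.
  exact: (immigration_filtration_measurable hN).
- by move=> t w t0; exact: immigration_ge0.
- move=> t t0; split; first exact: (measurable_immigration hN t).
  by apply: (ae_measurable_immigration _ hN t0) => x /hQx[].
- move=> t r B t0 r0 mB; split; last first.
    by move=> C hC; exact: (immigration_cond_law hc hm hdelta hv hK hQx hN t0 r0 mB hC).
  apply: (ae_measurable_comp (h := fun y : measurableTypeR R => immigration_kernel K hN r y B)).
    exact: measurable_kernel.
  by apply: (ae_measurable_immigration _ hN t0) => x /hQx[].
Qed.
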